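(* Let $f$ be a probability density on $[0,\frac{\pi}{2}]$. For each $n$ draw $n$ i.i.d. random chords of the unit circle according to the random chord model with half-angle density $f$ (described in the context), let $F_n$ be the number of regions into which these $n$ chords partition the unit disc, and let $\sigma_n=\sqrt{\operatorname{Var}(F_n)}$. Then $\mathbb{E}[F_n]\sim\Theta(n^2)$ and $\sigma_n\sim\Theta(n^{3/2})$. Moreover, for all $n>5$, $$\sup_{\|h\|\le 1,\ \|h'\|\le 1}\left|\mathbb{E}\left[h\left(\frac{F_n-\mathbb{E}[F_n]}{\sigma_n}\right)\right]-\Phi h\right|\le \frac{6n^{5/2}}{\sigma_n^2}+\frac{2n^4}{\sigma_n^3},$$ where the supremum is over differentiable functions $h:\mathbb{R}\to\mathbb{R}$ with $\|h\|\le1$ and $\|h'\|\le1$, and $$\sup_{w\in\mathbb{R}}\left|P\left(\frac{F_n-\mathbb{E}[F_n]}{\sigma_n}<w\right)-\Phi(w)\right|\le \frac{14n^4}{\sigma_n^3};$$ and the two right-hand sides satisfy $\frac{6n^{5/2}}{\sigma_n^2}+\frac{2n^4}{\sigma_n^3}\sim\Theta(n^{-1/2})$ and $\frac{14n^4}{\sigma_n^3}\sim\Theta(n^{-1/2})$.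
   Context: Random chord model: a random chord of the unit circle is determined by two independent random variables: $\theta\in[0,\frac{\pi}{2}]$, a continuous random variable with probability density $f$, which is half of the central angle subtended by the chord; and the left endpoint $C$ of the chord (left as seen from the centre), uniformly distributed on the circumference. Thus if $C=e^{i\varphi}$ with $\varphi$ uniform on $[0,2\pi)$, the other endpoint is $e^{i(\varphi-2\theta)}$. The $n$ chords are i.i.d. copies of such a chord. Regions: the $n$ chords partition the unit disc into disjoint regions through which no chord passes, i.e. the connected components of the open unit disc minus the union of the chords; $F_n$ is the number of these. Notation: for $g:\mathbb{R}\to\mathbb{R}$, $\|g\|=\sup_x|g(x)|$. With $Z$ a standard normal random variable, $\Phi h=\mathbb{E}[h(Z)]$ and $\Phi(w)=P(Z<w)$. For a sequence $(a_n)$, $a_n\sim\Theta(n^i)$ means that there exist $k_2>k_1>0$ and $n_0$ such that $k_1n^i\le a_n\le k_2n^i$ for all $n>n_0$. *)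

(* Defs.v *)
From HB Require Import structures.
From mathcomp Require Import all_boot all_order all_algebra.
From mathcomp Require Import finmap.
From mathcomp Require Import all_classical all_reals all_analysis.

Set Implicit Arguments.
Unset Strict Implicit.
Unset Printing Implicit Defensive.

Import Order.TTheory GRing.Theory Num.Theory.
Import numFieldNormedType.Exports.

#[global] Open Scope classical_set_scope.
#[global] Open Scope ring_scope.

Section Geometry.
Context {R : realType}.

(* The plane is R * R; e^{ia} is (cos a, sin a). *)
Definition circle_point (a : R) : R * R := (cos a, sin a).

Definition segment (x y : R * R) : set (R * R) :=
  [set z | exists2 t : R, 0 <= t <= 1 & z = (1 - t) *: x + t *: y].

(* theta is half of the central angle, e^{i phi} the left endpoint. *)
Definition chord (theta phi : R) : set (R * R) :=
  segment (circle_point phi) (circle_point (phi - 2 * theta)).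

Definition open_disc : set (R * R) :=
  [set z | z.1 ^+ 2 + z.2 ^+ 2 < 1].

Definition chord_complement n (theta phi : 'I_n -> R) : set (R * R) :=
  open_disc `\` \bigcup_(i in [set: 'I_n]) chord (theta i) (phi i).

Definition regions n (theta phi : 'I_n -> R) : set (set (R * R)) :=
  [set connected_component (chord_complement theta phi) x
     | x in chord_complement theta phi].

(* [fset_set] is the empty set on infinite sets; [regions] is always finite,
   so this is its actual cardinality. *)
Definition num_regions n (theta phi : 'I_n -> R) : nat :=
  #|` fset_set (regions theta phi)|%fset.

End Geometry.

Section Densities.
Context {R : realType}.

Definition is_density (D : set R) (f : R -> R) : Prop :=
  [/\ measurable_fun D f, forall x, D x -> 0 <= f x
    & (\int[lebesgue_measure]_(x in D) (f x)%:E = 1)%E].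

Definition has_density d (T : measurableType d) (P : probability T R)
    (X : {RV P >-> R}) (D : set R) (f : R -> R) : Prop :=
  forall A : set R, measurable A ->
    (distribution P X A = \int[lebesgue_measure]_(x in A `&` D) (f x)%:E)%E.

Lemma two_pi_gt0 : 0 < 2 * pi :> R.
Proof. by rewrite mulr_gt0// pi_gt0. Qed.

(* [uniform_prob] is stated on the closed interval [0, 2 pi]; it is the same
   law as the uniform one on [0, 2 pi). *)
Definition uniform_angle d (T : measurableType d) (P : probability T R)
    (X : {RV P >-> R}) : Prop :=
  forall A : set R, measurable A ->
    distribution P X A = uniform_prob two_pi_gt0 A.

End Densities.

Section Independence.
Context {R : realType} d (T : measurableType d) (P : probability T R).

Definition independent_pair d1 d2 (E1 : measurableType d1)
    (E2 : measurableType d2) (X : T -> E1) (Y : T -> E2) : Prop :=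
  forall (A : set E1) (B : set E2), measurable A -> measurable B ->
    (P ((X @^-1` A) `&` (Y @^-1` B)) = P (X @^-1` A) * P (Y @^-1` B))%E.

Definition mutually_independent (I : finType) d' (E : measurableType d')
    (X : I -> T -> E) : Prop :=
  forall (J : {set I}) (A : I -> set E),
    (forall i, i \in J -> measurable (A i)) ->
    (P (\bigcap_(i in [set` J]) (X i @^-1` A i)) =
     \prod_(i in J) P (X i @^-1` A i))%E.

End Independence.

Section RandomChords.
Context {R : realType} d (T : measurableType d) (P : probability T R).

Definition is_random_chord (f : R -> R) (theta phi : {RV P >-> R}) : Prop :=
  [/\ has_density theta `[0, pi / 2] f, uniform_angle phi
    & independent_pair P theta phi].

Definition iid_random_chords (f : R -> R) n
    (theta phi : 'I_n -> {RV P >-> R}) : Prop :=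
  (forall i, is_random_chord f (theta i) (phi i)) /\
  mutually_independent P (fun (i : 'I_n) (w : T) => (theta i w, phi i w)).

Definition region_count n (theta phi : 'I_n -> {RV P >-> R}) (w : T) : R :=
  (num_regions (fun i => theta i w) (fun i => phi i w))%:R.

Definition mean (X : T -> R) : R := fine 'E_P[X]%E.

Definition sigma (X : T -> R) : R := Num.sqrt (fine 'V_P[X]%E).

Definition standardized (X : T -> R) (w : T) : R := (X w - mean X) / sigma X.

End RandomChords.

Section Distances.
Context {R : realType}.

Definition sup_norm (g : R -> R) : \bar R :=
  ereal_sup [set `|g x|%:E | x in [set: R]].

Definition test_functions : set (R -> R) :=
  [set h : R -> R | [/\ forall x : R, derivable h x 1, (sup_norm h <= 1)%E
             & (sup_norm (derive1 h) <= 1)%E]].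

Definition Phi_fun (h : R -> R) : \bar R :=
  (\int[normal_prob (0 : R) 1]_z (h z)%:E)%E.

Definition Phi (w : R) : \bar R := normal_prob (0 : R) 1 [set z | z < w].

Definition smooth_distance d (T : measurableType d) (P : probability T R)
    (W : T -> R) : \bar R :=
  ereal_sup [set (`| 'E_P[(fun x => h (W x))] - Phi_fun h |)%E
            | h in test_functions].

Definition kolmogorov_distance d (T : measurableType d)
    (P : probability T R) (W : T -> R) : \bar R :=
  ereal_sup [set (`| P [set x | (W x < w)%R] - Phi w |)%E
            | w in [set: R]].

Definition is_Theta (a : nat -> R) (i : R) : Prop :=
  exists (k1 k2 : R) (n0 : nat), [/\ 0 < k1, k1 < k2 &
    forall n, (n0 < n)%N -> k1 * n%:R `^ i <= a n <= k2 * n%:R `^ i].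

End Distances.

(* Main.v *)
(* The lines carrying the chords cut the open disc into convex sign cells, and the
   regions are these cells. When the lines are added one at a time, a new line
   creates as many cells as the pieces into which the others cut it; hence for
   chords in general position, which holds almost surely, F_n = 1 + n + S with S
   the number of crossing pairs. S is a U-statistic of degree 2 whose kernel has
   values in {0, 1}, and two chords of half-angles t and u cross with probability
   2 min(t, u) / pi. The half-angle has no atoms, so the projection of the kernel
   is not a.s. constant, and Var S is of order n^3.
   The normal approximation is Stein's method with the exchangeable pair obtained
   by resampling one coordinate. If W is S standardized and Delta_i its change when
   the i-th chord is resampled, E[W f(W)] equals 1/2 sum_i E[Delta_i (f(W) - f(W_i))]
   up to the degenerate part of S, and sum_i E[Delta_i^2 | chords] concentrates by
   the Efron-Stein inequality. For the Kolmogorov distance the remainder is bounded,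
   as in the work of Shao and Zhang, through the monotonicity of w f(w) and of the
   indicator, which leaves only sums of Delta_i |Delta_i|. *)
Require Import Defs.
From HB Require Import structures.
From mathcomp Require Import all_boot all_order all_algebra.
From mathcomp Require Import finmap.
From mathcomp Require Import all_classical all_reals all_analysis.
From mathcomp Require Import measurable_realfun ring lra.
Import Order.TTheory GRing.Theory Num.Theory.
Import numFieldNormedType.Exports.

Set Implicit Arguments.
Unset Strict Implicit.
Unset Printing Implicit Defensive.

(** * Bounded measurable functions and their expectations *)

Section BoundedMeasurable.
Context d (T : measurableType d) (R : realType).
Implicit Types f g : T -> R.

(** The constants 14, 6 and 2 are not asymptotic. Since the kernel takes values in [0, 1], Var S <=
    n^3 / 8, so the ratio n^(3/2) / sigma_n is at least sqrt 8 > 14/5; each power of this ratio that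
    the target bounds have in excess of an error term pays for the losses in that term. The sample
    spaces for different n are unrelated, and only the law of a single chord is common to them. The
    probabilistic part is therefore carried out for an arbitrary law on n-tuples that is a product
    on rectangles, and its one tool is that exchanging a coordinate with an independent copy
    preserves the joint law: this gives Efron-Stein, the exchangeable pair and the cancellation in
    the Kolmogorov remainder. A test function has a derivative that need not be continuous, so
    Taylor's bound for the Stein solution goes through the mean value theorem. F_n is a count of
    connected components, whose measurability has to be proved; it follows from the description by
    open cells, which are tested on rational points. *)

Definition bmf f := measurable_fun setT f /\ exists M : R, forall x, `|f x| <= M.

Lemma bmf_cst (c : R) : bmf (fun=> c).
Proof. by split; [exact: measurable_cst | exists `|c|]. Qed.

Lemma bmfD f g : bmf f -> bmf g -> bmf (fun x => f x + g x).
Proof.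
move=> [mf [M hM]] [mg [N hN]]; split; first exact: measurable_funD.
by exists (M + N) => x; rewrite (le_trans (ler_normD _ _))// lerD.
Qed.

Lemma bmfN f : bmf f -> bmf (fun x => - f x).
Proof.
move=> [mf [M hM]]; split; first exact: measurable_funN.
by exists M => x; rewrite normrN.
Qed.

Lemma bmfB f g : bmf f -> bmf g -> bmf (fun x => f x - g x).
Proof. by move=> bf bg; apply: bmfD => //; exact: bmfN. Qed.

Lemma bmfM f g : bmf f -> bmf g -> bmf (fun x => f x * g x).
Proof.
move=> [mf [M hM]] [mg [N hN]]; split; first exact: measurable_funM.
by exists (M * N) => x; rewrite normrM ler_pM.
Qed.

Lemma bmfX f k : bmf f -> bmf (fun x => f x ^+ k).
Proof.
move=> bf; elim: k => [|k IH].
  by under eq_fun do rewrite expr0; exact: bmf_cst.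
by under eq_fun do rewrite exprS; exact: bmfM.
Qed.

Lemma bmf_norm f : bmf f -> bmf (fun x => `|f x|).
Proof.
move=> [mf [M hM]]; split; first exact: measurableT_comp.
by exists M => x; rewrite normr_id.
Qed.

Lemma bmf_sum (I : Type) (s : seq I) (Q : pred I) (F : I -> T -> R) :
  (forall i, Q i -> bmf (F i)) -> bmf (fun x => \sum_(i <- s | Q i) F i x).
Proof.
move=> bF; elim: s => [|i s IH].
  by under eq_fun do rewrite big_nil; exact: bmf_cst.
under eq_fun do rewrite big_cons.
by case: (boolP (Q i)) => Qi //; apply: bmfD => //; exact: bF.
Qed.

Lemma bmf_indic (A : set T) : measurable A -> bmf (\1_A : T -> R).
Proof.
move=> mA; split; first exact: measurable_indic.
by exists 1 => x; rewrite indicE; case: (_ \in _); rewrite ?normr1 ?normr0.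
Qed.

Lemma bmf_le f (M : R) : measurable_fun setT f -> (forall x, `|f x| <= M) -> bmf f.
Proof. by move=> mf fM; split=> //; exists M. Qed.

End BoundedMeasurable.

Lemma bmf_comp d (T : measurableType d) d' (T' : measurableType d')
  (R : realType) (f : T' -> R) (h : T -> T') :
  bmf f -> measurable_fun setT h -> bmf (fun x => f (h x)).
Proof.
move=> [mf [M hM]] mh; split; first exact: (measurableT_comp mf mh).
by exists M => x; exact: hM.
Qed.

Section BoundedExpectation.
Context d (T : measurableType d) (R : realType) (P : probability T R).
Implicit Types f g : T -> R.

Lemma bmf_integrable f : bmf f -> P.-integrable setT (EFin \o f).
Proof.
move=> [mf [M hM]]; apply: measurable_bounded_integrable => //.
  by rewrite -ge0_fin_numE// fin_num_measure.
exists M; split; first exact: num_real.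
by move=> N MN x _ /=; rewrite (le_trans (hM x)) ?ltW.
Qed.

Lemma Ex_EFin f : bmf f -> (\int[P]_x (f x)%:E)%E = (\int[P]_x f x)%:E.
Proof.
move=> bf; rewrite /Rintegral fineK//.
exact: integrable_fin_num (bmf_integrable bf).
Qed.

Lemma Ex_cst (c : R) : \int[P]_x c = c.
Proof.
by rewrite Rintegral_cst// (congr1 fine (probability_setT P)) mulr1.
Qed.

Lemma ExD f g : bmf f -> bmf g ->
  \int[P]_x (f x + g x) = \int[P]_x f x + \int[P]_x g x.
Proof. by move=> bf bg; rewrite RintegralD//; exact: bmf_integrable. Qed.

Lemma ExB f g : bmf f -> bmf g ->
  \int[P]_x (f x - g x) = \int[P]_x f x - \int[P]_x g x.
Proof. by move=> bf bg; rewrite RintegralB//; exact: bmf_integrable. Qed.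

Lemma ExZ (c : R) f : bmf f -> \int[P]_x (c * f x) = c * \int[P]_x f x.
Proof. by move=> bf; rewrite RintegralZl//; exact: bmf_integrable. Qed.

Lemma ExZr (c : R) f : bmf f -> \int[P]_x (f x * c) = \int[P]_x f x * c.
Proof. by move=> bf; rewrite RintegralZr//; exact: bmf_integrable. Qed.

Lemma ExN f : bmf f -> \int[P]_x (- f x) = - \int[P]_x f x.
Proof.
move=> bf; rewrite -mulN1r -ExZ//.
by apply: eq_Rintegral => x _; rewrite mulN1r.
Qed.

Lemma Ex_sum (I : eqType) (s : seq I) (Q : pred I) (F : I -> T -> R) :
  (forall i, Q i -> bmf (F i)) ->
  \int[P]_x (\sum_(i <- s | Q i) F i x) = \sum_(i <- s | Q i) \int[P]_x F i x.
Proof.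
move=> bF; elim: s => [|i s IH].
  by under eq_Rintegral do rewrite big_nil; rewrite Ex_cst big_nil.
under eq_Rintegral do rewrite big_cons; rewrite big_cons.
by case: (boolP (Q i)) => Qi //; rewrite ExD ?IH//; [exact: bF | exact: bmf_sum].
Qed.

Lemma Ex_le f g : bmf f -> bmf g -> (forall x, f x <= g x) ->
  \int[P]_x f x <= \int[P]_x g x.
Proof. by move=> bf bg fg; apply: le_Rintegral => //; exact: bmf_integrable. Qed.

Lemma Ex_ge0 f : (forall x, 0 <= f x) -> 0 <= \int[P]_x f x.
Proof. by move=> f0; exact: Rintegral_ge0. Qed.

Lemma Ex_norm f : bmf f -> `|\int[P]_x f x| <= \int[P]_x `|f x|.
Proof. by move=> bf; apply: le_normr_Rintegral => //; exact: bmf_integrable. Qed.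

Lemma Ex_le_cst f (M : R) : bmf f -> (forall x, f x <= M) -> \int[P]_x f x <= M.
Proof.
by move=> bf fM; rewrite -[leRHS]Ex_cst; apply: Ex_le => //; exact: bmf_cst.
Qed.

Lemma Ex_normM f g (M : R) : bmf f -> bmf g -> (forall x, `|f x| <= M) ->
  `|\int[P]_x (f x * g x)| <= M * \int[P]_x `|g x|.
Proof.
move=> bf bg fM; rewrite (le_trans (Ex_norm (bmfM bf bg)))//.
rewrite -ExZ; last exact: bmf_norm.
apply: Ex_le => [|| x]; first exact/bmf_norm/bmfM.
  by apply: bmfM; [exact: bmf_cst | exact: bmf_norm].
by rewrite normrM ler_wpM2r.
Qed.

Lemma Ex_indic (A : set T) : measurable A -> \int[P]_x \1_A x = fine (P A).
Proof. by move=> mA; rewrite /Rintegral integral_indic// setIT. Qed.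

(* AM-GM: [2 c |f| <= f^2 + c^2] *)
Lemma Ex_norm_le f (c : R) : bmf f -> 0 < c ->
  \int[P]_x (f x ^+ 2) <= c ^+ 2 -> \int[P]_x `|f x| <= c.
Proof.
move=> bf c0 h.
have : \int[P]_x (2 * c * `|f x|) <= \int[P]_x (f x ^+ 2 + c ^+ 2).
  apply: Ex_le => [|| x].
  - by apply: bmfM; [exact: bmf_cst | exact: bmf_norm].
  - by apply: bmfD; [exact: bmfX | exact: bmf_cst].
  - by rewrite -(real_normK (num_real (f x))); have := sqr_ge0 (`|f x| - c); nra.
rewrite ExZ; last exact: bmf_norm.
rewrite ExD; [|exact: bmfX|exact: bmf_cst].
rewrite Ex_cst => h2; have : 2 * c * \int[P]_x `|f x| <= 2 * c * c by nra.
by rewrite ler_pM2l//; lra.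
Qed.

End BoundedExpectation.

(** * Fubini for bounded functions *)

Section BoundedFubini.
Context d1 d2 (T1 : measurableType d1) (T2 : measurableType d2) (R : realType).
Variables (P1 : probability T1 R) (P2 : probability T2 R).
Implicit Types G : T1 * T2 -> R.

Lemma bmf_pairl G (y : T2) : bmf G -> bmf (fun x => G (x, y)).
Proof. by move=> bG; apply: (bmf_comp bG); exact: measurable_pair2. Qed.

Lemma bmf_pairr G (x : T1) : bmf G -> bmf (fun y => G (x, y)).
Proof. by move=> bG; apply: (bmf_comp bG); exact: measurable_pair1. Qed.

Lemma bmf_fst (f : T1 -> R) : bmf f -> bmf (fun z : T1 * T2 => f z.1).
Proof. by move=> bf; apply: (bmf_comp bf). Qed.

Lemma bmf_snd (f : T2 -> R) : bmf f -> bmf (fun z : T1 * T2 => f z.2).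
Proof. by move=> bf; apply: (bmf_comp bf). Qed.

Lemma bmf_integrable_prod G : bmf G ->
  (P1 \x P2)%E.-integrable setT (EFin \o G).
Proof.
move=> bG; apply/integrable12ltyP.
  by apply/measurable_EFinP; case: bG.
under eq_integral => x _.
  under eq_integral => y _ do rewrite /=.
  rewrite (Ex_EFin P2 (bmf_norm (bmf_pairr x bG))). over.
case: (bG) => mG [M hM].
apply: (@le_lt_trans _ _ (\int[P1]_x (M%:E))%E).
  apply: ge0_le_integral => //.
  - by move=> x _; rewrite lee_fin Ex_ge0.
  - rewrite (_ : (fun x => _) =
      fubini_F P2 (fun z : T1 * T2 => `|G z|%:E)); last first.
      apply/funext => x; rewrite -Ex_EFin//.
      exact: bmf_norm (bmf_pairr _ bG).
    apply: measurable_fun_fubini_tonelli_F => //; apply/measurable_EFinP.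
    by have [] := bmf_norm bG.
  - move=> x _; rewrite lee_fin; apply: Ex_le_cst => //.
    exact: bmf_norm (bmf_pairr _ bG).
rewrite integral_cst//; apply: (@le_lt_trans _ _ (M%:E * 1)%E).
  by rewrite le_eqVlt; apply/orP/or_introl/eqP; congr (_ * _)%E;
    exact: probability_setT.
by rewrite mule1 ltry.
Qed.

Lemma bmf_Exr G : bmf G -> bmf (fun x => \int[P2]_y G (x, y)).
Proof.
move=> bG; case: (bG) => mG [M hM]; split; last first.
  exists M => x; rewrite (le_trans (Ex_norm _ (bmf_pairr _ bG)))//.
  by apply: Ex_le_cst => //; exact: bmf_norm (bmf_pairr _ bG).
apply/measurable_EFinP.
rewrite (_ : EFin \o _ = fubini_F P2 (EFin \o G)); last first.
  by apply/funext => x; rewrite /= -Ex_EFin//; exact: bmf_pairr.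
exact: (measurable_fubini_F (bmf_integrable_prod bG)).
Qed.

Lemma Ex_prod G : bmf G -> (\int[P1 \x P2]_z (G z)%:E)%E =
  (\int[P1]_x \int[P2]_y G (x, y))%:E.
Proof.
move=> bG; rewrite -(integral12_prod_meas1 (bmf_integrable_prod bG)).
rewrite -Ex_EFin; last exact: bmf_Exr.
by apply: eq_integral => x _; rewrite -Ex_EFin//; exact: bmf_pairr.
Qed.

End BoundedFubini.

Section BoundedFubiniSwap.
Context d1 d2 (T1 : measurableType d1) (T2 : measurableType d2) (R : realType).
Variables (P1 : probability T1 R) (P2 : probability T2 R).

Lemma bmf_swap (G : T1 * T2 -> R) : bmf G -> bmf (fun z : T2 * T1 => G (z.2, z.1)).
Proof.
move=> bG; apply: (bmf_comp bG).
exact: (@measurable_fun_pair _ _ _ (T2 * T1)%type T1 T2 snd fst).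
Qed.

Lemma Ex_Fubini (G : T1 * T2 -> R) : bmf G ->
  \int[P1]_x \int[P2]_y G (x, y) = \int[P2]_y \int[P1]_x G (x, y).
Proof.
move=> bG; apply: EFin_inj; rewrite -!Ex_EFin; first last.
- exact: bmf_Exr bG.
- exact: (@bmf_Exr _ _ _ _ _ P2 P1 _ (bmf_swap bG)).
have := Fubini (bmf_integrable_prod P1 P2 bG) => /= h.
rewrite (eq_integral (fun x => \int[P2]_y (G (x, y))%:E)%E); last first.
  by move=> x _; rewrite Ex_EFin//; exact: bmf_pairr.
rewrite h; by apply: eq_integral => y _; rewrite -Ex_EFin//; exact: bmf_pairl.
Qed.

End BoundedFubiniSwap.

(** * Product laws on tuples and resampling of one coordinate *)

Section IidTuple.
Context dE (E : measurableType dE) (R : realType) (n : nat).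
Variables (mu : probability E R) (Q : probability (n.-tuple E) R).
Local Notation Om := (n.-tuple E).

Definition rect (A : 'I_n -> set E) : set Om :=
  [set x | forall i, A i (tnth x i)].

(** The law is prescribed only on rectangles, which is what mutual independence of the chords
    provides directly; rectangles are a pi-system generating the sigma-algebra of tuples, so this
    determines [Q]. *)
Definition iid_law := forall A : 'I_n -> set E, (forall i, measurable (A i)) ->
  (Q (rect A) = \prod_i mu (A i))%E.

Definition upd (x : Om) (i : 'I_n) (y : E) : Om :=
  [tuple if k == i then y else tnth x k | k < n].

Lemma tnth_upd x i y k : tnth (upd x i y) k = if k == i then y else tnth x k.
Proof. by rewrite tnth_mktuple. Qed.

Lemma upd_upd x i y z : upd (upd x i y) i z = upd x i z.
Proof. by apply: eq_from_tnth => k; rewrite !tnth_upd; case: eqP. Qed.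

Lemma updC x i j y z : i != j -> upd (upd x i y) j z = upd (upd x j z) i y.
Proof.
move=> ij; apply: eq_from_tnth => k; rewrite !tnth_upd.
by case: (eqVneq k j) => [->|//]; rewrite eq_sym (negbTE ij).
Qed.

Lemma upd_tnth x i : upd x i (tnth x i) = x.
Proof. by apply: eq_from_tnth => k; rewrite tnth_upd; case: eqP => [->|]. Qed.

Lemma measurable_upd i : measurable_fun setT (fun z : Om * E => upd z.1 i z.2).
Proof.
apply/measurable_fun_tnthP => k; rewrite /comp.
under eq_fun do rewrite tnth_upd.
case: (k == i); first exact: measurable_snd.
exact: (measurableT_comp (measurable_tnth k) measurable_fst).
Qed.

(** The exchange of the coordinate [i] with an independent copy: an involution, shown below to
    preserve [Q \x mu]. *)
Definition swapm i (z : Om * E) : Om * E := (upd z.1 i z.2, tnth z.1 i).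

Lemma measurable_swapm i : measurable_fun setT (swapm i).
Proof.
apply: measurable_fun_pair; first exact: measurable_upd.
exact: (measurableT_comp (measurable_tnth i) measurable_fst).
Qed.

Definition rects : set (set Om) :=
  [set X | exists2 A : 'I_n -> set E, (forall i, measurable (A i)) & X = rect A].

Lemma rect_bigcap (A : 'I_n -> set E) :
  rect A = (\bigcap_(i in [set: 'I_n]) ((fun x : Om => tnth x i) @^-1` A i))%classic.
Proof. by apply/seteqP; split => x h i; [move=> _; exact: h | exact: h]. Qed.

Lemma measurable_rect (A : 'I_n -> set E) :
  (forall i, measurable (A i)) -> measurable (rect A).
Proof.
move=> mA; rewrite rect_bigcap.
apply: fin_bigcap_measurable => // i _.
by rewrite -[X in measurable X]setTI; exact: measurable_tnth.
Qed.

Lemma measurable_rects : @measurable _ Om = <<s rects >>.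
Proof.
apply/seteqP; split; last first.
  apply: smallest_sub; first exact: sigma_algebra_measurable.
  by move=> _ [A mA ->]; exact: measurable_rect.
apply: smallest_sub; first exact: smallest_sigma_algebra.
rewrite -bigcup_seq => X /= [i _ [B mB <-]].
apply: sub_gen_smallest; exists (fun k => if k == i then B else setT).
  by move=> k; case: ifP.
apply/seteqP; split => [x [_ /= Bx] k|x h].
  by case: eqP => [->|].
by split=> //=; have := h i; rewrite eqxx.
Qed.

Lemma setI_closed_rects : setI_closed rects.
Proof.
move=> _ _ [A mA ->] [B mB ->]; exists (fun i => A i `&` B i).
  by move=> i; exact: measurableI.
apply/seteqP; split => [x [hA hB] i|x h]; first by split.
by split=> i; have [] := h i.
Qed.

Hypothesis iidQ : iid_law.

(** For fixed [B] both sides are finite measures in [A], so it suffices to compare them on the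
    rectangles [rect C], where the exchange only permutes the factors [mu (C i)] and [mu B]. *)
Lemma swapm_rect i (B : set E) (A : set Om) : measurable B -> measurable A ->
  ((Q \x mu) (swapm i @^-1` (A `*` B)) = Q A * mu B)%E.
Proof.
move=> mB mA.
have mD : measurable [set z : Om * E | B (tnth z.1 i)].
  rewrite -[X in measurable X]setTI.
  exact: (measurableT_comp (measurable_tnth i) measurable_fst).
have mup : measurable_fun setT (fun z : Om * E => upd z.1 i z.2).
  exact: measurable_upd.
have muBfin : mu B \is a fin_num by exact: fin_num_measure.
pose nu1f : {measure set Om -> \bar R} :=
  pushforward (mrestr (Q \x mu)%E mD) (fun z : Om * E => upd z.1 i z.2).
pose nu1 := nu1f mup.
pose r : {nonneg R} := NngNum (fine_ge0 (measure_ge0 mu B)).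
pose nu2 : {measure set Om -> \bar R} := mscale r Q.
have e1 X : nu1 X = (Q \x mu)%E (swapm i @^-1` (X `*` B)).
  by rewrite /nu1 /nu1f /= /pushforward /mrestr; congr ((Q \x mu)%E _).
have e2 X : nu2 X = (Q X * mu B)%E.
  by transitivity ((fine (mu B))%:E * Q X)%E; [by []|rewrite fineK// muleC].
rewrite -e1 -e2.
apply: (measure_unique rects (fun=> setT)) => //.
- exact: measurable_rects.
- exact: setI_closed_rects.
- by move=> _; exists (fun=> setT) => //; apply/seteqP; split.
- by rewrite bigcup_const.
- move=> _ [C mC ->]; rewrite e1 e2.
  have -> : swapm i @^-1` (rect C `*` B) =
      rect (fun k => if k == i then B else C k) `*` C i.
    apply/seteqP; split => -[x y] /= [h1 h2]; split.
    + move=> k /=; case: (eqVneq k i) => [->//|ki].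
      by have := h1 k; rewrite /= tnth_upd (negbTE ki).
    + by have := h1 i; rewrite /= tnth_upd eqxx.
    + move=> k /=; rewrite tnth_upd; case: (eqVneq k i) => [->//|ki].
      by have := h1 k; rewrite /= (negbTE ki).
    + by have := h1 i; rewrite /= eqxx.
  rewrite product_measure1E//; last first.
    by apply: measurable_rect => k; case: ifP.
  have mC' k : measurable (if k == i then B else C k) by case: ifP.
  rewrite (iidQ mC); apply: (eq_trans (congr1 ( *%E^~ (mu (C i))) (iidQ mC'))).
  rewrite /= (bigD1 i)//= eqxx [in RHS](bigD1 i)//=.
  rewrite (eq_bigr (fun k => mu (C k))); last by move=> k /negbTE ->.
  by rewrite muleC (muleC (mu B)) muleA.
- move=> _; rewrite e1; apply: (@le_lt_trans _ _ ((Q \x mu)%E setT)).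
    apply: le_measure; rewrite ?inE//.
    rewrite -[X in measurable X]setTI; apply: measurable_swapm => //.
    exact: measurableX.
  rewrite -setXTT product_measure1E//.
  apply: lte_mul_pinfty => //; rewrite ?fin_num_measure//.
  by rewrite -ge0_fin_numE// fin_num_measure.
Qed.

(** The image of [Q \x mu] under [swapm i] agrees with [Q \x mu] on products, hence everywhere. *)
Lemma Ex_swap i (G : Om * E -> R) : bmf G ->
  \int[Q]_x \int[mu]_y G (x, y) =
  \int[Q]_x \int[mu]_y G (upd x i y, tnth x i).
Proof.
move=> bG; apply: EFin_inj; rewrite -Ex_prod//.
have bG' : bmf (G \o swapm i) by apply: bmf_comp bG (measurable_swapm i).
rewrite -(Ex_prod Q mu bG').
pose m'f : {measure set (Om * E) -> \bar R} :=
  pushforward (Q \x mu)%E (swapm i).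
pose m' := m'f (measurable_swapm i).
rewrite (eq_measure_integral m'); last first.
  move=> A mA _; apply: product_measure_unique => // B C mB mC.
  exact: swapm_rect.
rewrite integral_pushforward//.
- exact: measurable_swapm.
- by apply/measurable_EFinP; case: bG.
- exact: bmf_integrable_prod bG'.
Qed.

(** Conditional expectation given all coordinates except [i]. *)
Definition avgi i (H : Om -> R) (x : Om) : R := \int[mu]_y H (upd x i y).

Lemma bmf_upd i (H : Om -> R) : bmf H -> bmf (fun z : Om * E => H (upd z.1 i z.2)).
Proof. by move=> bH; apply: (bmf_comp bH); exact: measurable_upd. Qed.

Lemma bmf_avgi i (H : Om -> R) : bmf H -> bmf (avgi i H).
Proof. by move=> bH; exact: (bmf_Exr Q mu (bmf_upd i bH)). Qed.

Lemma Ex_avgi i (H : Om -> R) : bmf H -> \int[Q]_x avgi i H x = \int[Q]_x H x.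
Proof.
move=> bH; have := Ex_swap i (@bmf_fst _ _ _ E _ _ bH) => /= <-.
by apply: eq_Rintegral => x _; rewrite Ex_cst.
Qed.

Lemma Ex_tnth i (h : E -> R) : bmf h -> \int[Q]_x h (tnth x i) = \int[mu]_y h y.
Proof.
move=> bh; have := Ex_swap i (@bmf_snd _ _ Om _ _ _ bh) => /=.
rewrite Ex_cst => ->.
by apply: eq_Rintegral => x _; rewrite Ex_cst.
Qed.

Lemma bmf_tnth i (h : E -> R) : bmf h -> bmf (fun x : Om => h (tnth x i)).
Proof. by move=> bh; apply: (bmf_comp bh); exact: measurable_tnth. Qed.

(** * The Efron-Stein inequality with bounded differences *)

Section EfronStein.
Variable c : 'I_n -> R.

Definition bounded_differences (H : Om -> R) :=
  forall i x y, `|H x - H (upd x i y)| <= c i.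

Lemma bounded_differences_avgi i H : bmf H -> bounded_differences H ->
  bounded_differences (avgi i H).
Proof.
move=> bH hH k x y; have [->|ki] := eqVneq k i.
  rewrite (_ : avgi i H x - _ = 0) ?normr0.
    exact: le_trans (hH i x y).
  apply/eqP; rewrite subr_eq0; apply/eqP; apply: eq_Rintegral => z _.
  by rewrite upd_upd.
have b1 w : bmf (fun z => H (upd w i z)) by exact: (bmf_pairr w (bmf_upd i bH)).
rewrite /avgi -ExB//; apply: (le_trans (Ex_norm _ (bmfB (b1 _) (b1 _)))).
apply: Ex_le_cst; first exact/bmf_norm/bmfB.
by move=> z; rewrite updC.
Qed.

(** Exchanging the coordinate [i] with its copy flips the sign of [H x - H (upd x i y)], so the left
    side is half the expectation of the product of the increments of [F] and [H]. [F] is kept apart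
    from [H] because only the second factor is averaged further in the telescoping sum. *)
Lemma Ex_mul_sub_avgi i (F H : Om -> R) : bmf F -> bmf H ->
  bounded_differences F -> bounded_differences H ->
  \int[Q]_x (F x * (H x - avgi i H x)) <= 2^-1 * c i ^+ 2.
Proof.
move=> bF bH dF dH.
have bFz := @bmf_fst _ _ _ E _ _ bF.
have bHz := @bmf_fst _ _ _ E _ _ bH.
have bFu := bmf_upd i bF.
have bHu := bmf_upd i bH.
have bG1 : bmf (fun z : Om * E => F z.1 * (H z.1 - H (upd z.1 i z.2))).
  by apply: bmfM => //; exact: bmfB.
have bG2 : bmf (fun z : Om * E => F (upd z.1 i z.2) * (H z.1 - H (upd z.1 i z.2))).
  by apply: bmfM => //; exact: bmfB.
have e1 : \int[Q]_x (F x * (H x - avgi i H x)) =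
    \int[Q]_x \int[mu]_y (F x * (H x - H (upd x i y))).
  apply: eq_Rintegral => x _.
  rewrite ExZ; last by apply: bmfB; [exact: bmf_cst | exact: (bmf_pairr x bHu)].
  rewrite ExB; [|exact: bmf_cst|exact: (bmf_pairr x bHu)].
  by rewrite Ex_cst.
have e2 : \int[Q]_x \int[mu]_y (F x * (H x - H (upd x i y))) =
    - \int[Q]_x \int[mu]_y (F (upd x i y) * (H x - H (upd x i y))).
  rewrite (Ex_swap i bG1) /= -ExN; last exact: (bmf_Exr Q mu bG2).
  apply: eq_Rintegral => x _; rewrite -ExN; last exact: (bmf_pairr x bG2).
  apply: eq_Rintegral => y _ /=.
  by rewrite upd_upd upd_tnth -mulrN opprB.
have e3 : \int[Q]_x \int[mu]_y ((F x - F (upd x i y)) * (H x - H (upd x i y))) =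
  \int[Q]_x \int[mu]_y (F x * (H x - H (upd x i y))) -
  \int[Q]_x \int[mu]_y (F (upd x i y) * (H x - H (upd x i y))).
  rewrite -ExB; [|exact: (bmf_Exr Q mu bG1)|exact: (bmf_Exr Q mu bG2)].
  apply: eq_Rintegral => x _.
  rewrite -ExB; [|exact: (bmf_pairr x bG1)|exact: (bmf_pairr x bG2)].
  by apply: eq_Rintegral => y _; rewrite mulrBl.
have : \int[Q]_x \int[mu]_y ((F x - F (upd x i y)) * (H x - H (upd x i y))) <=
    c i ^+ 2.
  have bG : bmf (fun z : Om * E =>
     (F z.1 - F (upd z.1 i z.2)) * (H z.1 - H (upd z.1 i z.2))).
    by apply: bmfM; exact: bmfB.
  apply: Ex_le_cst => [|x]; first exact: (bmf_Exr Q mu bG).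
  apply: Ex_le_cst => [|y]; first exact: (bmf_pairr x bG).
  apply: (le_trans (ler_norm _)); rewrite normrM expr2.
  exact: ler_pM.
rewrite e3 -[X in _ - X]opprK -e2 opprK e1 => h.
by rewrite ler_pdivlMl// mulr_natl mulr2n.
Qed.

Fixpoint avgs (s : seq 'I_n) (H : Om -> R) : Om -> R :=
  if s is i :: s' then avgs s' (avgi i H) else H.

Lemma bmf_avgs s H : bmf H -> bmf (avgs s H).
Proof. by elim: s H => //= i s IH H bH; exact/IH/bmf_avgi. Qed.

Lemma Ex_avgs s H : bmf H -> \int[Q]_x avgs s H x = \int[Q]_x H x.
Proof.
elim: s H => //= i s IH H bH; rewrite IH; last exact: bmf_avgi.
by rewrite Ex_avgi.
Qed.

(** [D] collects the coordinates already averaged out; once every coordinate has been, the function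
    is constant. *)
Lemma avgs_indep s H (D : {pred 'I_n}) :
  (forall x x', (forall k, k \notin D -> tnth x k = tnth x' k) -> H x = H x') ->
  forall x x', (forall k, k \notin D -> k \notin s -> tnth x k = tnth x' k) ->
  avgs s H x = avgs s H x'.
Proof.
elim: s H D => [|i s IH] H D hH x x' xx' /=.
  by apply: hH => k kD; exact: xx'.
apply: (IH _ [predU1 i & D]) => [z z' h|k].
  apply: eq_Rintegral => y _; apply: hH => k kD; rewrite !tnth_upd.
  by case: eqVneq => // ki; apply: h; rewrite inE negb_or ki.
rewrite inE negb_or => /andP[ki kD] ks; apply: xx' => //.
by rewrite inE negb_or ki.
Qed.

Lemma Ex_mul_sub_avgs s (F H : Om -> R) : bmf F -> bmf H ->
  bounded_differences F -> bounded_differences H ->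
  \int[Q]_x (F x * (H x - avgs s H x)) <= 2^-1 * \sum_(i <- s) c i ^+ 2.
Proof.
move=> bF bH dF; elim: s H bH => [|i s IH] H bH dH /=.
  under eq_Rintegral do rewrite subrr mulr0.
  by rewrite Ex_cst big_nil mulr0.
rewrite big_cons mulrDr.
have bA := bmf_avgi i bH.
have dA := bounded_differences_avgi i bH dH.
rewrite (_ : \int[Q]_x _ = \int[Q]_x (F x * (H x - avgi i H x)) +
   \int[Q]_x (F x * (avgi i H x - avgs s (avgi i H) x))); last first.
  rewrite -ExD.
  - by apply: eq_Rintegral => x _; ring.
  - by apply: bmfM => //; exact: bmfB.
  - by apply: bmfM => //; apply: bmfB => //; exact: bmf_avgs.
by apply: lerD; [exact: Ex_mul_sub_avgi | exact: IH].
Qed.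

(** The variance is E[H (H - E H)], and [H - E H] telescopes through the successive averages over
    single coordinates; each average keeps the bounded differences. *)
Lemma Efron_Stein (H : Om -> R) : bmf H -> bounded_differences H ->
  \int[Q]_x ((H x - \int[Q]_y H y) ^+ 2) <= 2^-1 * \sum_i c i ^+ 2.
Proof.
move=> bH dH.
set m := \int[Q]_y H y.
have avgE x : avgs (enum 'I_n) H x = m.
  rewrite /m -(Ex_avgs (enum 'I_n) bH) -[LHS](Ex_cst Q).
  apply: eq_Rintegral => y _.
  apply: (@avgs_indep _ _ pred0) => [{}x x' h|k _].
    by congr H; apply: eq_from_tnth => k; exact: h.
  by rewrite mem_enum.
have -> : \int[Q]_x ((H x - m) ^+ 2) =
    \int[Q]_x (H x * (H x - avgs (enum 'I_n) H x)).
  transitivity (\int[Q]_x (H x * (H x - m) - m * (H x - m))).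
    by apply: eq_Rintegral => x _; ring.
  have bm : bmf (fun x => H x - m) by apply: bmfB => //; exact: bmf_cst.
  rewrite ExB; [|exact: bmfM|by apply: bmfM => //; exact: bmf_cst].
  rewrite ExZ// ExB//; last exact: bmf_cst.
  rewrite Ex_cst -/m subrr mulr0 subr0.
  by apply: eq_Rintegral => x _; rewrite avgE.
by rewrite -big_enum; exact: Ex_mul_sub_avgs.
Qed.

End EfronStein.

End IidTuple.

Ltac bmf_solve := repeat (match goal with
  | |- bmf _ => first [assumption | solve [auto 2] | apply: bmf_cst | apply: bmfB | apply: bmfD
     | apply: bmfN | apply: bmfM | apply: bmfX | apply: bmf_norm
     | apply: bmf_sum; move=> *]
  end).

Lemma sum_cst (R : realType) n (c : R) : \sum_(i < n) c = n%:R * c.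
Proof. by rewrite sumr_const card_ord mulr_natl. Qed.

Lemma sum_neq1 (R : realType) n (i : 'I_n) (c : R) :
  \sum_(j < n | j != i) c = (n%:R - 1) * c.
Proof.
have h : \sum_(k < n) c = c + \sum_(j < n | j != i) c by rewrite (bigD1 i).
by rewrite mulrBl mul1r -sum_cst h addrC addKr.
Qed.

(** * Hoeffding decomposition of a U-statistic of degree 2 *)

Section Ustatistic.
Context dE (E : measurableType dE) (R : realType) (n : nat).
Variables (mu : probability E R) (Q : probability (n.-tuple E) R).
Local Notation Om := (n.-tuple E).
Hypothesis iidQ : iid_law mu Q.
Variable psi : E -> E -> R.
Hypothesis mpsi : measurable_fun setT (fun z : E * E => psi z.1 z.2).
Hypothesis psi_ge0 : forall a b, 0 <= psi a b.
Hypothesis psi_le1 : forall a b, psi a b <= 1.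
Hypothesis psi_sym : forall a b, psi a b = psi b a.

Definition Ustat (x : Om) : R :=
  2^-1 * \sum_i \sum_(j | j != i) psi (tnth x i) (tnth x j).
Definition proj1U (b : E) : R := \int[mu]_y psi y b.
Definition meanU : R := \int[mu]_b proj1U b.
(** Hoeffding's degenerate kernel: integrating it in either variable gives 0, which makes distinct
    pairs uncorrelated. *)
Definition psit a b : R := psi a b - proj1U a - proj1U b + meanU.
Definition degU (x : Om) : R :=
  2^-1 * \sum_i \sum_(j | j != i) psit (tnth x i) (tnth x j).
Definition var1U : R := \int[mu]_b ((proj1U b - meanU) ^+ 2).
Definition vardU : R := \int[mu]_b \int[mu]_y (psit y b ^+ 2).

Local Notation g := proj1U.
Local Notation p := meanU.
Local Notation N := (n%:R : R).

Let bpsi : bmf (fun z : E * E => psi z.1 z.2).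
Proof.
by apply: (bmf_le (M := 1)) => // x; rewrite ger0_norm.
Qed.

Let bg : bmf g. Proof. exact: (bmf_Exr mu mu (bmf_swap bpsi)). Qed.

Lemma g_bounds b : 0 <= g b <= 1.
Proof.
have bpb : bmf (fun y => psi y b) by exact: (bmf_pairl b bpsi).
by apply/andP; split; [exact: Ex_ge0 | exact: Ex_le_cst].
Qed.

Lemma meanU_bounds : 0 <= p <= 1.
Proof.
apply/andP; split; first by apply: Ex_ge0 => b; case/andP: (g_bounds b).
by apply: Ex_le_cst => // b; case/andP: (g_bounds b).
Qed.

Lemma psit_sym a b : psit a b = psit b a.
Proof. by rewrite /psit psi_sym; ring. Qed.

Let bpsit : bmf (fun z : E * E => psit z.1 z.2).
Proof.
have b1 := @bmf_fst _ _ E E _ _ bg; have b2 := @bmf_snd _ _ E E _ _ bg.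
by rewrite /psit; bmf_solve.
Qed.

Lemma Ex_psit b : \int[mu]_y psit y b = 0.
Proof.
have bpb : bmf (fun y => psi y b) by exact: (bmf_pairl b bpsi).
transitivity (\int[mu]_y (psi y b - g y + (p - g b))).
  by apply: eq_Rintegral => y _; rewrite /psit; ring.
rewrite ExD ?ExB ?Ex_cst; try by bmf_solve.
by rewrite -/(g b) -/p; ring.
Qed.

Lemma bmf_pair_tnth (K : E * E -> R) i j : bmf K ->
  bmf (fun x : Om => K (tnth x i, tnth x j)).
Proof.
move=> bK; apply: (bmf_comp bK).
by apply: measurable_fun_pair; exact: measurable_tnth.
Qed.

Lemma Ex_pair_tnth (K : E * E -> R) i j : bmf K -> i != j ->
  \int[Q]_x K (tnth x i, tnth x j) = \int[mu]_b \int[mu]_y K (y, b).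
Proof.
move=> bK ij; rewrite -(Ex_avgi iidQ i (bmf_pair_tnth i j bK)).
have bh := bmf_Exr mu mu (bmf_swap bK).
rewrite -[RHS](Ex_tnth iidQ j bh).
apply: eq_Rintegral => x _; apply: eq_Rintegral => y _.
by rewrite !tnth_upd eqxx eq_sym (negbTE ij).
Qed.

Lemma psit_orthogonal (X : Om -> R) i j : bmf X -> i != j ->
  (forall x y, X (upd x i y) = X x) ->
  \int[Q]_x (psit (tnth x i) (tnth x j) * X x) = 0.
Proof.
move=> bX ij hX.
have b1 := bmf_pair_tnth i j bpsit.
rewrite -(Ex_avgi iidQ i (bmfM b1 bX)) -[RHS](Ex_cst Q).
apply: eq_Rintegral => x _.
transitivity (\int[mu]_y (psit y (tnth x j) * X x)).
  apply: eq_Rintegral => y _.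
  by rewrite /= hX !tnth_upd eqxx eq_sym (negbTE ij).
by rewrite ExZr ?Ex_psit ?mul0r//; exact: (bmf_pairl _ bpsit).
Qed.

(** Unless [(k, l)] and [(i, j)] have the same elements, one of [i], [j] differs from both [k] and
    [l], and integrating over that coordinate gives 0. The two orders appear separately since the
    sums run over ordered pairs. *)
Lemma Ex_psit_psit i j k l : i != j ->
  \int[Q]_x (psit (tnth x i) (tnth x j) * psit (tnth x k) (tnth x l)) =
  (if (k, l) == (i, j) then vardU else 0) +
  (if (k, l) == (j, i) then vardU else 0).
Proof.
move=> ij.
have b1 := bmf_pair_tnth k l bpsit.
have hv : \int[Q]_x (psit (tnth x i) (tnth x j) ^+ 2) = vardU.
  exact: (Ex_pair_tnth (bmfX 2 bpsit) ij).
rewrite !xpair_eqE; have [ki|ki] := eqVneq k i.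
  subst k; rewrite (negbTE ij) /= addr0; have [lj|lj] := eqVneq l j.
    by subst l; rewrite -hv; apply: eq_Rintegral => x _; rewrite expr2.
  transitivity (\int[Q]_x (psit (tnth x j) (tnth x i) *
      psit (tnth x i) (tnth x l))).
    by apply: eq_Rintegral => x _; rewrite (psit_sym (tnth x i) (tnth x j)).
  apply: psit_orthogonal => // [|x y]; first by rewrite eq_sym.
  by rewrite !tnth_upd (negbTE ij) (negbTE lj).
rewrite /= add0r; have [kj|kj] := eqVneq k j.
  subst k; have [li|li] := eqVneq l i.
    subst l; rewrite -hv; apply: eq_Rintegral => x _.
    by rewrite (psit_sym (tnth x j)) expr2.
  apply: psit_orthogonal => // x y.
  by rewrite !tnth_upd (negbTE ki) (negbTE li).
have [li|li] := eqVneq l i; last first.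
  apply: psit_orthogonal => // x y.
  by rewrite !tnth_upd (negbTE ki) (negbTE li).
subst l; transitivity (\int[Q]_x (psit (tnth x j) (tnth x i) *
      psit (tnth x k) (tnth x i))).
  by apply: eq_Rintegral => x _; rewrite (psit_sym (tnth x i) (tnth x j)).
apply: psit_orthogonal => // [|x y]; first by rewrite eq_sym.
by rewrite !tnth_upd (negbTE kj) (negbTE ij).
Qed.

Let bpsitx i j : bmf (fun x : Om => psit (tnth x i) (tnth x j)).
Proof. exact: (bmf_pair_tnth i j bpsit). Qed.

Let bpsix i j : bmf (fun x : Om => psi (tnth x i) (tnth x j)).
Proof. exact: (bmf_pair_tnth i j bpsi). Qed.

Lemma bmf_degU : bmf degU. Proof. by rewrite /degU; bmf_solve. Qed.

Lemma bmf_Ustat : bmf Ustat. Proof. by rewrite /Ustat; bmf_solve. Qed.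

Lemma sum_neq_cst (c : R) : \sum_(i < n) \sum_(j < n | j != i) c = N * (N - 1) * c.
Proof. by rewrite (eq_bigr _ (fun i _ => sum_neq1 i c)) sum_cst mulrA. Qed.

Lemma Ex_degU_sqr : \int[Q]_x (degU x ^+ 2) = 2^-1 * (N * (N - 1) * vardU).
Proof.
transitivity (2^-1 * \int[Q]_x (\sum_i \sum_(j | j != i)
    (psit (tnth x i) (tnth x j) * degU x))).
  rewrite -ExZ; last by have bD := bmf_degU; bmf_solve.
  apply: eq_Rintegral => x _; rewrite expr2 {1}/degU -mulrA; congr (_ * _).
  by rewrite mulr_suml; apply: eq_bigr => i _; rewrite mulr_suml.
congr (_ * _); have bD := bmf_degU.
rewrite Ex_sum; last by move=> i _; bmf_solve.
rewrite -sum_neq_cst; apply: eq_bigr => i _.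
rewrite Ex_sum; last by move=> j _; bmf_solve.
apply: eq_bigr => j ji; have ij : i != j by rewrite eq_sym.
transitivity (\int[Q]_x (2^-1 * \sum_k \sum_(l | l != k)
    (psit (tnth x i) (tnth x j) * psit (tnth x k) (tnth x l)))).
  apply: eq_Rintegral => x _; rewrite /degU mulrCA; congr (_ * _).
  by rewrite mulr_sumr; apply: eq_bigr => k _; rewrite mulr_sumr.
rewrite ExZ; last by bmf_solve.
rewrite Ex_sum; last by move=> k _; bmf_solve.
under eq_bigr => k _.
  rewrite Ex_sum; last by move=> l _; bmf_solve.
  under eq_bigr => l lk do rewrite Ex_psit_psit//.
  over.
rewrite pair_big_dep /= big_split /=.
rewrite (bigD1 (i, j)) //= eqxx [X in _ * (_ + X + _)]big1 ?addr0; last first.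
  by case=> k l /= /andP[_ /negbTE]; rewrite xpair_eqE => ->.
rewrite (bigD1 (j, i)) //= eqxx [X in _ * (_ + (_ + X))]big1 ?addr0; last first.
  by case=> k l /= /andP[_ /negbTE]; rewrite xpair_eqE => ->.
by field.
Qed.

Let m := 2^-1 * (N * (N - 1) * p).

(** Hoeffding decomposition; the factor [N - 1] is the number of pairs containing a given
    coordinate. *)
Lemma Ustat_decomp x :
  Ustat x - m = (N - 1) * \sum_i (g (tnth x i) - p) + degU x.
Proof.
have e1 : \sum_(i < n) \sum_(j < n | j != i) g (tnth x i) =
    (N - 1) * \sum_i g (tnth x i).
  rewrite mulr_sumr; apply: eq_bigr => i _.
  exact: sum_neq1.
have e2 : \sum_(i < n) \sum_(j < n | j != i) g (tnth x j) =
    (N - 1) * \sum_i g (tnth x i).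
  rewrite (exchange_big_dep xpredT)//= -e1; apply: eq_bigr => i _.
  by apply: eq_bigl => j; rewrite eq_sym.
have e3 : \sum_(i < n) \sum_(j < n | j != i) psit (tnth x i) (tnth x j) =
    \sum_(i < n) \sum_(j < n | j != i) psi (tnth x i) (tnth x j) -
    \sum_(i < n) \sum_(j < n | j != i) g (tnth x i) -
    \sum_(i < n) \sum_(j < n | j != i) g (tnth x j) + N * (N - 1) * p.
  rewrite -sum_neq_cst -!sumrB -big_split; apply: eq_bigr => i _ /=.
  by rewrite -!sumrB -big_split.
rewrite /degU e3 e1 e2 sumrB sum_cst.
by rewrite /Ustat /m; field.
Qed.

Lemma var1U_sum : \int[Q]_x ((\sum_i (g (tnth x i) - p)) ^+ 2) = N * var1U.
Proof.
have bgx i : bmf (fun x : Om => g (tnth x i)) := bmf_tnth i bg.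
transitivity (\int[Q]_x (\sum_i \sum_j
    ((g (tnth x i) - p) * (g (tnth x j) - p)))).
  apply: eq_Rintegral => x _; rewrite expr2 mulr_suml; apply: eq_bigr => i _.
  by rewrite mulr_sumr.
rewrite Ex_sum; last by move=> i _; bmf_solve.
rewrite -sum_cst; apply: eq_bigr => i _.
rewrite Ex_sum; last by move=> j _; bmf_solve.
rewrite (bigD1 i)//= big1 ?addr0.
  transitivity (\int[Q]_x ((g (tnth x i) - p) ^+ 2)).
    by apply: eq_Rintegral => x _; rewrite expr2.
  have bh : bmf (fun b => (g b - p) ^+ 2) by bmf_solve.
  exact: (Ex_tnth iidQ i bh).
move=> j ji; have ij : i != j by rewrite eq_sym.
have bK : bmf (fun z : E * E => (g z.1 - p) * (g z.2 - p)).
  have b1 := @bmf_fst _ _ E E _ _ bg; have b2 := @bmf_snd _ _ E E _ _ bg.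
  by bmf_solve.
rewrite (Ex_pair_tnth bK ij) /= -[RHS](Ex_cst mu); apply: eq_Rintegral => b _.
rewrite ExZr; last by bmf_solve.
by rewrite ExB; [rewrite Ex_cst subrr mul0r|bmf_solve|bmf_solve].
Qed.

Lemma Ex_linU_degU :
  \int[Q]_x ((\sum_i (g (tnth x i) - p)) * degU x) = 0.
Proof.
have bgx i : bmf (fun x : Om => g (tnth x i)) := bmf_tnth i bg.
have bD := bmf_degU.
transitivity (2^-1 * \int[Q]_x (\sum_i \sum_(j | j != i) \sum_k
    (psit (tnth x i) (tnth x j) * (g (tnth x k) - p)))).
  rewrite -ExZ; last by bmf_solve.
  apply: eq_Rintegral => x _; rewrite /degU mulrCA; congr (_ * _).
  rewrite mulrC mulr_suml; apply: eq_bigr => i _; rewrite mulr_suml.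
  by apply: eq_bigr => j _; rewrite mulr_sumr.
rewrite Ex_sum; last by move=> i _; bmf_solve.
rewrite big1 ?mulr0// => i _.
rewrite Ex_sum; last by move=> j _; bmf_solve.
rewrite big1// => j ji; have ij : i != j by rewrite eq_sym.
rewrite Ex_sum; last by move=> k _; bmf_solve.
rewrite big1// => k _; have [ki|ki] := eqVneq k i; last first.
  apply: (psit_orthogonal (X := fun x => g (tnth x k) - p)) => // [|x y].
    by bmf_solve.
  by rewrite tnth_upd (negbTE ki).
subst k; transitivity (\int[Q]_x (psit (tnth x j) (tnth x i) *
      (g (tnth x i) - p))).
  by apply: eq_Rintegral => x _; rewrite (psit_sym (tnth x i)).
apply: (psit_orthogonal (X := fun x => g (tnth x i) - p)) => // [|x y].
  by bmf_solve.
by rewrite tnth_upd (negbTE ij).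
Qed.

Lemma Ex_Ustat_degU : \int[Q]_x ((Ustat x - m) * degU x) =
  2^-1 * (N * (N - 1) * vardU).
Proof.
have bgx i : bmf (fun x : Om => g (tnth x i)) := bmf_tnth i bg.
have bD := bmf_degU.
rewrite -Ex_degU_sqr -[RHS]add0r -(mulr0 (N - 1)) -Ex_linU_degU.
rewrite -ExZ; last by bmf_solve.
rewrite -ExD; [|by bmf_solve|by bmf_solve].
by apply: eq_Rintegral => x _; rewrite Ustat_decomp; ring.
Qed.

Lemma var_Ustat : \int[Q]_x ((Ustat x - m) ^+ 2) =
  N * (N - 1) ^+ 2 * var1U + 2^-1 * (N * (N - 1) * vardU).
Proof.
have bgx i : bmf (fun x : Om => g (tnth x i)) := bmf_tnth i bg.
have bD := bmf_degU; have bU := bmf_Ustat.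
pose la (x : Om) := \sum_i (g (tnth x i) - p).
have bla : bmf la by rewrite /la; bmf_solve.
transitivity (\int[Q]_x ((N - 1) ^+ 2 * la x ^+ 2 + (N - 1) * (la x * degU x) +
    (Ustat x - m) * degU x)).
  by apply: eq_Rintegral => x _; rewrite Ustat_decomp -/(la x); ring.
rewrite !ExD ?ExZ; try by bmf_solve.
by rewrite Ex_Ustat_degU Ex_linU_degU var1U_sum; ring.
Qed.

Lemma Ex_Ustat : \int[Q]_x Ustat x = m.
Proof.
rewrite /Ustat ExZ; last by bmf_solve.
rewrite Ex_sum; last by move=> i _; bmf_solve.
rewrite /m -sum_neq_cst; congr (_ * _); apply: eq_bigr => i _.
rewrite Ex_sum; last by move=> j _; bmf_solve.
apply: eq_bigr => j ji; have ij : i != j by rewrite eq_sym.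
by rewrite (Ex_pair_tnth bpsi ij).
Qed.

Lemma vardU_ge0 : 0 <= vardU.
Proof. by apply: Ex_ge0 => b; apply: Ex_ge0 => y; exact: sqr_ge0. Qed.

Lemma var1U_ge0 : 0 <= var1U.
Proof. by apply: Ex_ge0 => b; exact: sqr_ge0. Qed.

(** The left side is the variance of [psi] under [mu \x mu], by orthogonality of its Hoeffding
    components; a [0, 1]-valued variable of mean [p] has variance at most [p - p^2 <= 1/4]. *)
Lemma vardU_var1U : vardU + 2 * var1U <= 1 / 4.
Proof.
have b1 := @bmf_fst _ _ E E _ _ bg; have b2 := @bmf_snd _ _ E E _ _ bg.
have bp b : bmf (fun y => psi y b) by exact: (bmf_pairl b bpsi).
have bt b : bmf (fun y => psit y b) by exact: (bmf_pairl b bpsit).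
have bg2 : bmf (fun y => (g y - p) ^+ 2) by bmf_solve.
have bT2 : bmf (fun b => \int[mu]_y (psit y b ^+ 2)).
  exact: (bmf_Exr mu mu (bmf_swap (bmfX 2 bpsit))).
have bTg : bmf (fun z : E * E => psit z.1 z.2 * (g z.1 - p)) by bmf_solve.
have bTg' : bmf (fun b => \int[mu]_y (psit y b * (g y - p))).
  exact: (bmf_Exr mu mu (bmf_swap bTg)).
have hgp : \int[mu]_y (g y - p) = 0.
  by rewrite ExB; [rewrite Ex_cst subrr|bmf_solve|bmf_solve].
have e b : \int[mu]_y ((psi y b - p) ^+ 2) = \int[mu]_y (psit y b ^+ 2) +
    (var1U + (g b - p) ^+ 2 + 2 * \int[mu]_y (psit y b * (g y - p))).
  transitivity (\int[mu]_y (psit y b ^+ 2 + ((g y - p) ^+ 2 + (g b - p) ^+ 2 +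
      2 * (psit y b * (g y - p))) + (2 * (g b - p) * psit y b +
      2 * (g b - p) * (g y - p)))).
    by apply: eq_Rintegral => y _; rewrite /psit; ring.
  have bt' := bt b.
  rewrite !ExD; try by bmf_solve.
  rewrite Ex_cst !ExZ; try by bmf_solve.
  by rewrite Ex_psit hgp !mulr0 !addr0.
have e0 : \int[mu]_b \int[mu]_y (psit y b * (g y - p)) = 0.
  have := Ex_Fubini mu mu bTg => /= <-.
  rewrite -[RHS](Ex_cst mu); apply: eq_Rintegral => y _.
  rewrite ExZr; last by exact: (bmf_pairr y bpsit).
  under eq_Rintegral do rewrite psit_sym.
  by rewrite Ex_psit mul0r.
have E1 : \int[mu]_b \int[mu]_y ((psi y b - p) ^+ 2) = vardU + 2 * var1U.
  under eq_Rintegral do rewrite e.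
  rewrite !ExD; try by bmf_solve.
  rewrite Ex_cst ExZ// e0 mulr0 addr0 -/vardU -/var1U.
  by rewrite mulr_natl mulr2n.
rewrite -E1; have /andP[p0 p1] := meanU_bounds.
apply: (@le_trans _ _ (\int[mu]_b (g b * (1 - 2 * p) + p ^+ 2))).
  have bE : bmf (fun b => \int[mu]_y ((psi y b - p) ^+ 2)).
    have b3 : bmf (fun z : E * E => (psi z.1 z.2 - p) ^+ 2) by bmf_solve.
    exact: (bmf_Exr mu mu (bmf_swap b3)).
  apply: Ex_le => [//||b]; first by bmf_solve.
  have bpb := bp b.
  apply: (@le_trans _ _ (\int[mu]_y (psi y b * (1 - 2 * p) + p ^+ 2))).
    apply: Ex_le => [||y]; [by bmf_solve|by bmf_solve|].
    by have := psi_ge0 y b; have := psi_le1 y b; nra.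
  by rewrite ExD ?ExZr ?Ex_cst; try by bmf_solve.
rewrite ExD ?ExZr ?Ex_cst; try by bmf_solve.
by have := sqr_ge0 (p - 2^-1); rewrite -/p; nra.
Qed.

End Ustatistic.

Lemma Ex_dist d (T : measurableType d) (R : realType) (P : probability T R)
  (a b : T -> R) (C : R) : bmf a -> bmf b -> (forall y, `|a y - b y| <= C) ->
  `|\int[P]_y a y - \int[P]_y b y| <= C.
Proof.
move=> ba bb h; rewrite -ExB// (le_trans (Ex_norm _ _))//; first exact: bmfB.
by apply: Ex_le_cst => //; exact/bmf_norm/bmfB.
Qed.

Definition below (R : realType) (z x : R) : R := (x < z)%R%:R.

(** * Stein's method for the U-statistic *)

Section SteinUstatistic.
Context dE (E : measurableType dE) (R : realType) (n : nat).
Variables (mu : probability E R) (Q : probability (n.-tuple E) R).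
Local Notation Om := (n.-tuple E).
Hypothesis iidQ : iid_law mu Q.
Variable psi : E -> E -> R.
Hypothesis mpsi : measurable_fun setT (fun z : E * E => psi z.1 z.2).
Hypothesis psi_ge0 : forall a b, 0 <= psi a b.
Hypothesis psi_le1 : forall a b, psi a b <= 1.
Hypothesis psi_sym : forall a b, psi a b = psi b a.
Hypothesis n_gt1 : (1 < n)%N.

Local Notation g := (proj1U mu psi).
Local Notation p := (meanU mu psi).
Local Notation N := (n%:R : R).
Local Notation m := (2^-1 * (N * (N - 1) * p)).
Local Notation S := (Ustat (n:=n) psi).
Local Notation D := (degU (n:=n) mu psi).

Variable s : R.
Hypothesis s_gt0 : 0 < s.
Hypothesis s2E : s ^+ 2 = \int[Q]_x ((S x - m) ^+ 2).

Definition stdU (x : Om) : R := (S x - m) / s.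
Local Notation W := stdU.
Definition incrU i (x : Om) (y : E) : R := W x - W (upd x i y).
Local Notation Del := incrU.
Local Notation M := ((N - 1) / s).

Let bpsi : bmf (fun z : E * E => psi z.1 z.2).
Proof. by apply: (bmf_le (M := 1)) => // x; rewrite ger0_norm. Qed.

Let bS : bmf S. Proof. exact: bmf_Ustat. Qed.
Let bD : bmf D. Proof. exact: bmf_degU. Qed.
Let bW : bmf W. Proof. by rewrite /W; bmf_solve. Qed.
Let bW1 : bmf (fun z : Om * E => W z.1). Proof. exact: bmf_fst bW. Qed.
Let bWu i : bmf (fun z : Om * E => W (upd z.1 i z.2)).
Proof. exact: bmf_upd bW. Qed.
Let bDel i : bmf (fun z : Om * E => Del i z.1 z.2).
Proof. by rewrite /Del; bmf_solve. Qed.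
Let bDelx i x : bmf (fun y => Del i x y).
Proof. exact: (bmf_pairr x (bDel i)). Qed.

(** Isolates the terms containing the coordinate [i]; the others cancel in [incrU]. *)
Lemma Ustat_split i x : S x = \sum_(j | j != i) psi (tnth x i) (tnth x j) +
  2^-1 * \sum_(k | k != i) \sum_(l | (l != k) && (l != i))
    psi (tnth x k) (tnth x l).
Proof.
rewrite /Ustat (bigD1 i)//=.
rewrite [X in _ * (_ + X)](eq_bigr (fun k => psi (tnth x i) (tnth x k) +
  \sum_(l | (l != k) && (l != i)) psi (tnth x k) (tnth x l))); last first.
  by move=> k ki; rewrite (bigD1 i) 1?eq_sym//= psi_sym.
by rewrite big_split /=; field.
Qed.

Lemma incrUE i x y :
  Del i x y = s^-1 * \sum_(j | j != i) (psi (tnth x i) (tnth x j) - psi y (tnth x j)).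
Proof.
rewrite /Del /W -mulrBl mulrC; congr (_ * _).
rewrite (Ustat_split i x) (Ustat_split i (upd x i y)) sumrB.
have -> : \sum_(j | j != i) psi (tnth (upd x i y) i) (tnth (upd x i y) j) =
    \sum_(j | j != i) psi y (tnth x j).
  by apply: eq_bigr => j ji; rewrite !tnth_upd eqxx (negbTE ji).
have -> : \sum_(k | k != i) \sum_(l | (l != k) && (l != i))
      psi (tnth (upd x i y) k) (tnth (upd x i y) l) =
    \sum_(k | k != i) \sum_(l | (l != k) && (l != i)) psi (tnth x k) (tnth x l).
  apply: eq_bigr => k ki; apply: eq_bigr => l /andP[_ li].
  by rewrite !tnth_upd (negbTE ki) (negbTE li).
by ring.
Qed.

Let M_ge0 : 0 <= M.
Proof. by rewrite divr_ge0 ?(ltW s_gt0)// subr_ge0 ler1n ltnW. Qed.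

Lemma incrU_le i x y : `|Del i x y| <= M.
Proof.
rewrite incrUE normrM gtr0_norm ?invr_gt0// mulrC ler_wpM2r ?invr_ge0 ?(ltW s_gt0)//.
rewrite (le_trans (ler_norm_sum _ _ _))//.
rewrite -[leRHS]mulr1 -(sum_neq1 i); apply: ler_sum => j _.
have := psi_ge0 y (tnth x j); have := psi_le1 y (tnth x j).
have := psi_ge0 (tnth x i) (tnth x j); have := psi_le1 (tnth x i) (tnth x j).
by rewrite ler_norml; lra.
Qed.

(** Only the summand [j = k] of the increment sees the resampling of [k], and it changes by at most
    2. *)
Lemma incrU_upd_le i k x y z : k != i ->
  `|Del i x y - Del i (upd x k z) y| <= 2 / s.
Proof.
move=> ki; rewrite !incrUE -mulrBr normrM gtr0_norm ?invr_gt0// mulrC.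
rewrite ler_wpM2r ?invr_ge0 ?(ltW s_gt0)//.
rewrite -sumrB (bigD1 k)//= big1 ?addr0; last first.
  move=> j /andP[ji jk].
  by rewrite !tnth_upd [i == k]eq_sym (negbTE ki) (negbTE jk) subrr.
rewrite !tnth_upd [i == k]eq_sym (negbTE ki) eqxx.
have := psi_ge0 y (tnth x k); have := psi_le1 y (tnth x k).
have := psi_ge0 (tnth x i) (tnth x k); have := psi_le1 (tnth x i) (tnth x k).
have := psi_ge0 y z; have := psi_le1 y z.
have := psi_ge0 (tnth x i) z; have := psi_le1 (tnth x i) z.
by rewrite ler_norml; lra.
Qed.

Lemma incrU_swap i x y : Del i (upd x i y) (tnth x i) = - Del i x y.
Proof. by rewrite /Del upd_upd upd_tnth opprB. Qed.

(** The sum of the mean increments counts the linear part of [S] once and the degenerate part twice,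
    which leaves the excess [D x / s] over [W x]. *)
Lemma sum_Ex_incrU x : \sum_i \int[mu]_y Del i x y = W x + D x / s.
Proof.
have bpx b : bmf (fun y => psi y b) by exact: (bmf_pairl b bpsi).
have e1 i : \int[mu]_y Del i x y =
    s^-1 * \sum_(j | j != i) (psi (tnth x i) (tnth x j) - g (tnth x j)).
  transitivity (\int[mu]_y (s^-1 *
      \sum_(j | j != i) (psi (tnth x i) (tnth x j) - psi y (tnth x j)))).
    by apply: eq_Rintegral => y _; rewrite incrUE.
  rewrite ExZ; last by bmf_solve.
  rewrite Ex_sum; last by move=> j _; bmf_solve.
  congr (_ * _); apply: eq_bigr => j _.
  by rewrite ExB ?Ex_cst//; bmf_solve.
have e2 : \sum_(i < n) \sum_(j < n | j != i) g (tnth x j) =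
    (N - 1) * \sum_i g (tnth x i).
  rewrite (exchange_big_dep xpredT)//= mulr_sumr; apply: eq_bigr => i _.
  by rewrite -(sum_neq1 i); apply: eq_bigl => j; rewrite eq_sym.
rewrite (eq_bigr _ (fun i _ => e1 i)) -mulr_sumr.
have -> : \sum_(i < n) \sum_(j < n | j != i) (psi (tnth x i) (tnth x j) - g (tnth x j)) =
    2 * S x - (N - 1) * \sum_i g (tnth x i).
  rewrite -e2 /Ustat mulrA divff// mul1r -sumrB; apply: eq_bigr => i _.
  by rewrite sumrB.
have := Ustat_decomp mu psi x; rewrite sumrB sumr_const card_ord -[p *+ n]mulr_natl.
move=> h; rewrite /W; have {h} : S x = m + ((N - 1) *
   (\sum_i g (tnth x i) - N * p) + D x) by rewrite -h; ring.
move=> ->; field; exact: lt0r_neq0.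
Qed.

Definition sqrU (x : Om) : R := 2^-1 * \sum_i \int[mu]_y (Del i x y ^+ 2).
Definition signsqrU (x : Om) : R := \sum_i \int[mu]_y (Del i x y * `|Del i x y|).
Local Notation Qb := sqrU.
Local Notation Kb := signsqrU.

Let bI (G : Om -> E -> R) : bmf (fun z : Om * E => G z.1 z.2) ->
  bmf (fun x => \int[mu]_y G x y).
Proof. by move=> bG; exact: (bmf_Exr Q mu bG). Qed.

Let bQi i : bmf (fun x => \int[mu]_y (Del i x y ^+ 2)).
Proof. by apply: bI; bmf_solve. Qed.

Let bKi i : bmf (fun x => \int[mu]_y (Del i x y * `|Del i x y|)).
Proof. by apply: bI; bmf_solve. Qed.

Let bQb : bmf Qb. Proof. by rewrite /sqrU; bmf_solve. Qed.
Let bKb : bmf Kb. Proof. by rewrite /signsqrU; bmf_solve. Qed.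

(** [Del] changes sign under the exchange, so each integral on the right is twice E[F(W) Del];
    [sum_Ex_incrU] then evaluates the sum over [i]. *)
Lemma exchangeable_pair (F : R -> R) : bmf (fun x => F (W x)) ->
  \int[Q]_x (F (W x) * W x) + \int[Q]_x (F (W x) * (D x / s)) =
  2^-1 * \sum_i \int[Q]_x \int[mu]_y (Del i x y * (F (W x) - F (W (upd x i y)))).
Proof.
move=> bF.
have bF1 := @bmf_fst _ _ Om E _ _ bF; have bFu i := bmf_upd i bF.
have e i : \int[Q]_x \int[mu]_y (Del i x y * (F (W x) - F (W (upd x i y)))) =
    2 * \int[Q]_x \int[mu]_y (F (W x) * Del i x y).
  have bG1 : bmf (fun z : Om * E => F (W z.1) * Del i z.1 z.2).
    by bmf_solve.
  have bG2 : bmf (fun z : Om * E => F (W (upd z.1 i z.2)) * Del i z.1 z.2).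
    by bmf_solve.
  have e1 : \int[Q]_x \int[mu]_y (F (W x) * Del i x y) =
      - \int[Q]_x \int[mu]_y (F (W (upd x i y)) * Del i x y).
    rewrite (Ex_swap iidQ i bG1) /= -ExN; last exact: (bI bG2).
    apply: eq_Rintegral => x _; rewrite -ExN; last exact: (bmf_pairr x bG2).
    by apply: eq_Rintegral => y _; rewrite incrU_swap mulrN.
  rewrite mulr_natl mulr2n {2}e1 -ExB; [|exact: (bI bG1)|exact: (bI bG2)].
  apply: eq_Rintegral => x _.
  rewrite -ExB; [|exact: (bmf_pairr x bG1)|exact: (bmf_pairr x bG2)].
  by apply: eq_Rintegral => y _; ring.
rewrite (eq_bigr _ (fun i _ => e i)) -mulr_sumr mulrA mulVf// mul1r.
rewrite -ExD; [|by bmf_solve|by bmf_solve].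
rewrite -Ex_sum; last first.
  by move=> i _; apply: bI; bmf_solve.
apply: eq_Rintegral => x _; rewrite -mulrDr -sum_Ex_incrU mulr_sumr.
by apply: eq_bigr => i _; rewrite ExZ.
Qed.

Let degvar := \int[Q]_x (D x ^+ 2).

Lemma Ex_stdU_sqr : \int[Q]_x (W x * W x) = 1.
Proof.
transitivity (\int[Q]_x (s^-2 * (S x - m) ^+ 2)).
  apply: eq_Rintegral => x _; rewrite /W; field; exact: lt0r_neq0.
rewrite ExZ; last by bmf_solve.
by rewrite -s2E mulVf// expf_neq0// lt0r_neq0.
Qed.

(** The case [F = id] of [exchangeable_pair]: E[W^2] = 1, and the degenerate part contributes its
    own variance. *)
Lemma Ex_sqrU : \int[Q]_x Qb x = 1 + degvar / s ^+ 2.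
Proof.
have := exchangeable_pair (F := id) bW; rewrite Ex_stdU_sqr.
have -> : \int[Q]_x (W x * (D x / s)) = degvar / s ^+ 2.
  rewrite /degvar (Ex_degU_sqr iidQ mpsi psi_ge0 psi_le1 psi_sym).
  rewrite -(Ex_Ustat_degU iidQ mpsi psi_ge0 psi_le1 psi_sym) -ExZr; last by bmf_solve.
  apply: eq_Rintegral => x _; rewrite /W; field; exact: lt0r_neq0.
move=> ->; rewrite /sqrU ExZ; last by bmf_solve.
rewrite Ex_sum//; congr (_ * _); apply: eq_bigr => i _.
Qed.

(** [Del |Del|] is odd under the exchange. *)
Lemma Ex_signsqrU : \int[Q]_x Kb x = 0.
Proof.
rewrite /signsqrU Ex_sum// big1// => i _.
have bG : bmf (fun z : Om * E => Del i z.1 z.2 * `|Del i z.1 z.2|).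
  by bmf_solve.
have h : \int[Q]_x \int[mu]_y (Del i x y * `|Del i x y|) =
    - \int[Q]_x \int[mu]_y (Del i x y * `|Del i x y|).
  rewrite {1}(Ex_swap iidQ i bG) /= -ExN; last exact: (bI bG).
  apply: eq_Rintegral => x _; rewrite -ExN; last exact: (bmf_pairr x bG).
  by apply: eq_Rintegral => y _; rewrite incrU_swap normrN mulNr.
by apply/eqP; rewrite -[_ == _](mulrn_eq0 _ 2) mulr2n {2}h subrr.
Qed.

(** Resampling [k] moves the [k]-th summand by at most [M^2] and each of the other [N - 1] by at
    most [(2 / s) (2 M)], in total [5 M^2]; the sum carries a factor 1/2. *)
Lemma sqrU_bounded_differences :
  bounded_differences (fun=> 5 / 2 * M ^+ 2) Qb.
Proof.
move=> k x z; rewrite /sqrU -mulrBr normrM gtr0_norm ?invr_gt0//.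
rewrite -[leRHS]mulrA [5 * _]mulrCA ler_wpM2l ?invr_ge0// -sumrB.
rewrite (le_trans (ler_norm_sum _ _ _))// (bigD1 k)//=.
have b2 i x0 : bmf (fun y => Del i x0 y ^+ 2) by bmf_solve.
have -> : 5 * M ^+ 2 = M ^+ 2 + (N - 1) * (2 / s * (2 * M)) by field; exact: lt0r_neq0.
rewrite -(sum_neq1 k (2 / s * (2 * M))); apply: lerD.
  apply: Ex_dist => // y; 
  have sqrn t : t ^+ 2 = `|t| ^+ 2 :> R by rewrite real_normK ?num_real.
  rewrite (sqrn (Del k x y)) (sqrn (Del k (upd x k z) y)).
  have h1 := incrU_le k x y; have h2 := incrU_le k (upd x k z) y.
  rewrite ler_norml; apply/andP; split.
    have : `|Del k (upd x k z) y| ^+ 2 <= M ^+ 2 by rewrite lerXn2r ?nnegrE.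
    by have := sqr_ge0 `|Del k x y|; lra.
  have : `|Del k x y| ^+ 2 <= M ^+ 2 by rewrite lerXn2r ?nnegrE.
  by have := sqr_ge0 `|Del k (upd x k z) y|; lra.
apply: ler_sum => i ik; apply: Ex_dist => // y.
rewrite subr_sqr normrM ler_pM//; first by apply: incrU_upd_le; rewrite eq_sym.
rewrite (le_trans (ler_normD _ _))// mulr_natl mulr2n.
by apply: lerD; exact: incrU_le.
Qed.

(** As for [sqrU], except that the [k]-th summand is signed and may move by [2 M^2], and that there
    is no factor 1/2: hence 2 + 4 = 6. *)
Lemma signsqrU_bounded_differences :
  bounded_differences (fun=> 6 * M ^+ 2) Kb.
Proof.
move=> k x z; rewrite /signsqrU -sumrB.
rewrite (le_trans (ler_norm_sum _ _ _))// (bigD1 k)//=.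
have b2 i x0 : bmf (fun y => Del i x0 y * `|Del i x0 y|) by bmf_solve.
have -> : 6 * M ^+ 2 = 2 * M ^+ 2 + (N - 1) * (2 / s * (2 * M)) by field; exact: lt0r_neq0.
rewrite -(sum_neq1 k (2 / s * (2 * M))); apply: lerD.
  apply: Ex_dist => // y.
  have h1 := incrU_le k x y; have h2 := incrU_le k (upd x k z) y.
  rewrite (le_trans (ler_normB _ _))// !normrM !normr_id mulr_natl mulr2n expr2.
  by apply: lerD; apply: ler_pM.
apply: ler_sum => i ik; apply: Ex_dist => // y.
set a := Del i x y; set b := Del i (upd x k z) y.
have -> : a * `|a| - b * `|b| = a * (`|a| - `|b|) + (a - b) * `|b| by ring.
have ha : `|a| <= M by exact: incrU_le.
have hb : `|b| <= M by exact: incrU_le.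
have hab : `|a - b| <= 2 / s by apply: incrU_upd_le; rewrite eq_sym.
rewrite (le_trans (ler_normD _ _))// !normrM normr_id.
have := ler_dist_dist a b => hd.
have -> : 2 / s * (2 * M) = M * (2 / s) + (2 / s) * M by ring.
apply: lerD; apply: ler_pM => //; exact: le_trans hd hab.
Qed.

(** Units for the error terms: [N / s = q w], [N^(5/2) / s^2 = q^2 w] and [N^4 / s^3 = q^3 w]. The
    target bounds become [14 q^3 w] and [6 q^2 w + 2 q^3 w], while [q] is bounded below and [w]
    above. *)
Let r : R := Num.sqrt N.
Let q : R := r ^+ 3 / s.
Let w : R := r^-1.

Let r_gt0 : 0 < r. Proof. by rewrite sqrtr_gt0 ltr0n ltnW. Qed.
Let NE : N = r ^+ 2. Proof. by rewrite sqr_sqrtr// ler0n. Qed.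
Let r_neq0 : r != 0. Proof. exact: lt0r_neq0. Qed.
Let s_neq0 : s != 0. Proof. exact: lt0r_neq0. Qed.
Let w_gt0 : 0 < w. Proof. by rewrite invr_gt0. Qed.
Let q_gt0 : 0 < q. Proof. by rewrite divr_gt0// exprn_gt0. Qed.
Let NsE : N / s = q * w. Proof. by rewrite NE /q /w; field; rewrite r_neq0. Qed.
Let N_ge2 : 2 <= N. Proof. by rewrite ler_nat. Qed.
Let w_le : w ^+ 2 <= 1 / 2.
Proof.
have h := N_ge2; have h0 : 0 < N by rewrite (lt_le_trans _ h).
by rewrite mul1r /w exprVn -NE lef_pV2 ?posrE.
Qed.

(** Under [2 v + tau <= 1/4] the variance formula attains its largest value [N (N - 1)^2 / 8] at
    [v = 1/8], [tau = 0]. *)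
Lemma stdU_var_le : s ^+ 2 <= N ^+ 3 / 8.
Proof.
rewrite s2E (var_Ustat iidQ mpsi psi_ge0 psi_le1 psi_sym).
have := vardU_var1U mu mpsi psi_ge0 psi_le1 psi_sym.
have := vardU_ge0 mu psi; have := var1U_ge0 mu psi.
set v := var1U mu psi; set tau := vardU mu psi => v0 t0 h; have hN2 := N_ge2.
have hN : 0 <= N * (N - 1) by apply: mulr_ge0; lra.
have e : N * (N - 1) ^+ 2 * v + 2^-1 * (N * (N - 1) * tau) =
  N * (N - 1) * ((N - 2) * v + 2^-1 * (2 * v + tau)) by field.
rewrite e; apply: (@le_trans _ _ (N * (N - 1) * ((N - 1) / 8))).
  apply: ler_wpM2l => //; have : (N - 2) * v <= (N - 2) * (1 / 8).
    by apply: ler_wpM2l; lra.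
  lra.
have -> : N * (N - 1) * ((N - 1) / 8) = N * (N - 1) ^+ 2 / 8 by field.
by rewrite ler_wpM2r// [N ^+ 3]exprS ler_wpM2l ?ler0n// ler_pXn2r ?nnegrE//; lra.
Qed.

(** [q^2 = N^3 / s^2 >= 8], and [(14/5)^2 = 7.84]. *)
Let q_ge : 14 / 5 <= q.
Proof.
rewrite ler_pdivlMr// -(@ler_pXn2r _ 2)// ?nnegrE ?mulr_ge0 ?exprn_ge0 ?(ltW s_gt0) ?(ltW
  r_gt0)//.
rewrite exprMn -exprM mulnC exprM -NE; have h := stdU_var_le.
have h2 : 0 <= N ^+ 3 by rewrite exprn_ge0 ?ler0n.
lra.
Qed.

Let degvar_le : degvar <= N ^+ 2 / 8.
Proof.
rewrite /degvar (Ex_degU_sqr iidQ mpsi psi_ge0 psi_le1 psi_sym).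
have := vardU_var1U mu mpsi psi_ge0 psi_le1 psi_sym.
have := vardU_ge0 mu psi; have := var1U_ge0 mu psi.
set v := var1U mu psi; set tau := vardU mu psi => v0 t0 h; have hN2 := N_ge2.
have : N * (N - 1) * tau <= N ^+ 2 * (1 / 4).
  rewrite expr2; apply: ler_pM; [|lra| |lra]; first by apply: mulr_ge0; lra.
  by apply: ler_wpM2l; lra.
lra.
Qed.

Let degvar_s_le : degvar / s ^+ 2 <= (q * w) ^+ 2 / 8.
Proof.
rewrite -NsE (_ : (N / s) ^+ 2 / 8 = N ^+ 2 / 8 / s ^+ 2); last by field.
by rewrite ler_wpM2r ?invr_ge0 ?exprn_ge0 ?(ltW s_gt0).
Qed.

Let q2w_gt0 : 0 < q ^+ 2 * w. Proof. by rewrite mulr_gt0// exprn_gt0. Qed.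
Let qw_gt0 : 0 < q * w. Proof. exact: mulr_gt0. Qed.

Let NM4 : N * M ^+ 4 <= (q ^+ 2 * w) ^+ 2.
Proof.
have -> : (q ^+ 2 * w) ^+ 2 = N * (N / s) ^+ 4.
  by rewrite NsE /w; rewrite NE; field.
have h := N_ge2.
rewrite ler_wpM2l ?ler0n// lerXn2r ?nnegrE ?divr_ge0 ?ler0n ?(ltW s_gt0)//.
  by rewrite subr_ge0 (le_trans _ h)// ler1n.
by rewrite ler_pM2r ?invr_gt0// gerBl.
Qed.

(** Efron-Stein gives the variance bound [25/8 (q^2 w)^2], and 177/100 exceeds sqrt (25/8). The
    second term bounds the bias of [sqrU], whose mean is [1 + degvar / s^2]. *)
Lemma Ex_abs_sqrU : \int[Q]_x `|1 - Qb x| <= 177 / 100 * (q ^+ 2 * w) + (q * w) ^+ 2 / 8.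
Proof.
set e := \int[Q]_x Qb x.
have h1 : \int[Q]_x `|Qb x - e| <= 177 / 100 * (q ^+ 2 * w).
  apply: Ex_norm_le; [by bmf_solve|by have hq := q2w_gt0; have hq' := qw_gt0; lra|].
  rewrite (le_trans (Efron_Stein iidQ bQb sqrU_bounded_differences))//.
  rewrite sum_cst (_ : _ * _ = 25 / 8 * (N * M ^+ 4)); last by field.
  rewrite [(177 / 100 * _) ^+ 2]exprMn.
  apply: (le_trans (ler_wpM2l _ NM4)); first by lra.
  by rewrite ler_wpM2r ?sqr_ge0//; lra.
have h2 : e - 1 = degvar / s ^+ 2 by rewrite /e Ex_sqrU addrC addKr.
have h3 : 0 <= e - 1.
  by rewrite h2 divr_ge0 ?exprn_ge0 ?(ltW s_gt0)// Ex_ge0// => x; exact: sqr_ge0.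
apply: (@le_trans _ _ (\int[Q]_x (`|Qb x - e| + (e - 1)))).
  apply: Ex_le => [||x]; [by bmf_solve|by bmf_solve|].
  rewrite distrC (_ : Qb x - 1 = (Qb x - e) + (e - 1)); last by ring.
  by rewrite (le_trans (ler_normD _ _))// (ger0_norm h3).
rewrite ExD; [|by bmf_solve|by bmf_solve].
rewrite Ex_cst; apply: lerD => //.
by rewrite h2.
Qed.

(** Efron-Stein gives the variance bound [18 (q^2 w)^2], and 425/100 exceeds sqrt 18. *)
Lemma Ex_abs_signsqrU : \int[Q]_x `|Kb x| <= 425 / 100 * (q ^+ 2 * w).
Proof.
apply: (Ex_norm_le (f := Kb) bKb); first by have hq := q2w_gt0; lra.
have := Efron_Stein iidQ bKb signsqrU_bounded_differences.
rewrite Ex_signsqrU; under eq_Rintegral do rewrite subr0.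
move=> h; rewrite (le_trans h)//.
rewrite sum_cst.
have -> : 2^-1 * (N * (6 * M ^+ 2) ^+ 2) = 18 * (N * M ^+ 4) by field.
rewrite [(425 / 100 * _) ^+ 2]exprMn.
apply: (le_trans (ler_wpM2l _ NM4)); first by lra.
by rewrite ler_wpM2r ?sqr_ge0//; lra.
Qed.

(** 36/100 exceeds sqrt (1/8). *)
Lemma Ex_abs_degU : \int[Q]_x `|D x / s| <= 36 / 100 * (q * w).
Proof.
apply: Ex_norm_le; [by bmf_solve|by have hq := q2w_gt0; have hq' := qw_gt0; lra|].
have -> : \int[Q]_x ((D x / s) ^+ 2) = degvar / s ^+ 2.
  rewrite /degvar -ExZr; last by bmf_solve.
  by apply: eq_Rintegral => x _; rewrite expr_div_n.
rewrite (le_trans degvar_s_le)// exprMn; have := sqr_ge0 (q * w); lra.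
Qed.

Let norm_half (t : R) : `|2^-1 * t| = 2^-1 * `|t|.
Proof. by rewrite normrM gtr0_norm// invr_gt0. Qed.

(** * Kolmogorov bound for the U-statistic *)

Section Kolmogorov.
Variables (f : R -> R) (z c : R).
Hypothesis mf : measurable_fun setT f.
Hypothesis f_le : forall x, `|f x| <= 2.
Hypothesis xf_le : forall x, `|x * f x| <= 1.
Hypothesis xf_nd : forall x y, x <= y -> x * f x <= y * f y.
Hypothesis c01 : 0 <= c <= 1.
Local Notation J := (below z).
(** Integrated form of the Stein equation [f' = x f + J - c]: since [x f] is nondecreasing and [J]
    nonincreasing, the extreme slopes between [b] and [a] combine the values at the two ends. *)
Hypothesis f_incr : forall b a, b <= a ->
  (a - b) * (b * f b + J a - c) <= f a - f b <= (a - b) * (a * f a + J b - c).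

Let bfW : bmf (fun x => f (W x)).
Proof.
split; first by apply: (measurableT_comp mf); case: bW.
by exists 2 => x.
Qed.

Let bJ : bmf (fun x => J (W x)).
Proof.
rewrite (_ : (fun x => _) = \1_[set x | W x < z]).
  apply: bmf_indic; case: bW => mW _.
  have := mW measurableT _ (measurable_itv `]-oo, z[); rewrite setTI.
  by rewrite (_ : (fun x => W x) @^-1` _ = [set x | W x < z]%classic)//; apply/seteqP;
    split => x /=;
    rewrite in_itv.
by apply/funext => x; rewrite indicE mem_setE /=.
Qed.

Let bMW : bmf (fun x => W x * f (W x)). Proof. by bmf_solve. Qed.

(** The Stein remainder: the increment of [f] is compared with its slope at [W x] as given by the
    Stein equation. *)
Let e i x y := Del i x y * (f (W x) - f (W (upd x i y))) -
   Del i x y ^+ 2 * (W x * f (W x) + J (W x) - c).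

Let bfW1 := @bmf_fst _ _ Om E _ _ bfW.
Let bJ1 := @bmf_fst _ _ Om E _ _ bJ.
Let bfWu i := bmf_upd i bfW.
Let bJu i := bmf_upd i bJ.

Let be i : bmf (fun u : Om * E => e i u.1 u.2).
Proof. by rewrite /e; bmf_solve. Qed.

Let Pp i x y := 2^-1 * (Del i x y ^+ 2 + Del i x y * `|Del i x y|).
Let Pn i x y := 2^-1 * (Del i x y ^+ 2 - Del i x y * `|Del i x y|).
Let bPp i : bmf (fun u : Om * E => Pp i u.1 u.2).
Proof. by rewrite /Pp; bmf_solve. Qed.
Let bPn i : bmf (fun u : Om * E => Pn i u.1 u.2).
Proof. by rewrite /Pn; bmf_solve. Qed.

Let X i := \int[Q]_x \int[mu]_y
  ((W x * f (W x) - J (W x)) * (Del i x y * `|Del i x y|)).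

Let Pp_swap i x y : Pp i (upd x i y) (tnth x i) = Pn i x y.
Proof. by rewrite /Pp /Pn incrU_swap normrN sqrrN mulNr. Qed.
Let Pn_swap i x y : Pn i (upd x i y) (tnth x i) = Pp i x y.
Proof. by rewrite /Pp /Pn incrU_swap normrN sqrrN mulNr opprK. Qed.

(* [Pp] and [Pn] are [Del ^ 2] on the events [Del > 0] and [Del < 0]; the swap of
   [x_i] and [y] exchanges the two events as well as [W x] and [W (upd x i y)]. *)
Let e_le i : \int[Q]_x \int[mu]_y e i x y <= X i.
Proof.
pose G1 (u : Om * E) := Pp i u.1 u.2 * J (W (upd u.1 i u.2)) +
  Pn i u.1 u.2 * (W (upd u.1 i u.2) * f (W (upd u.1 i u.2))).
pose G2 (u : Om * E) := Pp i u.1 u.2 * J (W u.1) +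
  Pn i u.1 u.2 * (W u.1 * f (W u.1)).
have bG1 : bmf G1 by rewrite /G1; bmf_solve.
have bG2 : bmf G2 by rewrite /G2; bmf_solve.
pose G3 (u : Om * E) := Pn i u.1 u.2 * J (W u.1) +
  Pp i u.1 u.2 * (W u.1 * f (W u.1)).
have bG3 : bmf G3 by rewrite /G3; bmf_solve.
have bX : bmf (fun u : Om * E =>
  (W u.1 * f (W u.1) - J (W u.1)) * (Del i u.1 u.2 * `|Del i u.1 u.2|)) by bmf_solve.
have h : \int[Q]_x \int[mu]_y e i x y <=
    \int[Q]_x \int[mu]_y (G1 (x, y) - G2 (x, y)).
  apply: Ex_le => [||x]; [exact: (bI (be i))|exact: (bI (bmfB bG1 bG2))|].
  apply: Ex_le => [||y]; [exact: (bmf_pairr x (be i))|exact: (bmf_pairr x (bmfB bG1 bG2))|].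
  (* For [Del >= 0] the terms [x f] cancel and only the indicators differ; for [Del < 0] the
     indicators cancel and a difference of terms [x f] remains. *)
  rewrite /e /G1 /G2 /=; set a := W x; set b := W (upd x i y).
  have hDE : Del i x y = a - b by [].
  rewrite /Pp /Pn hDE; have [ab|/ltW ba] := leP b a.
    rewrite ger0_norm ?subr_ge0//; case/andP: (f_incr ab) => _ h.
    have : (a - b) * (f a - f b) <= (a - b) * ((a - b) * (a * f a + J b - c)).
      by apply: ler_wpM2l => //; rewrite subr_ge0.
    by rewrite expr2; lra.
  rewrite ler0_norm ?subr_le0//; case/andP: (f_incr ba) => _ h.
  have : (b - a) * (f b - f a) <= (b - a) * ((b - a) * (b * f b + J a - c)).
    by apply: ler_wpM2l => //; rewrite subr_ge0.
  by rewrite expr2; lra.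
apply: (le_trans h); rewrite le_eqVlt; apply/orP/or_introl/eqP.
have -> : \int[Q]_x \int[mu]_y (G1 (x, y) - G2 (x, y)) =
    \int[Q]_x \int[mu]_y G1 (x, y) - \int[Q]_x \int[mu]_y G2 (x, y).
  rewrite -ExB; [|exact: (bI bG1)|exact: (bI bG2)].
  apply: eq_Rintegral => x _.
  by rewrite ExB//; [exact: (bmf_pairr x bG1)|exact: (bmf_pairr x bG2)].
(* After the exchange everything is evaluated at [W x], and the weights combine to
   [Pp - Pn = Del |Del|]. *)
have -> : \int[Q]_x \int[mu]_y G1 (x, y) = \int[Q]_x \int[mu]_y G3 (x, y).
  rewrite (Ex_swap iidQ i bG1); apply: eq_Rintegral => x _.
  apply: eq_Rintegral => y _.
  by rewrite /G1 /G3 /= Pp_swap Pn_swap upd_upd upd_tnth.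
rewrite /X.
rewrite -ExB; [|exact: (bI bG3)|exact: (bI bG2)].
apply: eq_Rintegral => x _.
rewrite -ExB; [|exact: (bmf_pairr x bG3)|exact: (bmf_pairr x bG2)].
by apply: eq_Rintegral => y _; rewrite /G3 /G2 /Pp /Pn /=; field.
Qed.

(** The lower bounds of [f_incr] give the mirror image of [e_le], with [Pp] and [Pn] in exchanged
    roles. *)
Let e_ge i : - X i <= \int[Q]_x \int[mu]_y e i x y.
Proof.
pose G1 (u : Om * E) := Pn i u.1 u.2 * J (W (upd u.1 i u.2)) +
  Pp i u.1 u.2 * (W (upd u.1 i u.2) * f (W (upd u.1 i u.2))).
pose G2 (u : Om * E) := Pn i u.1 u.2 * J (W u.1) +
  Pp i u.1 u.2 * (W u.1 * f (W u.1)).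
have bG1 : bmf G1 by rewrite /G1; bmf_solve.
have bG2 : bmf G2 by rewrite /G2; bmf_solve.
pose G3 (u : Om * E) := Pp i u.1 u.2 * J (W u.1) +
  Pn i u.1 u.2 * (W u.1 * f (W u.1)).
have bG3 : bmf G3 by rewrite /G3; bmf_solve.
have bX : bmf (fun u : Om * E =>
  (W u.1 * f (W u.1) - J (W u.1)) * (Del i u.1 u.2 * `|Del i u.1 u.2|)) by bmf_solve.
have h : \int[Q]_x \int[mu]_y (G1 (x, y) - G2 (x, y)) <=
    \int[Q]_x \int[mu]_y e i x y.
  apply: Ex_le => [||x]; [exact: (bI (bmfB bG1 bG2))|exact: (bI (be i))|].
  apply: Ex_le => [||y]; [exact: (bmf_pairr x (bmfB bG1 bG2))|exact: (bmf_pairr x (be i))|].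
  rewrite /e /G1 /G2 /=; set a := W x; set b := W (upd x i y).
  have hDE : Del i x y = a - b by [].
  rewrite /Pp /Pn hDE; have [ab|/ltW ba] := leP b a.
    rewrite ger0_norm ?subr_ge0//; case/andP: (f_incr ab) => h _.
    have : (a - b) * ((a - b) * (b * f b + J a - c)) <= (a - b) * (f a - f b).
      by apply: ler_wpM2l => //; rewrite subr_ge0.
    by rewrite expr2; lra.
  rewrite ler0_norm ?subr_le0//; case/andP: (f_incr ba) => h _.
  have : (b - a) * ((b - a) * (a * f a + J b - c)) <= (b - a) * (f b - f a).
    by apply: ler_wpM2l => //; rewrite subr_ge0.
  by rewrite expr2; lra.
apply: le_trans h; rewrite le_eqVlt; apply/orP/or_introl/eqP.
have -> : \int[Q]_x \int[mu]_y (G1 (x, y) - G2 (x, y)) =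
    \int[Q]_x \int[mu]_y G1 (x, y) - \int[Q]_x \int[mu]_y G2 (x, y).
  rewrite -ExB; [|exact: (bI bG1)|exact: (bI bG2)].
  apply: eq_Rintegral => x _.
  by rewrite ExB//; [exact: (bmf_pairr x bG1)|exact: (bmf_pairr x bG2)].
have -> : \int[Q]_x \int[mu]_y G1 (x, y) = \int[Q]_x \int[mu]_y G3 (x, y).
  rewrite (Ex_swap iidQ i bG1); apply: eq_Rintegral => x _.
  apply: eq_Rintegral => y _.
  by rewrite /G1 /G3 /= Pp_swap Pn_swap upd_upd upd_tnth.
rewrite /X.
rewrite -ExB; [|exact: (bI bG3)|exact: (bI bG2)].
rewrite -ExN; last exact: (bI bX).
apply: eq_Rintegral => x _.
rewrite -ExB; [|exact: (bmf_pairr x bG3)|exact: (bmf_pairr x bG2)].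
rewrite -ExN; last exact: (bmf_pairr x bX).
by apply: eq_Rintegral => y _; rewrite /G3 /G2 /Pp /Pn /=; field.
Qed.

Let J01 x : 0 <= J x <= 1.
Proof. by rewrite /below; case: (x < z); rewrite ?lexx ?ler01. Qed.

(** The factor [W f(W) - J(W)] involves neither [i] nor [y], so summing over [i] rebuilds
    [signsqrU]. *)
Let sum_X : `|\sum_i X i| <= 2 * \int[Q]_x `|Kb x|.
Proof.
have -> : \sum_i X i = \int[Q]_x ((W x * f (W x) - J (W x)) * Kb x).
  rewrite /X -Ex_sum; last first.
    move=> i _; apply: bI; by bmf_solve.
  apply: eq_Rintegral => x _; rewrite mulr_sumr; apply: eq_bigr => i _.
  by rewrite ExZ//; bmf_solve.
apply: Ex_normM => // [|x]; first by bmf_solve.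
rewrite (le_trans (ler_normB _ _))//.
have := xf_le (W x); have /andP[j0 j1] := J01 (W x); rewrite (ger0_norm j0); lra.
Qed.

Lemma stein_kolmogorov : `|\int[Q]_x J (W x) - c| <= 14 * N ^+ 4 / s ^+ 3.
Proof.
(* The value of [f'] at [W x] according to the Stein equation. *)
pose H x := W x * f (W x) + J (W x) - c.
have bH : bmf H by rewrite /H; bmf_solve.
have H2 x : `|H x| <= 2.
  have := xf_le (W x); have /andP[j0 j1] := J01 (W x); case/andP: c01 => c0 c1.
  by rewrite /H !ler_norml => /andP[h1 h2]; apply/andP; split; lra.
have e1 : \int[Q]_x J (W x) - c = \int[Q]_x (H x * (1 - Qb x)) +
    \int[Q]_x (f (W x) * (D x / s)) -
    2^-1 * \sum_i \int[Q]_x \int[mu]_y e i x y.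
  have h1 := exchangeable_pair bfW.
  have h2 : \sum_i \int[Q]_x \int[mu]_y (Del i x y * (f (W x) - f (W (upd x i y)))) =
      \sum_i \int[Q]_x \int[mu]_y e i x y + 2 * \int[Q]_x (H x * Qb x).
    have -> : 2 * \int[Q]_x (H x * Qb x) =
        \sum_i \int[Q]_x \int[mu]_y (Del i x y ^+ 2 * H x).
      rewrite -Ex_sum; last first.
        by move=> i _; apply: bI; have bH1 := @bmf_fst _ _ Om E _ _ bH; bmf_solve.
      rewrite -ExZ; last by bmf_solve.
      apply: eq_Rintegral => x _; rewrite /sqrU.
      transitivity (H x * \sum_i \int[mu]_y (Del i x y ^+ 2)); first by field.
      rewrite mulr_sumr; apply: eq_bigr => i _.
      rewrite ExZr; [exact: mulrC|by bmf_solve].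
    rewrite -big_split; apply: eq_bigr => i _ /=.
    have bH1 := @bmf_fst _ _ Om E _ _ bH.
    have bDH : bmf (fun u : Om * E => Del i u.1 u.2 ^+ 2 * H u.1) by bmf_solve.
    rewrite -ExD; [|exact: (bI (be i))|exact: (bI bDH)].
    apply: eq_Rintegral => x _.
    rewrite -ExD; [|exact: (bmf_pairr x (be i))|exact: (bmf_pairr x bDH)].
    by apply: eq_Rintegral => y _; rewrite /e /H; ring.
  have h3 : \int[Q]_x (H x * (1 - Qb x)) = \int[Q]_x (f (W x) * W x) +
      \int[Q]_x J (W x) - c - \int[Q]_x (H x * Qb x).
    rewrite -[c in RHS](Ex_cst Q) -ExD; [|by bmf_solve|by bmf_solve].
    rewrite -ExB; [|by bmf_solve|by bmf_solve].
    rewrite -ExB; [|by bmf_solve|by bmf_solve].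
    by apply: eq_Rintegral => x _; rewrite /H; ring.
  rewrite h3; rewrite h2 in h1; move: h1.
  set a1 := \int[Q]_x (f (W x) * W x); set a2 := \int[Q]_x (f (W x) * (D x / s)).
  set a3 := \sum_i _; set a4 := \int[Q]_x (H x * Qb x); set a5 := \int[Q]_x _.
  move=> h1; lra.
have b1 : `|\int[Q]_x (H x * (1 - Qb x))| <= 2 * \int[Q]_x `|1 - Qb x|.
  by apply: Ex_normM => //; bmf_solve.
have b2 : `|\int[Q]_x (f (W x) * (D x / s))| <= 2 * \int[Q]_x `|D x / s|.
  by apply: Ex_normM => //; bmf_solve.
have b3 : `|\sum_i \int[Q]_x \int[mu]_y e i x y| <= 2 * \int[Q]_x `|Kb x|.
  apply: le_trans sum_X; rewrite ler_norml; apply/andP; split.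
    apply: (@le_trans _ _ (- \sum_i X i)); first by rewrite lerN2 ler_norm.
    by rewrite -sumrN; apply: ler_sum => i _; exact: e_ge.
  apply: (@le_trans _ _ (\sum_i X i)); last exact: ler_norm.
  by apply: ler_sum => i _; exact: e_le.
have E1 := Ex_abs_sqrU; have E2 := Ex_abs_degU; have E3 := Ex_abs_signsqrU.
rewrite e1 (le_trans (ler_normB _ _))//.
rewrite (le_trans (lerD (ler_normD _ _) (lexx _)))//.
rewrite norm_half.
have -> : 14 * N ^+ 4 / s ^+ 3 = 14 * (q ^+ 3 * w).
  by rewrite NE /q /w; field; rewrite r_neq0.
(* Every error term is at most a multiple of [q^2 w]; the multiples add up to 8.76, against
   [14 q >= 39.2]. *)
apply: (@le_trans _ _ (2 * (177 / 100 * (q ^+ 2 * w) + (q * w) ^+ 2 / 8) +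
   2 * (36 / 100 * (q * w)) + 425 / 100 * (q ^+ 2 * w))); first by lra.
have h1 : (q * w) ^+ 2 <= q ^+ 2 * w.
  rewrite exprMn ler_wpM2l ?sqr_ge0// expr2 ger_pMr//.
  by rewrite -(@expr_le1 _ 2)// ?(ltW w_gt0)//; have := w_le; lra.
have h2 : q * w <= q ^+ 2 * w.
  by rewrite ler_pM2r// expr2 ler_peMl// ?(ltW q_gt0)//; have := q_ge; lra.
have h3 : 14 / 5 * (q ^+ 2 * w) <= q ^+ 3 * w.
  by rewrite mulrA ler_pM2r// exprS ler_wpM2r ?sqr_ge0.
have : 0 < q ^+ 2 * w by rewrite mulr_gt0// exprn_gt0.
lra.
Qed.

End Kolmogorov.

(** * Bound for smooth test functions *)

Section Smooth.
Variables (f f1 h : R -> R) (c : R).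
Hypothesis mf : measurable_fun setT f.
Hypothesis mf1 : measurable_fun setT f1.
Hypothesis f_le : forall x, `|f x| <= 283 / 100.
Hypothesis f1_le : forall x, `|f1 x| <= 4.
Hypothesis f1E : forall x, f1 x - x * f x = h x - c.
Hypothesis f_taylor : forall a b, `|f b - f a - (b - a) * f1 a| <= 383 / 100 * (b - a) ^+ 2.
Hypothesis n_gt5 : (5 < n)%N.

Let bfW : bmf (fun x => f (W x)).
Proof.
split; first by apply: (measurableT_comp mf); case: bW.
by exists (283 / 100) => x.
Qed.

Let bf1W : bmf (fun x => f1 (W x)).
Proof.
split; first by apply: (measurableT_comp mf1); case: bW.
by exists 4 => x.
Qed.

Let bfW1 := @bmf_fst _ _ Om E _ _ bfW.
Let bf1W1 := @bmf_fst _ _ Om E _ _ bf1W.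
Let bfWu i := bmf_upd i bfW.

Let e i x y := Del i x y * (f (W x) - f (W (upd x i y))) - Del i x y ^+ 2 * f1 (W x).
Let be i : bmf (fun u : Om * E => e i u.1 u.2).
Proof. by rewrite /e; bmf_solve. Qed.

(** 41/100 exceeds 1 / sqrt 6; this is where [n > 5] enters. *)
Let w_le6 : w <= 41 / 100.
Proof.
have hr : 6 <= r ^+ 2 by rewrite -NE ler_nat.
rewrite /w -[leRHS]invrK lef_pV2 ?posrE// ?invr_gt0 ?divr_gt0//.
rewrite invf_div -(@ler_pXn2r _ 2)// ?nnegrE ?divr_ge0 ?(ltW r_gt0)//.
by rewrite (le_trans _ hr)//; lra.
Qed.

Lemma stein_smooth : `|\int[Q]_x h (W x) - c| <=
  6 * (N ^+ 2 * Num.sqrt N) / s ^+ 2 + 2 * N ^+ 4 / s ^+ 3.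
Proof.
have e1 : \int[Q]_x h (W x) - c = \int[Q]_x (f1 (W x) * (1 - Qb x)) +
    \int[Q]_x (f (W x) * (D x / s)) -
    2^-1 * \sum_i \int[Q]_x \int[mu]_y e i x y.
  have h1 := exchangeable_pair bfW.
  have h2 : \sum_i \int[Q]_x \int[mu]_y (Del i x y * (f (W x) - f (W (upd x i y)))) =
      \sum_i \int[Q]_x \int[mu]_y e i x y + 2 * \int[Q]_x (f1 (W x) * Qb x).
    have -> : 2 * \int[Q]_x (f1 (W x) * Qb x) =
        \sum_i \int[Q]_x \int[mu]_y (Del i x y ^+ 2 * f1 (W x)).
      rewrite -Ex_sum; last by move=> i _; apply: bI; bmf_solve.
      rewrite -ExZ; last by bmf_solve.
      apply: eq_Rintegral => x _; rewrite /sqrU.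
      transitivity (f1 (W x) * \sum_i \int[mu]_y (Del i x y ^+ 2)); first by field.
      rewrite mulr_sumr; apply: eq_bigr => i _.
      rewrite ExZr; [exact: mulrC|by bmf_solve].
    rewrite -big_split; apply: eq_bigr => i _ /=.
    have bDH : bmf (fun u : Om * E => Del i u.1 u.2 ^+ 2 * f1 (W u.1)) by bmf_solve.
    rewrite -ExD; [|exact: (bI (be i))|exact: (bI bDH)].
    apply: eq_Rintegral => x _.
    rewrite -ExD; [|exact: (bmf_pairr x (be i))|exact: (bmf_pairr x bDH)].
    by apply: eq_Rintegral => y _; rewrite /e; ring.
  have h3 : \int[Q]_x h (W x) - c =
      \int[Q]_x (f1 (W x)) - \int[Q]_x (f (W x) * W x).
    have hE x : h x = f1 x - x * f x + c by rewrite f1E subrK.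
    under eq_Rintegral do rewrite hE.
    rewrite ExD; [|by bmf_solve|by bmf_solve].
    rewrite ExB; [|by bmf_solve|by bmf_solve].
    rewrite Ex_cst addrK; congr (_ - _); apply: eq_Rintegral => x _.
    by rewrite mulrC.
  have h4 : \int[Q]_x (f1 (W x) * (1 - Qb x)) = 
      \int[Q]_x (f1 (W x)) - \int[Q]_x (f1 (W x) * Qb x).
    rewrite -ExB; [|by bmf_solve|by bmf_solve].
    by apply: eq_Rintegral => x _; ring.
  rewrite h3 h4; rewrite h2 in h1; move: h1.
  set a1 := \int[Q]_x (f (W x) * W x); set a2 := \int[Q]_x (f (W x) * (D x / s)).
  set a3 := \sum_i _; set a4 := \int[Q]_x (f1 (W x) * Qb x); set a5 := \int[Q]_x _.
  move=> h1; lra.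
have b1 : `|\int[Q]_x (f1 (W x) * (1 - Qb x))| <= 4 * \int[Q]_x `|1 - Qb x|.
  by apply: Ex_normM => //; bmf_solve.
have b2 : `|\int[Q]_x (f (W x) * (D x / s))| <= 283 / 100 * \int[Q]_x `|D x / s|.
  by apply: Ex_normM => //; bmf_solve.
have qwM : M <= q * w by rewrite -NsE ler_pM2r ?invr_gt0//; lra.
(* Taylor at [W x] bounds the remainder by a multiple of [|Del|^3 <= q w Del^2], so the sum is
   controlled by the mean of [sqrU]. *)
have b3 : `|2^-1 * \sum_i \int[Q]_x \int[mu]_y e i x y| <=
    383 / 100 * (q * w) * (1 + (q * w) ^+ 2 / 8).
  rewrite norm_half.
  apply: (@le_trans _ _ (383 / 100 * (q * w) * \int[Q]_x Qb x)); last first.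
    rewrite Ex_sqrU; apply: ler_wpM2l; last by rewrite lerD2l; exact: degvar_s_le.
    by have hq := qw_gt0; lra.
  rewrite /Qb ExZ; last by bmf_solve.
  rewrite [leRHS]mulrCA ler_wpM2l ?invr_ge0//.
  rewrite (le_trans (ler_norm_sum _ _ _))// Ex_sum// mulr_sumr.
  apply: ler_sum => i _.
  have bDe : bmf (fun u : Om * E => `|e i u.1 u.2|) by exact: bmf_norm (be i).
  rewrite (le_trans (Ex_norm _ (bI (be i))))// -ExZ//.
  apply: Ex_le => [||x]; [exact/bmf_norm/(bI (be i))|by bmf_solve|].
  rewrite (le_trans (Ex_norm _ (bmf_pairr x (be i))))// -ExZ; last by bmf_solve.
  apply: Ex_le => [||y]; [exact: (bmf_pairr x bDe)|by bmf_solve|].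
  have hDE : Del i x y = W x - W (upd x i y) by [].
  have := f_taylor (W x) (W (upd x i y)).
  rewrite (_ : e i x y = - (Del i x y *
    (f (W (upd x i y)) - f (W x) - (W (upd x i y) - W x) * f1 (W x)))); last first.
    by rewrite /e hDE; ring.
  rewrite (_ : (W (upd x i y) - W x) ^+ 2 = Del i x y ^+ 2); last by rewrite hDE; ring.
  set t := f (W _) - _ - _ => ht; rewrite normrN normrM.
  have -> : 383 / 100 * (q * w) * Del i x y ^+ 2 = (q * w) * (383 / 100 * Del i x y ^+ 2).
    by ring.
  by apply: ler_pM => //; exact: le_trans (incrU_le _ _ _) qwM.
have E1 := Ex_abs_sqrU; have E2 := Ex_abs_degU.
rewrite e1 (le_trans (ler_normB _ _))//.
rewrite (le_trans (lerD (ler_normD _ _) (lexx _)))//.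
have -> : 2 * N ^+ 4 / s ^+ 3 = 2 * (q ^+ 3 * w).
  by rewrite NE /q /w; field; rewrite r_neq0.
have -> : 6 * (N ^+ 2 * Num.sqrt N) / s ^+ 2 = 6 * (q ^+ 2 * w).
  by rewrite -/r NE /q /w; field; rewrite r_neq0.
(* By the estimates below the errors are at most [9.02 q^2 w + 0.09 q^3 w]; since [q >= 14/5], what
   is left of [2 q^3 w] covers the excess over [6 q^2 w]. *)
apply: (@le_trans _ _ (4 * (177 / 100 * (q ^+ 2 * w) + (q * w) ^+ 2 / 8) +
   283 / 100 * (36 / 100 * (q * w)) +
   383 / 100 * (q * w) * (1 + (q * w) ^+ 2 / 8))); first by lra.
have h1 : (q * w) ^+ 2 <= 41 / 100 * (q ^+ 2 * w).
  have -> : 41 / 100 * (q ^+ 2 * w) = q ^+ 2 * (41 / 100 * w) by ring.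
  rewrite exprMn; apply: ler_wpM2l; first exact: sqr_ge0.
  by rewrite expr2; apply: ler_wpM2r; [exact: ltW | exact: w_le6].
have h2 : 14 / 5 * (q * w) <= q ^+ 2 * w.
  by rewrite mulrA ler_pM2r// expr2 ler_pM2r// q_ge.
have h3 : 14 / 5 * (q ^+ 2 * w) <= q ^+ 3 * w.
  by rewrite mulrA ler_pM2r// exprS ler_wpM2r ?sqr_ge0.
have h4 : (q * w) * (q * w) ^+ 2 <= 41 / 100 * (41 / 100 * (q ^+ 3 * w)).
  apply: (@le_trans _ _ (q * w * (41 / 100 * (q ^+ 2 * w)))).
    by apply: ler_wpM2l => //; rewrite mulr_ge0// ltW.
  have -> : q * w * (41 / 100 * (q ^+ 2 * w)) = 41 / 100 * (q ^+ 3 * w * w) by ring.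
  rewrite ler_wpM2l// [leRHS]mulrC ler_wpM2l//.
  by rewrite mulr_ge0 ?exprn_ge0// ltW.
have : 0 < q ^+ 2 * w by rewrite mulr_gt0// exprn_gt0.
lra.
Qed.

End Smooth.

End SteinUstatistic.

(** * Calculus of one real variable *)

Section RealDerivatives.
Context {R : realType}.
Implicit Types f g : R -> R.

Lemma der_add f g (x a b : R) : is_derive x 1 f a -> is_derive x 1 g b ->
  is_derive x 1 (fun t => f t + g t) (a + b).
Proof. by move=> hf hg; exact: is_deriveD. Qed.

Lemma der_opp f (x a : R) : is_derive x 1 f a -> is_derive x 1 (fun t => - f t) (- a).
Proof. by move=> hf; exact: is_deriveN. Qed.

Lemma der_sub f g (x a b : R) : is_derive x 1 f a -> is_derive x 1 g b ->
  is_derive x 1 (fun t => f t - g t) (a - b).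
Proof. by move=> hf hg; apply: der_add => //; exact: der_opp. Qed.

Lemma der_mul f g (x a b : R) : is_derive x 1 f a -> is_derive x 1 g b ->
  is_derive x 1 (fun t => f t * g t) (f x * b + g x * a).
Proof. by move=> hf hg; exact: is_deriveM. Qed.

Lemma der_inv f (x a : R) : f x != 0 -> is_derive x 1 f a ->
  is_derive x 1 (fun t => (f t)^-1%R) (- (f x ^- 2 * a)).
Proof.
by move=> fx hf; apply: (is_derive_eq (is_deriveV fx hf)); rewrite scaleNr.
Qed.

Lemma der_cst (c x : R) : is_derive x 1 (fun=> c) 0.
Proof. exact: is_derive_cst. Qed.

Lemma der_id (x : R) : is_derive x 1 (fun t : R => t) 1.
Proof. exact: is_derive_id. Qed.

Lemma der_comp f g (x a b : R) : is_derive (g x) 1 f a -> is_derive x 1 g b ->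
  is_derive x 1 (fun t => f (g t)) (a * b).
Proof. by move=> hf hg; exact: is_derive1_comp. Qed.

Lemma der_reflect f (x a : R) : is_derive (- x) 1 f a ->
  is_derive x 1 (fun t => f (- t)) (- a).
Proof.
move=> hf; have h := der_comp (g := fun t => - t) hf (der_opp (der_id x)).
by apply: (is_derive_eq h); rewrite mulrN1.
Qed.

Lemma derive_continuous f df : (forall x : R, is_derive x 1 f (df x)) -> continuous f.
Proof.
move=> hf x; apply: differentiable_continuous; apply/derivable1_diffP.
by case: (hf x).
Qed.

Lemma mvt_on f df (a b : R) : a <= b ->
  (forall x, a <= x <= b -> is_derive x 1 f (df x)) ->
  exists2 c, a <= c <= b & f b - f a = df c * (b - a).
Proof.
move=> ab hf.
have [c cab e] : exists2 c : R, c \in `[a, b] & f b - f a = df c * (b - a).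
  apply: MVT_segment => //.
    by move=> x; rewrite in_itv /= => /andP[/ltW h1 /ltW h2]; apply: hf; rewrite h1.
  apply: derivable_within_continuous => x; rewrite in_itv /= => h.
  by case: (hf x h).
by exists c => //; move: cab; rewrite in_itv.
Qed.

Lemma derive_nd f df (a b : R) : a <= b ->
  (forall x, a <= x <= b -> is_derive x 1 f (df x)) ->
  (forall x, a <= x <= b -> 0 <= df x) -> f a <= f b.
Proof.
move=> ab hf h0; rewrite -subr_ge0; have [c cab ->] := mvt_on ab hf.
by rewrite mulr_ge0 ?h0// subr_ge0.
Qed.

Lemma derive_ni f df (a b : R) : a <= b ->
  (forall x, a <= x <= b -> is_derive x 1 f (df x)) ->
  (forall x, a <= x <= b -> df x <= 0) -> f b <= f a.
Proof.
move=> ab hf h0; rewrite -lerN2.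
apply: (derive_nd (f := fun t => - f t) (df := fun t => - df t)) => // x h.
  exact: der_opp (hf x h).
by rewrite oppr_ge0 h0.
Qed.

(** A nonincreasing function lies above its limit. The Gaussian inequalities below are obtained this
    way from the sign of a derivative. *)
Lemma ni_cvg0_ge0 f (a : R) : (forall x y, a <= x -> x <= y -> f y <= f x) ->
  f y @[y --> +oo] --> (0 : R) -> forall x, a <= x -> 0 <= f x.
Proof.
move=> hf f0 x ax; apply: (cvgr_to_le f0); near=> y.
by apply: hf => //; near: y; exact: nbhs_pinfty_ge.
Unshelve. all: by end_near. Qed.

End RealDerivatives.

(** * Gaussian tail and Mills ratio *)

Section GaussianTail.
Context {R : realType}.
Local Notation leb := (@lebesgue_measure R).

Definition gpdf : R -> R := normal_pdf 0 1.
Local Notation gp := gpdf.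

Lemma gpdfE (t : R) : gp t = normal_peak 1 * expR (- (2^-1 * t ^+ 2)).
Proof.
rewrite /gp normal_pdfE ?oner_neq0//= /normal_fun subr0 expr1n mulNr.
by rewrite [_ / _]mulrC.
Qed.

Lemma gpdf_gt0 t : 0 < gp t.
Proof. by rewrite gpdfE mulr_gt0 ?expR_gt0// normal_peak_gt0 ?oner_neq0. Qed.

Lemma gpdf_neq0 t : gp t != 0. Proof. exact: lt0r_neq0 (gpdf_gt0 t). Qed.

Lemma gpdfN t : gp (- t) = gp t. Proof. by rewrite !gpdfE sqrrN. Qed.

Lemma dgpdf (x : R) : is_derive x 1 gp (- (x * gp x)).
Proof.
rewrite (_ : gp = fun t => normal_peak 1 * expR (- (2^-1 * (t * t)))); last first.
  by apply/funext => t; rewrite gpdfE expr2.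
have h := der_mul (der_cst (normal_peak 1) x) (der_comp (is_derive_expR _)
  (der_opp (der_mul (der_cst 2^-1 x) (der_mul (der_id x) (der_id x))))).
by apply: (is_derive_eq h); field.
Qed.

Lemma gpdf_cvg0 : gp y @[y --> +oo] --> (0 : R).
Proof.
rewrite (_ : gp = fun t => normal_peak 1 * expR (- (2^-1 * t ^+ 2))); last first.
  by apply/funext => t; rewrite gpdfE.
rewrite -[X in _ --> X](mulr0 (normal_peak 1)).
apply: cvgMr.
have h := @cvgr_expR R.
apply: (@cvg_comp _ _ _ (fun t : R => 2^-1 * t ^+ 2) (fun t => expR (- t)) _ _ _ _ h).
apply/cvgryPge => A; near=> t.
have h1 : 2 <= t by near: t; exact: nbhs_pinfty_ge.
have h2 : A <= t by near: t; apply: nbhs_pinfty_ge; exact: num_real.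
nra.
Unshelve. all: by end_near. Qed.

Lemma inv_cvg0 : y^-1%R @[y --> +oo] --> (0 : R).
Proof.
apply/cvgrPdist_le => e e0; near=> t.
have t0 : 0 < t by near: t; exact: nbhs_pinfty_gt.
rewrite sub0r normrN gtr0_norm ?invr_gt0//.
rewrite -[leRHS]invrK lef_pV2 ?posrE ?invr_gt0//.
Unshelve. all: by end_near. Qed.

Lemma continuous_gpdf : continuous gp.
Proof. exact: derive_continuous dgpdf. Qed.

Section WeightedIntegral.
Variable h : R -> R.
Hypothesis mh : measurable_fun setT h.
Variable B : R.
Hypothesis hB : forall x, `|h x| <= B.

Lemma integrable_gpdfM (D : set R) : measurable D ->
  leb.-integrable D (EFin \o (fun t => h t * gp t)).
Proof.
move=> mD.
have i1 : leb.-integrable D (EFin \o gp).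
  apply: (@integrableS _ _ _ _ setT) => //.
  exact: integrable_normal_pdf.
have := @integrableMr _ _ R leb D mD h (EFin \o gp) (measurable_funTS mh) _ i1; apply.
exists B; split; first exact: num_real.
by move=> N BN x _ /=; rewrite (le_trans (hB x)) ?ltW.
Qed.

Definition gint (w : R) : R := \int[leb]_(t in `]-oo, w]) (h t * gp t).

Lemma gint_split w : gint w + \int[leb]_(t in `]w, +oo[) (h t * gp t) =
  \int[leb]_t (h t * gp t).
Proof.
rewrite /gint -Rintegral_setU//.
- congr (Rintegral _ _ _); apply/seteqP; split => // x _ /=.
  by rewrite !in_itv/= andbT; case: leP; [left|right].
- exact: integrable_gpdfM (measurableU _ _ _ _).
- rewrite disj_set2E; apply/eqP/seteqP; split => // x [] /=.
  by rewrite !in_itv/= andbT leNgt => /negP.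
Qed.

Lemma dgint w : {for w, continuous h} -> is_derive w 1 gint (h w * gp w).
Proof.
move=> ch.
have wu : w < w + 1 by rewrite ltrDl.
have [||h1 h2] := @continuous_FTC1 R (fun t => h t * gp t) -oo%O w (w + 1) wu
    (integrable_gpdfM (measurable_itv _)).
- by rewrite ltNyr.
- exact: (cvgM ch (@continuous_gpdf w)).
by apply: DeriveDef; [exact: h1 | rewrite -derive1E h2].
Qed.

End WeightedIntegral.

Local Notation one := (cst 1 : R -> R).

Lemma one_le : forall x : R, `|one x| <= 1. Proof. by move=> x; rewrite /= normr1. Qed.

Definition gcdf (w : R) : R := gint one w.
Definition gtail (w : R) : R := 1 - gcdf w.

Lemma int_gpdf : \int[leb]_t (one t * gp t) = 1.
Proof.
transitivity (fine (\int[leb]_t (gp t)%:E)).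
  by congr fine; apply: eq_integral => t _; rewrite mul1r.
by rewrite integral_normal_pdf.
Qed.

Lemma gtailE w : gtail w = \int[leb]_(t in `]w, +oo[) (one t * gp t).
Proof.
have h := gint_split (measurable_cst (1 : R)) one_le w; rewrite int_gpdf in h.
by apply: (addrI (gcdf w)); rewrite [RHS]h /gtail addrC subrK.
Qed.

Lemma gtail_ge0 w : 0 <= gtail w.
Proof. by rewrite gtailE Rintegral_ge0// => x _; rewrite mul1r ltW ?gpdf_gt0. Qed.

Lemma gcdf_ge0 w : 0 <= gcdf w.
Proof. by rewrite /gcdf /gint Rintegral_ge0// => x _; rewrite mul1r ltW ?gpdf_gt0. Qed.

Lemma dgcdf (w : R) : is_derive w 1 gcdf (gp w).
Proof.
have h := dgint (measurable_cst (1 : R)) one_le (w := w) (@cst_continuous _ _ _ w).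
by apply: (is_derive_eq h); rewrite mul1r.
Qed.

Lemma dgtail (w : R) : is_derive w 1 gtail (- gp w).
Proof. by apply: (is_derive_eq (der_sub (der_cst 1 w) (dgcdf w))); rewrite sub0r. Qed.

Lemma gcdfN w : gcdf (- w) = gtail w.
Proof.
rewrite gtailE /gcdf /gint /Rintegral.
rewrite ge0_integration_by_substitutionNy.
- rewrite integral_itv_obnd_cbnd; last first.
    apply/measurable_EFinP/measurable_funTS; apply: measurable_funM => //.
    exact: measurable_normal_pdf.
  by congr fine; apply: eq_integral => t _; rewrite /= gpdfN.
- apply: continuous_subspaceT => x; apply: cvgM; first exact: cvg_cst.
  exact: continuous_gpdf.
- by move=> x _; rewrite mul1r ltW ?gpdf_gt0.
Qed.

Lemma gtailN w : gtail (- w) = gcdf w.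
Proof. by rewrite -gcdfN opprK. Qed.

Lemma gcdfD_gtail w : gcdf w + gtail w = 1.
Proof. by rewrite /gtail addrC subrK. Qed.

(** [gcdf] is the distribution function of the standard normal law, which vanishes at minus
    infinity; reflection turns this into the tail. *)
Lemma gtail_cvg0 : gtail y @[y --> +oo] --> (0 : R).
Proof.
have mid : @measurable_fun _ _ (measurableTypeR R) R setT (fun x : R => x) by exact:
  (@measurable_id _ R setT).
pose X : {RV (normal_prob (0 : R) 1) >-> R} :=
  HB.pack (fun x : R => x) (isMeasurableFun.Build _ _ _ _ _ mid).
have h := cvg_cdfNy0 X.
have e x : cdf X x = (gcdf x)%:E.
  rewrite /cdf /distribution /pushforward /= /normal_prob /gcdf /gint.
  rewrite /Rintegral fineK.
    by apply: eq_integral => t _; rewrite mul1r.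
  apply: integrable_fin_num => //.
  exact: (integrable_gpdfM (measurable_cst (1 : R)) one_le (measurable_itv _)).
have h2 : gcdf x @[x --> -oo] --> (0 : R).
  have h' : (gcdf x)%:E @[x --> -oo] --> (0 : R)%:E.
    by rewrite (_ : (fun x => (gcdf x)%:E) = cdf X)//; apply/funext => x; rewrite e.
  exact: (fine_cvg h').
rewrite (_ : gtail = fun y => gcdf (- y)); last first.
  by apply/funext => y; rewrite gcdfN.
exact: ((cvgNy_compNP gcdf _).1 h2).
Qed.

(** The Mills ratio. It solves [y' = x y - 1], and the Stein solutions below are written with it or
    bounded by it. *)
Definition mills (x : R) : R := gtail x / gp x.

Lemma mills_ge0 x : 0 <= mills x.
Proof. by rewrite divr_ge0 ?gtail_ge0// ltW ?gpdf_gt0. Qed.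

Lemma dmills (x : R) : is_derive x 1 mills (x * mills x - 1).
Proof.
apply: (is_derive_eq (der_mul (dgtail x) (der_inv (gpdf_neq0 x) (dgpdf x)))).
by rewrite /mills; field; exact: gpdf_neq0.
Qed.

(** For [x > 0], [gpdf x / x - gtail x] has derivative [- gpdf x / x^2] and tends to 0. *)
Lemma mul_mills_le1 (x : R) : x * mills x <= 1.
Proof.
have [x0|x0] := leP x 0.
  by rewrite (le_trans (mulr_le0_ge0 x0 (mills_ge0 x)))// ler01.
suff : 0 <= gp x / x - gtail x.
  rewrite subr_ge0 ler_pdivlMr// mulrC => h.
  by rewrite /mills mulrA ler_pdivrMr ?gpdf_gt0// mul1r.
apply: (@ni_cvg0_ge0 _ (fun t => gp t / t - gtail t) x) => //.
  move=> a b xa ab.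
  apply: (derive_ni (f := fun t => gp t / t - gtail t)
    (df := fun t => - (gp t / t ^+ 2))) => // t /andP[at_ _].
    have t0 : t != 0 by rewrite gt_eqF// (lt_le_trans x0)// (le_trans xa).
    apply: (is_derive_eq (der_sub (der_mul (dgpdf t) (der_inv (f := fun t => t) t0 (der_id t)))
      (dgtail t))).
    by field.
  by rewrite oppr_le0 divr_ge0 ?sqr_ge0// ltW ?gpdf_gt0.
rewrite -[X in _ --> X](subr0 (0 : R)) -[X in _ --> X - _](mulr0 (0 : R)).
apply: cvgB; last exact: gtail_cvg0.
by apply: cvgM; [exact: gpdf_cvg0 | exact: inv_cvg0].
Qed.

(** [gtail x - x / (1 + x^2) gpdf x] has derivative [- 2 gpdf x / (1 + x^2)^2] and tends to 0. The
    inequality says that [x mills x] has a nonnegative derivative. *)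
Lemma mills_lb (x : R) : x <= (1 + x ^+ 2) * mills x.
Proof.
have pos (t : R) : 0 < 1 + t * t by have := sqr_ge0 t; rewrite expr2; lra.
have dn (t : R) : 1 + t * t != 0 by exact: lt0r_neq0.
suff h : 0 <= gtail x - x / (1 + x * x) * gp x.
  rewrite /mills mulrA ler_pdivlMr ?gpdf_gt0// expr2 mulrC -ler_pdivrMl//.
  by rewrite -subr_ge0 (_ : _ - _ = gtail x - x / (1 + x * x) * gp x)//; field.
apply: (@ni_cvg0_ge0 _ (fun t => gtail t - t / (1 + t * t) * gp t) x) => //.
  move=> a b xa ab.
  apply: (derive_ni (f := fun t => gtail t - t / (1 + t * t) * gp t)
    (df := fun t => - (2 * gp t / (1 + t * t) ^+ 2))) => // t _.
    apply: (is_derive_eq (der_sub (dgtail t) (der_mul (der_mul (der_id t)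
      (der_inv (f := fun t => 1 + t * t) (dn t) (der_add (der_cst 1 t) (der_mul (der_id t)
        (der_id t)))))
      (dgpdf t)))).
    by field.
  by rewrite oppr_le0 divr_ge0 ?sqr_ge0// mulr_ge0// ltW ?gpdf_gt0.
rewrite -[X in _ --> X](subr0 (0 : R)).
apply: cvgB; first exact: gtail_cvg0.
apply: (@squeeze_cvgr _ _ _ _ (cst 0) gp).
- near=> t; have t0 : 0 <= t by near: t; exact: nbhs_pinfty_ge.
  apply/andP; split.
    by rewrite !mulr_ge0// ?invr_ge0// ltW ?gpdf_gt0.
  rewrite ler_piMl ?(ltW (gpdf_gt0 _))// ler_pdivrMr// mul1r.
  by have := sqr_ge0 (t - 1); rewrite !expr2; nra.
- exact: cvg_cst.
- exact: gpdf_cvg0.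
Unshelve. all: by end_near. Qed.

Lemma mills_ni (x y : R) : x <= y -> mills y <= mills x.
Proof.
move=> xy; apply: (derive_ni xy (fun t _ => dmills t)) => t _.
by rewrite subr_le0 mul_mills_le1.
Qed.

Lemma mul_mills_nd (x y : R) : x <= y -> x * mills x <= y * mills y.
Proof.
move=> xy; apply: (derive_nd (f := fun t => t * mills t) xy
  (fun t _ => der_mul (der_id t) (dmills t))) => t _.
by have := mills_lb t; rewrite expr2; lra.
Qed.

(** [mills 0 = sqrt (pi / 2)], and [pi < 4] suffices because 283/200 exceeds sqrt 2. *)
Lemma mills0_le : mills 0 <= 283 / 200.
Proof.
have -> : mills 0 = 2^-1 / gp 0.
  rewrite /mills; congr (_ / _).
  have := gcdfD_gtail 0; rewrite -gtailN oppr0; lra.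
rewrite gpdfE expr0n mulr0 oppr0 expR0 mulr1 /normal_peak invrK expr1n mul1r.
have hp : (pi : R) *+ 2 <= (2 * (283 / 200)) ^+ 2.
  by have := @pihalf_lt2 R; rewrite -mulr_natl; lra.
have h : Num.sqrt ((pi : R) *+ 2) <= 2 * (283 / 200).
  rewrite -(@ger0_norm _ (2 * (283 / 200) : R)) -?sqrtr_sqr ?ler_wsqrtr//.
  lra.
Qed.

Lemma gtail_le1 x : gtail x <= 1.
Proof. by have := gcdf_ge0 x; have := gcdfD_gtail x; lra. Qed.

Lemma gcdf_le1 x : gcdf x <= 1.
Proof. by have := gtail_ge0 x; have := gcdfD_gtail x; lra. Qed.

Lemma gcdf_nd x y : x <= y -> gcdf x <= gcdf y.
Proof.
move=> xy; apply: (derive_nd xy (fun t _ => dgcdf t)) => t _.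
exact: ltW (gpdf_gt0 t).
Qed.

Lemma gtail_ni x y : x <= y -> gtail y <= gtail x.
Proof. by move=> /gcdf_nd; rewrite /gtail; lra. Qed.

Lemma millsN x : mills (- x) = gcdf x / gp x.
Proof. by rewrite /mills gtailN gpdfN. Qed.

Lemma mills_cdf_tail x : gtail x * mills (- x) = gcdf x * mills x.
Proof. by rewrite millsN /mills; ring. Qed.

Lemma dmillsN (x : R) : is_derive x 1 (fun t => mills (- t)) (1 + x * mills (- x)).
Proof. by apply: (is_derive_eq (der_reflect (dmills (- x)))); ring. Qed.

(** * Stein equation for the indicator of a half-line *)

Section SteinIndicator.
Variable z : R.
Local Notation c := (gcdf z).

(** The bounded solution of [f' = w f + 1_{w < z} - gcdf z], namely
    [gcdf (min w z) gtail (max w z) / gpdf w]. The branches agree at [z] by [mills_cdf_tail]. *)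
Definition stein_ind (w : R) : R :=
  if w <= z then gtail z * mills (- w) else c * mills w.
Local Notation f := stein_ind.

Lemma stein_ind_le w : w <= z -> f w = gtail z * mills (- w).
Proof. by move=> wz; rewrite /f wz. Qed.

Lemma stein_ind_ge w : z <= w -> f w = c * mills w.
Proof.
rewrite le_eqVlt => /orP[/eqP <-|zw]; last by rewrite /f leNgt zw.
by rewrite /f lexx mills_cdf_tail.
Qed.

Lemma measurable_mills : measurable_fun setT mills.
Proof. exact: continuous_measurable_fun (derive_continuous dmills). Qed.

Lemma measurable_stein_ind : measurable_fun setT f.
Proof.
apply: measurable_fun_ifT.
- by apply: measurable_fun_ler.
- apply: measurable_funM => //; apply: (measurableT_comp measurable_mills).
  exact: measurable_funN.
- by apply: measurable_funM => //; exact: measurable_mills.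
Qed.

Let c0 : 0 <= c. Proof. exact: gcdf_ge0. Qed.
Let c1 : c <= 1. Proof. exact: gcdf_le1. Qed.
Let t0 : 0 <= gtail z. Proof. exact: gtail_ge0. Qed.
Let t1 : gtail z <= 1. Proof. exact: gtail_le1. Qed.
Let ct : c + gtail z = 1. Proof. exact: gcdfD_gtail. Qed.

Lemma stein_ind_ge0 w : 0 <= f w.
Proof. by rewrite /f; case: ifP => _; rewrite mulr_ge0 ?mills_ge0. Qed.

(** [f w <= mills |w|]: where the Mills factor has a negative argument, monotonicity of [gtail] or
    [gcdf] followed by [mills_cdf_tail] replaces it by the factor with the opposite argument. *)
Lemma stein_ind_bound w : `|f w| <= 2.
Proof.
rewrite ger0_norm ?stein_ind_ge0//; apply: (@le_trans _ _ (mills 0)); last first.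
  by rewrite (le_trans mills0_le)//; lra.
have [wz|/ltW zw] := leP w z.
  rewrite stein_ind_le//; have [w0|/ltW w0] := leP w 0.
    rewrite (le_trans (ler_piMl (mills_ge0 _) t1))// mills_ni//; lra.
  apply: (@le_trans _ _ (gtail w * mills (- w))).
    by rewrite ler_wpM2r ?mills_ge0// gtail_ni.
  rewrite mills_cdf_tail (le_trans (ler_piMl (mills_ge0 _) (gcdf_le1 _)))//.
  exact: mills_ni.
rewrite stein_ind_ge//; have [w0|/ltW w0] := leP 0 w.
  by rewrite (le_trans (ler_piMl (mills_ge0 _) c1))// mills_ni.
apply: (@le_trans _ _ (gcdf w * mills w)).
  by rewrite ler_wpM2r ?mills_ge0// gcdf_nd.
rewrite -mills_cdf_tail (le_trans (ler_piMl (mills_ge0 _) (gtail_le1 _)))//.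
by rewrite mills_ni//; lra.
Qed.

Let mulN_mills_le1 (x : R) : - x * mills (- x) <= 1.
Proof. exact: mul_mills_le1. Qed.

Let pM (a b : R) : 0 <= a <= 1 -> 0 <= b <= 1 -> 0 <= a * b <= 1.
Proof.
move=> /andP[a0 a1] /andP[b0 b1]; apply/andP; split; first exact: mulr_ge0.
exact: mulr_ile1.
Qed.

(** The same four cases, with [x mills x <= 1] in place of the bound by [mills 0]. *)
Lemma mul_stein_ind_bound w : `|w * f w| <= 1.
Proof.
have tz : 0 <= gtail z <= 1 by rewrite t0.
have cz : 0 <= c <= 1 by rewrite c0.
have tw : 0 <= gtail w <= 1 by rewrite gtail_ge0 gtail_le1.
have cw : 0 <= gcdf w <= 1 by rewrite gcdf_ge0 gcdf_le1.
have mw := mills_ge0 w; have mw' := mills_ge0 (- w).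
have [wz|/ltW zw] := leP w z.
  rewrite stein_ind_le//; have [w0|/ltW w0] := leP w 0.
    have h : 0 <= - w * mills (- w) <= 1.
      by rewrite mulN_mills_le1 mulr_ge0// oppr_ge0.
    have := pM tz h; rewrite ler_norml => /andP[h1 h2].
    by apply/andP; split; lra.
  have h : 0 <= w * mills w <= 1 by rewrite mul_mills_le1 mulr_ge0.
  have /andP[h1 h2] := pM cw h.
  rewrite ger0_norm; last exact: mulr_ge0 w0 (mulr_ge0 t0 mw').
  apply: le_trans h2; rewrite [leRHS]mulrCA ler_wpM2l//.
  by rewrite -mills_cdf_tail ler_wpM2r// gtail_ni.
rewrite stein_ind_ge//; have [w0|/ltW w0] := leP 0 w.
  have h : 0 <= w * mills w <= 1 by rewrite mul_mills_le1 mulr_ge0.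
  have := pM cz h; rewrite ler_norml => /andP[h1 h2].
  by apply/andP; split; lra.
have h : 0 <= - w * mills (- w) <= 1.
  by rewrite mulN_mills_le1 mulr_ge0// oppr_ge0.
have /andP[h1 h2] := pM tw h.
rewrite -normrN -mulNr ger0_norm; last first.
  by apply: mulr_ge0; [rewrite oppr_ge0 | exact: mulr_ge0].
apply: le_trans h2; rewrite [leRHS]mulrCA mills_cdf_tail ler_wpM2l ?oppr_ge0//.
by rewrite ler_wpM2r// gcdf_nd.
Qed.

(** On each side of [z] this is the monotonicity of [x mills x], on the left after a reflection; the
    common value at [z] joins the two. *)
Lemma mul_stein_ind_nd x y : x <= y -> x * f x <= y * f y.
Proof.
have hl (a b : R) : a <= b -> b <= z -> a * f a <= b * f b.
  move=> ab bz; rewrite !stein_ind_le ?(le_trans ab)//.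
  rewrite mulrCA [leRHS]mulrCA ler_wpM2l//.
  have : - b * mills (- b) <= - a * mills (- a) by apply: mul_mills_nd; lra.
  by rewrite !mulNr lerN2.
have hr (a b : R) : a <= b -> z <= a -> a * f a <= b * f b.
  move=> ab za; rewrite !stein_ind_ge ?(le_trans za)//.
  by rewrite mulrCA [leRHS]mulrCA ler_wpM2l// mul_mills_nd.
move=> xy; have [yz|/ltW zy] := leP y z; first exact: hl.
have [xz|/ltW zx] := leP x z; last exact: hr.
by apply: (@le_trans _ _ (z * f z)); [exact: hl | exact: hr].
Qed.

Let incr_l (b a : R) : b <= a -> a <= z ->
  (a - b) * (b * f b + 1 - c) <= f a - f b <= (a - b) * (a * f a + 1 - c).
Proof.
move=> ba az.
have [x /andP[bx xa] e] := mvt_on (f := fun t => gtail z * mills (- t)) ba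
  (fun t _ => der_mul (der_cst (gtail z) t) (dmillsN t)).
have xz : x <= z by rewrite (le_trans xa).
have -> : f a - f b = (a - b) * (x * f x + 1 - c).
  rewrite (stein_ind_le az) (stein_ind_le (le_trans ba az)) (stein_ind_le xz).
  by rewrite e /gtail; ring.
by rewrite !ler_wpM2l ?subr_ge0// lerB// lerD2r mul_stein_ind_nd.
Qed.

Let incr_r (b a : R) : b <= a -> z <= b ->
  (a - b) * (b * f b - c) <= f a - f b <= (a - b) * (a * f a - c).
Proof.
move=> ba zb.
have [x /andP[bx xa] e] := mvt_on (f := fun t => c * mills t) ba
  (fun t _ => der_mul (der_cst c t) (dmills t)).
have zx : z <= x by rewrite (le_trans zb).
have -> : f a - f b = (a - b) * (x * f x - c).
  rewrite (stein_ind_ge zb) (stein_ind_ge (le_trans zb ba)) (stein_ind_ge zx).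
  by rewrite e; ring.
by rewrite !ler_wpM2l ?subr_ge0// lerB// mul_stein_ind_nd.
Qed.

(** On each side of [z] the mean value theorem gives the slope [x f(x)] plus a constant, and
    [x f(x)] is monotone. An interval across [z] is cut there. *)
Lemma stein_ind_incr b a : b <= a ->
  (a - b) * (b * f b + (a < z)%R%:R - c) <= f a - f b <=
  (a - b) * (a * f a + (b < z)%R%:R - c).
Proof.
move=> ba; case: (ltgtP a z) => [az|za|az] /=.
- by rewrite (le_lt_trans ba az) incr_l// ltW.
- have [bz|zb] := ltP b z; last by rewrite addr0 addr0 incr_r.
  have /andP[h1 h2] := incr_l (ltW bz) (lexx z).
  have /andP[h3 h4] := incr_r (ltW za) (lexx z).
  have m1 := mul_stein_ind_nd (ltW bz); have m2 := mul_stein_ind_nd (ltW za).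
  have -> : f a - f b = (f a - f z) + (f z - f b) by ring.
  have za0 : 0 <= a - z by rewrite subr_ge0 ltW.
  have bz0 : 0 <= z - b by rewrite subr_ge0 ltW.
  have k1 := mulr_ge0 za0 (_ : 0 <= z * f z - b * f b).
  have k2 := mulr_ge0 bz0 (_ : 0 <= a * f a - z * f z).
  rewrite !subr_ge0 in k1 k2; have {}k1 := k1 m1; have {}k2 := k2 m2.
  apply/andP; split.
    by apply: le_trans (lerD h3 h1); rewrite mulr0n; nra.
  by apply: (le_trans (lerD h4 h2)); rewrite mulr1n; nra.
- subst a; rewrite mulr0n addr0.
  have [bz|zb] := ltP b z; last first.
    have -> : b = z by apply/eqP; rewrite eq_le ba.
    by rewrite !subrr !mul0r lexx.
  have /andP[h1 h2] := incr_l ba (lexx z); rewrite mulr1n h2 andbT.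
  apply: le_trans h1; rewrite ler_wpM2l ?subr_ge0//; lra.
Qed.

End SteinIndicator.

(** * Stein equation for smooth test functions *)

Section SteinSmooth.
Variable h : R -> R.
Hypothesis dh : forall x, derivable h x 1.
Hypothesis h1 : forall x, `|h x| <= 1.
Hypothesis h'1 : forall x, `|derive1 h x| <= 1.

Let ch : continuous h.
Proof.
by move=> x; apply: differentiable_continuous; apply/derivable1_diffP; exact: dh.
Qed.

Let mh : measurable_fun setT h. Proof. exact: continuous_measurable_fun. Qed.

Let dhE (x : R) : is_derive x 1 h (derive1 h x).
Proof. by apply: DeriveDef; [exact: dh | rewrite derive1E]. Qed.

Definition gmean : R := \int[leb]_t (h t * gp t).
Local Notation c := gmean.

Lemma gmean_le : `|c| <= 1.
Proof.
rewrite /c (le_trans (le_normr_Rintegral _ _))//.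
  exact: (integrable_gpdfM mh h1).
rewrite -int_gpdf; apply: le_Rintegral => //.
- have -> : EFin \o (fun t => `|h t * gp t|) = EFin \o (fun t => `|h t| * gp t).
    by apply/funext => t /=; rewrite normrM (gtr0_norm (gpdf_gt0 t)).
  apply: (integrable_gpdfM (h := fun t => `|h t|) _ (B := 1)) => //.
    exact: measurableT_comp.
  by move=> x; rewrite normr_id.
- exact: (integrable_gpdfM (measurable_cst (1 : R)) one_le).
- move=> t _; rewrite normrM (gtr0_norm (gpdf_gt0 t)) ler_wpM2r ?(ltW (gpdf_gt0 t))//.
Qed.

Let H (t : R) : R := h t - c.

Let mH : measurable_fun setT H. Proof. exact: measurable_funB. Qed.

Let H2 t : `|H t| <= 2.
Proof.
rewrite (le_trans (ler_normB _ _))//.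
by have := h1 t; have := gmean_le; lra.
Qed.

Let cH : continuous H.
Proof. by move=> x; apply: cvgB; [exact: ch | exact: cvg_cst]. Qed.

Local Notation G := (gint H).

Let int_H : \int[leb]_t (H t * gp t) = 0.
Proof.
transitivity (\int[leb]_t (h t * gp t - c * (one t * gp t))).
  by apply: eq_Rintegral => t _; rewrite /H /=; ring.
have i1 := integrable_gpdfM (measurable_cst (1 : R)) one_le measurableT.
rewrite RintegralB//.
- by rewrite RintegralZl// int_gpdf mulr1 subrr.
- exact: (integrable_gpdfM mh h1).
- have -> : EFin \o (fun t => c * (one t * gp t)) =
      (fun t => c%:E * (one t * gp t)%:E)%E.
    by apply/funext => t /=; rewrite EFinM.
  exact: integrableZl.
Qed.

Let norm_int_le (D : set R) : measurable D ->
  `|\int[leb]_(t in D) (H t * gp t)| <= 2 * \int[leb]_(t in D) (one t * gp t).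
Proof.
move=> mD.
have i1 := integrable_gpdfM (measurable_cst (1 : R)) one_le mD.
rewrite (le_trans (le_normr_Rintegral _ _))//.
  exact: (integrable_gpdfM mH H2).
rewrite -RintegralZl//; apply: le_Rintegral => //.
- have -> : EFin \o (fun t => `|H t * gp t|) = EFin \o (fun t => `|H t| * gp t).
    by apply/funext => t /=; rewrite normrM (gtr0_norm (gpdf_gt0 t)).
  apply: (integrable_gpdfM (h := fun t => `|H t|) _ (B := 2)) => //.
    exact: measurableT_comp.
  by move=> x; rewrite normr_id.
- have -> : EFin \o (fun t => 2 * (one t * gp t)) =
      (fun t => 2%:E * (one t * gp t)%:E)%E.
    by apply/funext => t /=; rewrite EFinM.
  exact: integrableZl.
- move=> t _; rewrite normrM (gtr0_norm (gpdf_gt0 t)) mul1r.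
  by rewrite ler_wpM2r ?(ltW (gpdf_gt0 t)).
Qed.

Let G_cdf w : `|G w| <= 2 * gcdf w. Proof. exact: norm_int_le. Qed.

(** [H] has Gaussian mean 0, so its integral over the left half-line is minus that over the right
    one. With [G_cdf] this controls [stein_fun] at both ends. *)
Let G_tail w : `|G w| <= 2 * gtail w.
Proof.
have e := gint_split mH H2 w; rewrite int_H in e.
have -> : G w = - \int[leb]_(t in `]w, +oo[) (H t * gp t) by rewrite -[LHS]addr0 -e; lra.
by rewrite normrN gtailE; exact: norm_int_le.
Qed.

Definition stein_fun (w : R) : R := G w / gp w.
Local Notation f := stein_fun.
Definition stein_der (w : R) : R := H w + w * f w.
Local Notation f1 := stein_der.

Lemma dstein (w : R) : is_derive w 1 f (f1 w).
Proof.
have dG := dgint mH H2 (cH (x := w)).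
apply: (is_derive_eq (der_mul dG (der_inv (gpdf_neq0 w) (dgpdf w)))).
by rewrite /f1 /f; field; exact: gpdf_neq0.
Qed.

Let f_mills w : `|f w| <= 2 * mills w.
Proof.
rewrite /f normrM normfV (gtr0_norm (gpdf_gt0 w)) /mills mulrA.
by rewrite ler_wpM2r// invr_ge0 ltW ?gpdf_gt0.
Qed.

Let f_millsN w : `|f w| <= 2 * mills (- w).
Proof.
rewrite /f normrM normfV (gtr0_norm (gpdf_gt0 w)) millsN mulrA.
by rewrite ler_wpM2r// invr_ge0 ltW ?gpdf_gt0.
Qed.

(** Of [mills w] and [mills (- w)], the one with nonnegative argument is at most
    [mills 0 <= 283/200]. *)
Lemma stein_fun_bound w : `|f w| <= 283 / 100.
Proof.
have m0 := mills0_le.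
have [w0|/ltW w0] := leP 0 w.
  by have := mills_ni w0; have := f_mills w; lra.
have : mills (- w) <= mills 0 by apply: mills_ni; rewrite oppr_ge0.
by have := f_millsN w; lra.
Qed.

Let wf_bound w : `|w * f w| <= 2.
Proof.
rewrite normrM; have [w0|/ltW w0] := leP 0 w.
  rewrite (ger0_norm w0); have := mul_mills_le1 w.
  have := ler_wpM2l w0 (f_mills w); rewrite mulrCA; lra.
rewrite (ler0_norm w0); have := mul_mills_le1 (- w).
have w0' : 0 <= - w by rewrite oppr_ge0.
have := ler_wpM2l w0' (f_millsN w); rewrite mulrCA; lra.
Qed.

Lemma stein_der_bound w : `|f1 w| <= 4.
Proof.
rewrite /f1 (le_trans (ler_normD _ _))//.
by have := H2 w; have := wf_bound w; lra.
Qed.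

Lemma stein_eq w : f1 w - w * f w = h w - c.
Proof. by rewrite /f1 addrK. Qed.

(** The inhomogeneous term of [f'' = w f' + K], the derivative of the Stein equation; it is bounded
    by [1 + 283/100]. *)
Let K (w : R) : R := derive1 h w + f w.

Let K_bound w : `|K w| <= 383 / 100.
Proof.
rewrite /K (le_trans (ler_normD _ _))//.
by have := h'1 w; have := stein_fun_bound w; lra.
Qed.

Lemma dstein_der (w : R) : is_derive w 1 f1 (w * f1 w + K w).
Proof.
apply: (is_derive_eq (der_add (der_sub (dhE w) (der_cst c w)) (der_mul (der_id w) (dstein w)))).
by rewrite /K; ring.
Qed.

(* A bounded solution of [g' = w g + k] with [|k| <= C] satisfies [w g <= C] for
   [w > 0], because [gpdf * (g - C / w)] is nondecreasing and vanishes at infinity. *)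
Let ode_bound (g k : R -> R) (C B : R) :
  (forall x : R, is_derive x 1 g (x * g x + k x)) ->
  (forall x, `|k x| <= C) -> (forall x, `|g x| <= B) ->
  forall w, 0 < w -> w * g w <= C.
Proof.
move=> dg kC gB w w0.
have C0 : 0 <= C by exact: le_trans (kC 0).
suff : 0 <= - (gp w * (g w - C * w^-1)).
  rewrite oppr_ge0 pmulr_rle0 ?gpdf_gt0// subr_le0 => hw.
  by rewrite mulrC -ler_pdivlMr.
apply: (@ni_cvg0_ge0 _ (fun t => - (gp t * (g t - C * t^-1))) w) => //.
  move=> a b wa ab.
  apply: (derive_ni (f := fun t => - (gp t * (g t - C * t^-1)))
    (df := fun t => - (gp t * (C + k t + C / t ^+ 2)))) => // t /andP[at_ _].
    have t0 : t != 0 by rewrite gt_eqF// (lt_le_trans w0)// (le_trans wa).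
    apply: (is_derive_eq (der_opp (der_mul (dgpdf t) (der_sub (dg t)
      (der_mul (der_cst C t) (der_inv (f := fun t => t) t0 (der_id t))))))).
    by field.
  rewrite oppr_le0 mulr_ge0 ?(ltW (gpdf_gt0 t))// addr_ge0 ?divr_ge0 ?sqr_ge0//.
  by have := kC t; rewrite ler_norml; lra.
have cb : (gp t * (B + C * t^-1)) @[t --> +oo] --> (0 : R).
  rewrite -(mul0r (B + C * 0)); apply: cvgM; first exact: gpdf_cvg0.
  apply: cvgD; first exact: cvg_cst.
  by apply: cvgM; [exact: cvg_cst | exact: inv_cvg0].
apply: (@squeeze_cvgr _ _ _ _ (fun t => - (gp t * (B + C * t^-1)))
  (fun t => gp t * (B + C * t^-1))) => //; last first.
  by rewrite -oppr0; exact: cvgN.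
near=> t; have t0 : 0 < t by near: t; exact: nbhs_pinfty_gt.
rewrite -ler_norml normrN normrM (gtr0_norm (gpdf_gt0 t)) ler_wpM2l ?(ltW (gpdf_gt0 t))//.
rewrite (le_trans (ler_normB _ _))// lerD// normrM (ger0_norm C0) gtr0_norm//.
by rewrite invr_gt0.
Unshelve. all: by end_near. Qed.

(** [ode_bound] is one-sided and concerns positive arguments, so it is applied to [f1], to [- f1]
    and to their reflections. *)
Let wf1_bound w : `|w * f1 w| <= 383 / 100.
Proof.
have pos (x : R) : 0 < x -> `|x * f1 x| <= 383 / 100.
  move=> x0; have h2 := ode_bound dstein_der K_bound stein_der_bound x0.
  have h3 : x * (- f1 x) <= 383 / 100.
    apply: (@ode_bound (fun t => - f1 t) (fun t => - K t) _ 4) => // t.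
    - by apply: (is_derive_eq (der_opp (dstein_der t))); ring.
    - by rewrite normrN K_bound.
    - by rewrite normrN stein_der_bound.
  by rewrite ler_norml; apply/andP; split; lra.
have neg (x : R) : 0 < x -> `|x * f1 (- x)| <= 383 / 100.
  move=> x0; have h2 : x * f1 (- x) <= 383 / 100.
    apply: (@ode_bound (fun t => f1 (- t)) (fun t => - K (- t)) _ 4) => // t.
    - by apply: (is_derive_eq (der_reflect (dstein_der (- t)))); ring.
    - by rewrite normrN K_bound.
    - by rewrite stein_der_bound.
  have h3 : x * (- f1 (- x)) <= 383 / 100.
    apply: (@ode_bound (fun t => - f1 (- t)) (fun t => K (- t)) _ 4) => // t.
    - by apply: (is_derive_eq (der_opp (der_reflect (dstein_der (- t))))); ring.
    - by rewrite normrN stein_der_bound.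
  by rewrite ler_norml; apply/andP; split; lra.
have [w0|w0|->] := ltgtP w 0; last by rewrite mul0r normr0; lra.
  have := neg (- w); rewrite opprK mulNr normrN; apply; lra.
exact: pos.
Qed.

Let der2_bound w : `|w * f1 w + K w| <= 383 / 50.
Proof.
rewrite (le_trans (ler_normD _ _))//.
by have := wf1_bound w; have := K_bound w; lra.
Qed.

(** [F2] is only known to be bounded, so a comparison replaces the integral remainder: [k] vanishes
    at [a], and the sign of its derivative makes [a] a maximum. *)
Let taylor_aux (F F1 F2 : R -> R) (C : R) :
  (forall x : R, is_derive x 1 F (F1 x)) -> (forall x : R, is_derive x 1 F1 (F2 x)) ->
  (forall x, `|F2 x| <= 2 * C) ->
  forall a b, F b - F a - (b - a) * F1 a <= C * (b - a) ^+ 2.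
Proof.
move=> dF dF1 F2C a b.
have lip x y : x <= y -> F1 y - F1 x <= 2 * C * (y - x) /\
    - (2 * C * (y - x)) <= F1 y - F1 x.
  move=> xy; have [u _ ->] := mvt_on xy (fun t _ => dF1 t).
  have := F2C u; rewrite ler_norml => /andP[l1 l2]; rewrite -mulNr.
  by rewrite !ler_wpM2r ?subr_ge0.
pose k (t : R) : R := F t - F a - (t - a) * F1 a - C * ((t - a) * (t - a)).
have dk (t : R) : is_derive t 1 k (F1 t - F1 a - 2 * C * (t - a)).
  have dta := der_sub (der_id t) (der_cst a t).
  apply: (is_derive_eq (der_sub (der_sub (der_sub (dF t) (der_cst (F a) t)) (der_mul dta
    (der_cst (F1 a) t)))
    (der_mul (der_cst C t) (der_mul dta dta)))).
  by ring.
have ka : k a = 0 by rewrite /k; ring.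
suff : k b <= k a by rewrite ka /k expr2; lra.
have [ab|/ltW ba] := leP a b.
  apply: (derive_ni ab (fun t _ => dk t)) => t /andP[at_ _].
  by have [] := lip _ _ at_; lra.
apply: (derive_nd ba (fun t _ => dk t)) => t /andP[_ ta].
by have [] := lip _ _ ta; lra.
Qed.

Lemma stein_taylor a b : `|f b - f a - (b - a) * f1 a| <= 383 / 100 * (b - a) ^+ 2.
Proof.
have d2 x : `|x * f1 x + K x| <= 2 * (383 / 100) by have := der2_bound x; lra.
have := taylor_aux dstein dstein_der d2 a b.
have d2' x : `|- (x * f1 x + K x)| <= 2 * (383 / 100) by rewrite normrN.
have := taylor_aux (fun t => der_opp (dstein t)) (fun t => der_opp (dstein_der t)) d2' a b.
by rewrite ler_norml => *; apply/andP; split; lra.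
Qed.

Lemma measurable_stein_fun : measurable_fun setT f.
Proof. exact: continuous_measurable_fun (derive_continuous dstein). Qed.

Lemma measurable_stein_der : measurable_fun setT f1.
Proof. exact: continuous_measurable_fun (derive_continuous dstein_der). Qed.

End SteinSmooth.

End GaussianTail.

(** [k] coincides almost everywhere with the Radon-Nikodym derivative of [nu], for which the change
    of variables holds. It turns normal expectations into Lebesgue integrals. *)
Lemma integral_density d (T : measurableType d) (R : realType)
    (mu : {sigma_finite_measure set T -> \bar R}) (nu : {finite_measure set T -> \bar R})
    (k h : T -> R) (B : R) :
  mu.-integrable setT (EFin \o k) ->
  (forall A, measurable A -> nu A = (\int[mu]_(x in A) (k x)%:E)%E) ->
  measurable_fun setT h -> (forall x, `|h x| <= B) ->
  (\int[nu]_x (h x)%:E = \int[mu]_x (h x * k x)%:E)%E.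
Proof.
move=> ik nuE mh hB.
have numu : nu `<< mu.
  apply/null_content_dominatesP => A mA A0; rewrite nuE//.
  apply: null_set_integral => //; apply: measurable_funTS.
  by case/integrableP: ik.
have ih : nu.-integrable setT (EFin \o h).
  apply: measurable_bounded_integrable => //.
    by rewrite -ge0_fin_numE// fin_num_measure.
  by exists B; split; [exact: num_real | move=> N BN x _ /=; rewrite (le_trans (hB x))// ltW].
rewrite -(Radon_Nikodym_change_of_variables numu measurableT ih).
pose rn := Radon_Nikodym (charge_of_finite_measure nu) mu.
have irn : mu.-integrable setT rn by exact: Radon_Nikodym_integrable.
have ae : ae_eq mu setT rn (EFin \o k).
  apply: integral_ae_eq => //; first by case/integrableP: ik.
  move=> E _ mE; rewrite -(Radon_Nikodym_integral (mu := mu) _ mE)//.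
  exact: nuE.
have mk : measurable_fun setT (EFin \o k) by case/integrableP: ik.
apply: ae_eq_integral => //.
- apply: emeasurable_funM; first exact/measurable_EFinP.
  by case/integrableP: irn.
- apply/measurable_EFinP; apply: measurable_funM => //; exact/measurable_EFinP.
- apply: filterS ae => x /(_ I) e _; rewrite EFinM; congr (_ * _)%E.
  exact: e.
Qed.

(** * Cells of an arrangement of affine functions *)

Section Cells.
Context {R : realType} {V : lmodType R}.
Implicit Types (X : set V) (l : V -> R) (L : seq (V -> R)).

Definition affine_fun l := forall x y (t : R),
  l ((1 - t) *: x + t *: y) = (1 - t) * l x + t * l y.

(* Convex and open in its affine hull. *)
Definition rel_open_convex X := forall x y, X x -> X y ->
  exists2 e : R, 0 < e & forall t, - e <= t <= 1 + e -> X ((1 - t) *: x + t *: y).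

Definition pos_part X l : set V := X `&` [set x | 0 < l x].

Definition zero_part X l : set V := X `&` [set x | l x = 0].

Fixpoint cell X L (s : seq bool) : set V :=
  match L, s with
  | l :: L', b :: s' => cell (pos_part X (if b then l else \- l)) L' s'
  | _, _ => X
  end.

Fixpoint signs n : seq (seq bool) :=
  if n is n'.+1 then map (cons true) (signs n') ++ map (cons false) (signs n')
  else [:: [::]].

(** Regions are counted through their sign vectors, which makes the count recursive in the list of
    functions. *)
Definition ncells X L : nat :=
  count (fun s => `[< cell X L s !=set0 >]) (signs (size L)).

Lemma ncells0 X : ncells X [::] = `[< X !=set0 >] :> nat.
Proof. by rewrite /ncells /= addn0. Qed.

Lemma ncells_cons X l L :
  ncells X (l :: L) = (ncells (pos_part X l) L + ncells (pos_part X (\- l)) L)%N.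
Proof. by rewrite /ncells /= count_cat !count_map. Qed.

Lemma ncells_set0 L : ncells set0 L = 0%N.
Proof.
elim: L => [|l L IH]; first by rewrite ncells0 asboolF// => -[].
by rewrite ncells_cons /pos_part !set0I IH.
Qed.

Lemma affine_opp l : affine_fun l -> affine_fun (\- l).
Proof. by move=> al x y t /=; rewrite al; ring. Qed.

Lemma small_pos (a b : R) : 0 < a -> 0 < b ->
  exists2 e : R, 0 < e & forall t, - e <= t <= 1 + e -> 0 < (1 - t) * a + t * b.
Proof.
move=> a0 b0; have s0 : 0 < a + b by lra.
exists (Num.min a b / (2 * (a + b))).
  by rewrite divr_gt0 ?lt_min ?a0 ?b0//; lra.
set e := _ / _ => t /andP[h1 h2].
have em : 2 * (e * (a + b)) = Num.min a b.
  by rewrite /e; field; rewrite lt0r_neq0.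
have e0 : 0 < e by rewrite divr_gt0 ?lt_min ?a0 ?b0//; lra.
have ma : Num.min a b <= a by rewrite ge_min lexx.
have mb : Num.min a b <= b by rewrite ge_min lexx orbT.
have ea : 0 < e * a by rewrite mulr_gt0.
have eb : 0 < e * b by rewrite mulr_gt0.
have [ab|ba] := leP a b.
  have : 0 <= (t + e) * (b - a) by rewrite mulr_ge0; lra.
  rewrite -(pmulr_rgt0 _ (ltr0n R 1))//; nra.
have : 0 <= (1 + e - t) * (a - b) by rewrite mulr_ge0; lra.
nra.
Qed.

Lemma rel_open_pos X l : affine_fun l -> rel_open_convex X -> rel_open_convex (pos_part X l).
Proof.
move=> al rX x y [Xx lx] [Xy ly]; have [e e0 he] := rX _ _ Xx Xy.
have [e' e'0 he'] := small_pos lx ly.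
exists (Num.min e e'); first by rewrite lt_min e0.
have m1 : Num.min e e' <= e by rewrite ge_min lexx.
have m2 : Num.min e e' <= e' by rewrite ge_min lexx orbT.
move=> t /andP[t1 t2]; split; first by apply: he; lra.
by rewrite /= al; apply: he'; lra.
Qed.

Lemma rel_open_zero X l : affine_fun l -> rel_open_convex X -> rel_open_convex (zero_part X l).
Proof.
move=> al rX x y [Xx lx] [Xy ly]; have [e e0 he] := rX _ _ Xx Xy.
exists e => // t ht; split; first exact: he.
by rewrite /= al lx ly !mulr0 addr0.
Qed.

(** If [l] vanishes at [y] but not at [x], it is nonzero on the rest of the segment from [y] to [x],
    and near [y] the condition [0 < l'] persists. This carries the hypothesis of
    [deletion_restriction] over to the parts of [X]. *)
Lemma pos_nonzero X l l' : affine_fun l -> affine_fun l' -> rel_open_convex X ->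
  (exists2 x, X x & l x != 0) -> pos_part X l' !=set0 ->
  exists2 x, pos_part X l' x & l x != 0.
Proof.
move=> al al' rX [x Xx lx] [y [Xy ly]].
have [ly0|] := eqVneq (l y) 0; last by exists y.
have [e e0 he] := rX _ _ Xy Xx.
have [k [k0 k1 kl]] : exists k : R, [/\ 0 < k, k <= 1 & 0 < (1 - k) * l' y + k * l' x].
  have [lx0|lx0] := leP (l' x) 0; last by exists 1; split; lra.
  have d0 : 0 < 2 * (l' y - l' x) by rewrite /= in ly; lra.
  (* Half the parameter at which [l'] vanishes on the way from [y] to [x]. *)
  exists (l' y / (2 * (l' y - l' x))); split; first exact: divr_gt0.
    by rewrite ler_pdivrMr//; rewrite /= in ly; lra.
  set k := _ / _; have : k * (2 * (l' y - l' x)) = l' y by rewrite /k divfK// lt0r_neq0.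
  by rewrite /= in ly; lra.
exists ((1 - k) *: y + k *: x); last by rewrite al ly0 mulr0 add0r mulf_neq0// lt0r_neq0.
by split; [apply: he; lra|rewrite /= al'].
Qed.

(** Relative openness allows a small step past the zero [y], away from [x], where [l] has the sign
    opposite to [l x]. *)
Lemma rel_open_zero_signs X l : affine_fun l -> rel_open_convex X -> (exists2 x,
  X x & l x != 0) ->
  zero_part X l !=set0 -> pos_part X l !=set0 /\ pos_part X (\- l) !=set0.
Proof.
move=> al rX [x Xx lx] [y [Xy ly]].
have [e e0 he] := rX _ _ Xy Xx.
have h (t : R) : - e <= t <= 1 + e -> X ((1 - t) *: y + t *: x) /\
   l ((1 - t) *: y + t *: x) = t * l x.
  by move=> ht; split; [exact: he|rewrite al ly mulr0 add0r].
have [h1 h2] : X ((1 - - e) *: y + - e *: x) /\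
   l ((1 - - e) *: y + - e *: x) = - e * l x by apply: h; lra.
have [lx0|lx0] : l x < 0 \/ 0 < l x by apply/orP; rewrite -neq_lt.
  split; last by exists x; split => //=; lra.
  by exists ((1 - - e) *: y + - e *: x); split => //=; rewrite h2; nra.
split; first by exists x.
by exists ((1 - - e) *: y + - e *: x); split => //=; rewrite h2; nra.
Qed.

(** Induction on the other functions: splitting by the sign of [k] commutes with taking the parts
    for [l], so both counts add over the two halves. In the base case [l] cuts [X] into two pieces
    if it has a zero on it, and leaves one piece otherwise. *)
Lemma deletion_restriction X l L : affine_fun l -> (forall k, List.In k L -> affine_fun k) ->
  rel_open_convex X -> (X !=set0 -> exists2 x, X x & l x != 0) ->
  ncells X (l :: L) = (ncells X L + ncells (zero_part X l) L)%N.
Proof.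
elim: L X => [|k L IH] X al aL rX X0.
  rewrite ncells_cons !ncells0.
  have [Xn|Xn] := pselect (X !=set0); last first.
    rewrite !asboolF// => -[x [Xx _]]; apply: Xn; by exists x.
  have lX := X0 Xn; rewrite (asboolT Xn).
  have [zn|zn] := pselect (zero_part X l !=set0).
    by have [p q] := rel_open_zero_signs al rX lX zn; rewrite !asboolT.
  rewrite (asboolF zn).
  have [x Xx lx] := lX.
  wlog lx0 : l al {X0 lX} zn lx / 0 < l x.
    move=> H; have [lx0|lx0] : l x < 0 \/ 0 < l x by apply/orP; rewrite -neq_lt.
      rewrite addnC -(H (\- l)) => //; last 4 first.
      - exact: affine_opp.
      - move=> -[y [Xy /eqP]] /=; rewrite oppr_eq0 => /eqP ly; apply: zn.
        by exists y.
      - by rewrite oppr_eq0.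
      - by rewrite oppr_gt0.
      congr (_ + `[< pos_part X _ !=set0 >])%N.
      by apply/funext => y /=; rewrite opprK.
    exact: H.
  rewrite asboolT; last by exists x.
  rewrite asboolF// => -[y [Xy /=]]; rewrite oppr_gt0 => ly; apply: zn.
  have [e e0 he] := rX _ _ Xy Xx.
  have d0 : 0 < l x - l y by lra.
  (* The zero of [l] on the segment from [y], where it is negative, to [x], where it is positive. *)
  pose t := - l y / (l x - l y).
  have tE : t * (l x - l y) = - l y by rewrite /t divfK// lt0r_neq0.
  exists ((1 - t) *: y + t *: x); split; last by rewrite /= al; lra.
  have t0 : 0 <= t by rewrite divr_ge0//; lra.
  have t1 : t <= 1 by rewrite ler_pdivrMr//; lra.
  by apply: he; lra.
have ak : affine_fun k by apply: aL; left.
have aL' : forall k, List.In k L -> affine_fun k by move=> k' h; apply: aL; right.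
have posC (Y : set V) a b : pos_part (pos_part Y a) b = pos_part (pos_part Y b) a.
  by rewrite /pos_part setIAC.
have zposC (Y : set V) a b : pos_part (zero_part Y a) b = zero_part (pos_part Y b) a.
  by rewrite /pos_part /zero_part setIAC.
have step k' : affine_fun k' -> ncells (pos_part X k') (l :: L) =
    (ncells (pos_part X k') L + ncells (zero_part (pos_part X k') l) L)%N.
  move=> ak'; apply: IH => //; first exact: rel_open_pos.
  move=> n0; apply: pos_nonzero => //; apply: X0.
  by move: n0 => -[x [Xx _]]; exists x.
rewrite ncells_cons (ncells_cons _ k) (ncells_cons _ k) (ncells_cons X k) (ncells_cons _ k).
rewrite !(posC _ l) !(posC _ (\- l)) !zposC.
have := step _ ak; have := step _ (affine_opp ak); rewrite !(ncells_cons _ l) => h1 h2.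
by rewrite addnACA h2 h1 addnACA.
Qed.

End Cells.

Section CellSigns.
Context {R : realType} {V : lmodType R}.
Implicit Types (X : set V) (L : seq (V -> R)).

Definition sgns L (x : V) : seq bool := [seq 0 < l x | l <- L].

Lemma cellP X L s x : size s = size L ->
  cell X L s x <-> [/\ X x, forall l, List.In l L -> l x <> 0 & s = sgns L x].
Proof.
elim: L s X => [|l L IH] [|b s]//= X; first by split=> [Xx|[]].
move=> [sz]; rewrite IH//; split.
  move=> [[Xx bl] L0 ->]; have lx : l x != 0 /\ b = (0 < l x).
    case: b bl => /= bl; first by rewrite bl lt0r_neq0.
    by rewrite oppr_gt0 in bl; rewrite ltr0_neq0// ltNge (ltW bl).
  case: lx => /eqP lx ->; split => // k [<-//|]; exact: L0.
move=> [Xx L0 [-> ->]]; split => //; last by move=> k kL; apply: L0; right.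
split => //; have /eqP := L0 l (or_introl erefl).
change (l x != 0 -> 0 < (if 0 < l x then l else \- l) x).
by have [h _|h lx0] := ltP 0 (l x); rewrite //= oppr_gt0 lt_neqAle lx0.
Qed.

Lemma mem_signs n s : (s \in signs n) = (size s == n).
Proof.
elim: n s => [|n IH] [|b s]; rewrite //= mem_cat.
  by apply/negbTE/norP; split; apply/mapP => -[].
rewrite eqSS -IH; case: b; rewrite mem_map ?orbF; try by move=> ? ? [].
  by rewrite -[RHS]orbF; congr orb; apply/negbTE/mapP => -[].
by rewrite -[RHS]orFb; congr orb; apply/negbTE/mapP => -[].
Qed.

Lemma uniq_signs n : uniq (signs n).
Proof.
elim: n => //= n IH; rewrite cat_uniq !map_inj_uniq ?IH ?andbT; try by move=> ? ? [].
by apply/hasPn => s /mapP[t _ ->]; apply/mapP => -[].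
Qed.

End CellSigns.

(** * Chords, their lines and the regions of the disc *)

Section PlaneCells.
Context {R : realType}.
Implicit Types (p q : R * R) (ps : seq (R * R)).

(* [p = (theta, phi)]; the chord lies on the line [ell p x = 0]. *)
Definition ell p (x : R * R) : R :=
  x.1 * cos (p.2 - p.1) + x.2 * sin (p.2 - p.1) - cos p.1.

Lemma affine_ell p : affine_fun (ell p).
Proof. by move=> x y t; rewrite /ell /= /GRing.scale /=; ring. Qed.

(** [1 - |z|^2] at parameter [t] equals [(1 - t) a + t b + t (1 - t) D], with [a], [b] its values at
    the endpoints and [D] their squared distance; slightly outside [0, 1] the negative terms are of
    order [e]. *)
Lemma rel_open_open_disc : rel_open_convex (@open_disc R).
Proof.
move=> [x1 x2] [y1 y2]; rewrite /open_disc /= => hx hy.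
pose a := 1 - (x1 ^+ 2 + x2 ^+ 2); pose b := 1 - (y1 ^+ 2 + y2 ^+ 2).
pose D := (x1 - y1) ^+ 2 + (x2 - y2) ^+ 2.
have D0 : 0 <= D by rewrite addr_ge0 ?sqr_ge0.
have a0 : 0 < a by rewrite /a; lra.
have b0 : 0 < b by rewrite /b; lra.
pose e := Num.min a b / (8 * (1 + D)).
have eE : e * D * 8 = Num.min a b - 8 * e by rewrite /e; field; rewrite lt0r_neq0//; lra.
have e0 : 0 < e by rewrite divr_gt0 ?lt_min ?a0//; lra.
have ma : Num.min a b <= a by rewrite ge_min lexx.
have mb : Num.min a b <= b by rewrite ge_min lexx orbT.
have a1 : a <= 1 by rewrite /a lerBlDr lerDl addr_ge0 ?sqr_ge0.
have b1 : b <= 1 by rewrite /b lerBlDr lerDl addr_ge0 ?sqr_ge0.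
have eD0 : 0 <= e * D by rewrite mulr_ge0// ltW.
have e1 : e <= 1 / 8 by lra.
have ab0 : 0 < a * b by rewrite mulr_gt0.
have eab : e * a <= e /\ e * b <= e by split; rewrite ger_pMr.
have bd (u : R) : 0 <= u -> u <= e -> u * (1 + u) * D <= 2 * (e * D).
  move=> u0 ue; rewrite mulrA ler_wpM2r//.
  have : u * u <= e * 1 by rewrite ler_pM//; lra.
  lra.
exists e => // t /andP[t1 t2].
suff : 0 < (1 - t) * a + t * b + t * (1 - t) * D.
  move=> h; rewrite /GRing.scale /= -subr_gt0; apply: lt_le_trans h _.
  rewrite le_eqVlt; apply/orP; left; apply/eqP; rewrite /a /b /D; ring.
have [t0|t0] := ltP t 0.
  have := bd (- t); have : 0 <= - t * a by rewrite mulr_ge0//; lra.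
  have : - t * b <= e * b by rewrite ler_wpM2r//; lra.
  by lra.
have [t3|t3] := ltP 1 t.
  have := bd (t - 1); have : 0 <= (t - 1) * b by rewrite mulr_ge0//; lra.
  have : (t - 1) * a <= e * a by rewrite ler_wpM2r//; lra.
  by lra.
have : 0 <= t * (1 - t) * D by rewrite !mulr_ge0//; lra.
have [tt|tt] := ltP 0 t.
  have : 0 < t * b by rewrite mulr_gt0.
  have : 0 <= (1 - t) * a by rewrite mulr_ge0//; lra.
  by lra.
have -> : t = 0 by lra.
by lra.
Qed.

(** The endpoints have angles [m + t] and [m - t], so the chord lies on the line with normal
    direction [m] at signed distance [cos t]. A point of this line in the open disc has coordinate
    [b] along it with [b^2 < sin t ^ 2], hence lies between the endpoints. *)
Lemma chord_ell (t p : R) x : open_disc x -> chord t p x <-> ell (t, p) x = 0.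
Proof.
move=> hx; pose m := p - t.
have -> : chord t p = segment (circle_point (m + t)) (circle_point (m - t)).
  by rewrite /chord /m; congr (segment (circle_point _) (circle_point _)); ring.
rewrite /segment /circle_point /= /ell /= -/m cosD cosB sinD sinB.
have mm := cos2Dsin2 m; have tt := cos2Dsin2 t.
split.
  move=> [s _ ->] /=; rewrite /GRing.scale /=.
  transitivity (cos t * (cos m ^+ 2 + sin m ^+ 2 - 1)); first by ring.
  by rewrite mm; ring.
case: x hx => x1 x2; rewrite /open_disc /= => hx e0.
pose b := x2 * cos m - x1 * sin m.
have x1E : x1 = cos t * cos m - b * sin m.
  have -> : cos t = x1 * cos m + x2 * sin m by lra.
  transitivity (x1 * (cos m ^+ 2 + sin m ^+ 2)); first by rewrite mm mulr1.
  by rewrite /b; ring.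
have x2E : x2 = cos t * sin m + b * cos m.
  have -> : cos t = x1 * cos m + x2 * sin m by lra.
  transitivity (x2 * (cos m ^+ 2 + sin m ^+ 2)); first by rewrite mm mulr1.
  by rewrite /b; ring.
have bs : b ^+ 2 < sin t ^+ 2.
  have : x1 ^+ 2 + x2 ^+ 2 = (cos t ^+ 2 + b ^+ 2) * (cos m ^+ 2 + sin m ^+ 2).
    by rewrite x1E x2E; ring.
  by rewrite mm mulr1; lra.
have s0 : sin t != 0.
  by apply: contraTneq bs => ->; rewrite -leNgt expr0n sqr_ge0.
pose k := b / sin t; have kE : b = k * sin t by rewrite /k divfK.
have k1 : k ^+ 2 < 1.
  by move: bs; rewrite kE exprMn gtr_pMl// exprn_even_gt0.
have k11 : -1 <= k <= 1.
  by rewrite -ler_norml -(@ler_pXn2r _ 2)// ?nnegrE// expr1n real_normK// ?num_real// ltW.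
exists ((1 - k) / 2); first by move/andP : k11 => [? ?]; apply/andP; split; lra.
rewrite /GRing.scale /= x1E x2E kE.
have addE (u v w z : R) : (u, v) + (w, z) = (u + w, v + z) :> R * R by [].
by rewrite /scale_pair addE /GRing.scale /=; congr pair; field.
Qed.

Lemma connected_segment (x y : R * R) :
  connected [set (1 - t) *: x + t *: y | t in `[0 : R, 1]].
Proof.
apply: connected_continuous_connected; first exact: segment_connected.
apply: continuous_subspaceT => t.
apply: cvgD; apply: cvgZr_tmp; last exact: cvg_id.
by apply: cvgB; [exact: cvg_cst|exact: cvg_id].
Qed.

Lemma continuous_ell p : continuous (ell p).
Proof.
move=> x; apply: cvgB; last exact: cvg_cst.
by apply: cvgD; (apply: cvgM; last exact: cvg_cst); [exact: cvg_fst|exact: cvg_snd].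
Qed.

(** The image of [B] is an interval avoiding 0. *)
Lemma connected_sign (B : set (R * R)) (g : R * R -> R) x y : connected B ->
  continuous g -> (forall z, B z -> g z <> 0) -> B x -> B y ->
  (0 < g x) = (0 < g y).
Proof.
move=> cB cg B0; wlog : x y / 0 < g x.
  move=> H Bx By; case: (ltP 0 (g x)) => gx; first by rewrite -(H x y) ?gx.
  by case: (ltP 0 (g y)) => gy//; have := H y x gy By Bx; rewrite gy ltNge gx.
move=> gx Bx By; rewrite gx; apply/esym/negP => -/negP; rewrite -leNgt => gy.
have /connected_intervalP iB : connected (g @` B).
  by apply: connected_continuous_connected => //; exact: continuous_subspaceT.
have [z Bz] : (g @` B) 0.
  by apply: (iB (g y) (g x)); [exists y|exists x|rewrite gy ltW].
exact: B0.
Qed.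

Section Regions.
Variables (n : nat) (theta phi : 'I_n -> R).
Let A := chord_complement theta phi.
Let L := [seq ell (theta i, phi i) | i <- enum 'I_n].

Lemma in_lines l : List.In l L -> exists i, l = ell (theta i, phi i).
Proof.
rewrite /L; elim: (enum _) => //= i s IH [<-|]; last exact: IH.
by exists i.
Qed.

Lemma lines_in i : List.In (ell (theta i, phi i)) L.
Proof.
rewrite /L; have : i \in enum 'I_n by rewrite mem_enum.
by elim: (enum _) => //= j s IH; rewrite inE => /orP[/eqP ->|/IH h]; [left|right].
Qed.

Lemma chord_complementP x :
  A x <-> open_disc x /\ forall l, List.In l L -> l x <> 0.
Proof.
split=> [[Dx nx]|[Dx nx]].
  split=> // l /in_lines[i ->] lx; apply: nx; exists i => //.
  exact/(chord_ell _ _ Dx).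
split=> // -[i _ /(chord_ell _ _ Dx)]; exact: nx (lines_in i).
Qed.

(** A connected set missing the chords keeps every sign, and the segment between two points with
    equal signs misses all the lines. *)
Lemma component_cell x : A x ->
  connected_component A x = cell (@open_disc R) L (sgns L x).
Proof.
move=> Ax; have [Dx L0] := (chord_complementP x).1 Ax.
apply/seteqP; split => y.
  move=> [B [Bx BA cB] By]; apply/cellP; first by rewrite size_map.
  have [Dy Ly] := (chord_complementP y).1 (BA _ By).
  split => //; rewrite /sgns.
  apply: List.map_ext_in => l Ll; have [i li] := in_lines Ll.
  apply: (connected_sign cB) => //; first by rewrite li; exact: continuous_ell.
  by move=> z /BA/chord_complementP[_]; apply.
move/cellP => []; rewrite ?size_map// => Dy Ly sE.
exists ((fun t : R => (1 - t) *: x + t *: y) @` `[0, 1]); last first.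
  exists 1; first by rewrite /= in_itv /= ler01 lexx.
  by rewrite subrr scale0r scale1r add0r.
split; last exact: connected_segment.
  exists 0; first by rewrite /= in_itv /= ler01 lexx.
  by rewrite subr0 scale0r scale1r addr0.
move=> _ [t /= + <-]; rewrite in_itv /= => /andP[t0 t1].
apply/chord_complementP; split.
  by have [e e0] := rel_open_open_disc Dx Dy; apply; lra.
move=> l Ll; have [i li] := in_lines Ll.
have al : affine_fun l by rewrite li; exact: affine_ell.
have sl : (0 < l x) = (0 < l y).
  by move: sE Ll; rewrite /sgns; elim: (L) => //= k K IH [h1 h2] [<-//|]; exact: IH.
rewrite al; have /eqP := L0 _ Ll; have /eqP := Ly _ Ll.
have [lx|lx] := ltP 0 (l x).
  move=> _ _; rewrite lx in sl; move/esym in sl.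
  by have [e e0 h] := small_pos lx sl; apply/eqP; rewrite lt0r_neq0//; apply: h; lra.
rewrite ltNge lx /= in sl; move/esym/negbT in sl; rewrite -leNgt in sl.
move=> ly0 lx0; have lx' : 0 < - l x by rewrite oppr_gt0 lt_neqAle lx0.
have ly' : 0 < - l y by rewrite oppr_gt0 lt_neqAle ly0.
have [e e0 h] := small_pos lx' ly'.
by have := h t; lra.
Qed.

(** Nonempty cells with different sign vectors are different sets, so counting sign vectors counts
    regions. The argument also exhibits the set of regions as finite, so that [fset_set] returns its
    actual elements. *)
Lemma num_regions_cells : num_regions theta phi = ncells (@open_disc R) L.
Proof.
pose ne s := `[< cell (@open_disc R) L s !=set0 >].
pose B := seq_fset tt (seq.filter ne (signs (size L))).
have -> : num_regions theta phi = #|` [fset cell (@open_disc R) L s | s in B]%fset|.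
  rewrite /num_regions; congr (#|` _|%fset).
  rewrite -[RHS]set_fsetK; congr fset_set; apply/seteqP; split => Y.
    move=> [x Ax <-]; rewrite component_cell//=; apply/imfsetP => /=.
    exists (sgns L x) => //; rewrite seq_fsetE mem_filter mem_signs size_map eqxx andbT.
    apply/asboolP; exists x; apply/cellP; first by rewrite size_map.
    by have [] := (chord_complementP x).1 Ax.
  move=> /imfsetP[s /= + ->]; rewrite /= seq_fsetE mem_filter mem_signs => /andP[/asboolP[x xs]
    /eqP sz].
  have [Dx Lx sE] := (cellP _ _ sz).1 xs.
  have Ax : A x by apply/chord_complementP.
  by exists x => //; rewrite component_cell// -sE.
rewrite card_in_imfset; last first.
  move=> s t; rewrite /= !seq_fsetE !mem_filter !mem_signs.
  move=> /andP[/asboolP[x xs] /eqP sz] /andP[_ /eqP tz] st.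
  have [_ _ ->] := (cellP _ _ sz).1 xs.
  by move: xs; rewrite st => /(cellP _ _ tz)[_ _ ->].
rewrite /ncells -size_filter -[in RHS](undup_id (filter_uniq ne (uniq_signs (size L)))).
rewrite -(size_seq_fset tt) -/B /=.
reflexivity.
Qed.

End Regions.

(** * Counting cells for lines in general position *)

Definition mid p : R := p.2 - p.1.

(** For half-angles [t], [u] in [0, pi/2] this reads cos (t + u) < cos (mid p - mid q) < cos (t -
    u): the endpoints of the chords interleave. *)
Definition cross p q : bool :=
  `|cos (mid p - mid q) - cos p.1 * cos q.1| < `|sin p.1 * sin q.1|.

(** Up to sign, the determinant of the three line equations, expanded along the column of
    constants. *)
Definition det3 p q r : R := cos p.1 * sin (mid r - mid q) +
  cos q.1 * sin (mid p - mid r) + cos r.1 * sin (mid q - mid p).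

(** General position, in the recursive form used by the induction: no line is tangent, no two are
    parallel and no three concurrent. *)
Fixpoint generic ps : bool :=
  if ps is p :: ps' then
    [&& sin p.1 != 0, all (fun q => sin (mid p - mid q) != 0) ps',
      pairwise (fun q r => det3 p q r != 0) ps' & generic ps']
  else true.

Fixpoint crossings ps : nat :=
  if ps is p :: ps' then (\sum_(q <- ps') cross p q + crossings ps')%N else 0%N.

Lemma concurrent_det3 p q r x : ell p x = 0 -> ell q x = 0 -> ell r x = 0 ->
  det3 p q r = 0.
Proof.
rewrite /ell -!/(mid _) => /subr0_eq hp /subr0_eq hq /subr0_eq hr.
by rewrite /det3 -hp -hq -hr !sinB; ring.
Qed.

(** The intersection point, given by Cramer's rule, has squared norm [(c^2 + d^2 - 2 c d cos (a -
    b)) / sin (a - b) ^ 2]; squaring [cross] says that this is less than 1. *)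
Lemma crossP p q : sin (mid p - mid q) != 0 ->
  zero_part (zero_part (@open_disc R) (ell p)) (ell q) !=set0 <-> cross p q.
Proof.
move=> s0; rewrite /zero_part /ell /= -!/(mid _).
set a := mid p in s0 *; set b := mid q in s0 *.
set c := cos p.1; set d := cos q.1.
have key (x : R * R) : x.1 * cos a + x.2 * sin a - c = 0 ->
    x.1 * cos b + x.2 * sin b - d = 0 ->
    (x.1 ^+ 2 + x.2 ^+ 2) * sin (a - b) ^+ 2 = c ^+ 2 + d ^+ 2 - 2 * (c * d * cos (a - b)).
  move=> /subr0_eq <- /subr0_eq <-.
  have ca := cos2Dsin2 a; have cb := cos2Dsin2 b.
  rewrite sinB cosB.
  pose u := x.1 * cos a + x.2 * sin a; pose v := x.1 * cos b + x.2 * sin b.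
  rewrite -/u -/v; transitivity (u ^+ 2 * (cos b ^+ 2 + sin b ^+ 2) +
    v ^+ 2 * (cos a ^+ 2 + sin a ^+ 2) - 2 * (u * v * (cos a * cos b + sin a * sin b))).
    by rewrite /u /v; ring.
  by rewrite ca cb !mulr1.
have crossE : cross p q = (c ^+ 2 + d ^+ 2 - 2 * (c * d * cos (a - b)) < sin (a - b) ^+ 2).
  rewrite /cross -/a -/b -/c -/d.
  rewrite -(@ltr_pXn2r _ 2)// ?nnegrE// !real_normK ?num_real//.
  rewrite exprMn !sin2cos2 -/c -/d -subr_gt0 -[RHS]subr_gt0; congr (0 < _).
  by ring.
have s2 : 0 < sin (a - b) ^+ 2 by rewrite exprn_even_gt0.
split.
  move=> [x [[Dx px] qx]]; by rewrite crossE -(key x)// gtr_pMl.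
rewrite crossE => h.
exists ((d * sin a - c * sin b) / sin (a - b), (c * cos b - d * cos a) / sin (a - b)).
set x := (_, _).
have xa : x.1 * cos a + x.2 * sin a - c = 0.
  by rewrite /x /=; move: s0; rewrite sinB => s0; field.
have xb : x.1 * cos b + x.2 * sin b - d = 0.
  by rewrite /x /=; move: s0; rewrite sinB => s0; field.
split => //; split => //.
by move: h; rewrite -(key x)// gtr_pMl.
Qed.

Lemma zero_part_disc p : sin p.1 != 0 -> zero_part (@open_disc R) (ell p) !=set0.
Proof.
move=> s0; exists (cos p.1 * cos (mid p), cos p.1 * sin (mid p)); split.
  rewrite /open_disc /= !exprMn -mulrDr cos2Dsin2 mulr1.
  by rewrite cos2sin2 ltrBlDr ltrDl exprn_even_gt0.
rewrite /= /ell /= -/(mid p).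
transitivity (cos p.1 * (cos (mid p) ^+ 2 + sin (mid p) ^+ 2 - 1)); first by ring.
by rewrite cos2Dsin2 subrr mulr0.
Qed.

(** [x b] is the point of the line at coordinate [b] from the foot of the perpendicular. The lines
    are not parallel, so [ell q] differs at [b = 0] and [b = sin p.1 / 2], both inside the disc. *)
Lemma zero_part_nonzero p q : sin p.1 != 0 -> sin (mid p - mid q) != 0 ->
  exists2 x, zero_part (@open_disc R) (ell p) x & ell q x != 0.
Proof.
move=> s0 pq.
pose x (b : R) := (cos p.1 * cos (mid p) - b * sin (mid p),
  cos p.1 * sin (mid p) + b * cos (mid p)).
have mm := cos2Dsin2 (mid p).
have hx b : b ^+ 2 < sin p.1 ^+ 2 -> zero_part (@open_disc R) (ell p) (x b).
  move=> hb; split.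
    rewrite /open_disc /=.
    have -> : (cos p.1 * cos (mid p) - b * sin (mid p)) ^+ 2 +
      (cos p.1 * sin (mid p) + b * cos (mid p)) ^+ 2 = (cos p.1 ^+ 2 + b ^+ 2) *
      (cos (mid p) ^+ 2 + sin (mid p) ^+ 2) by ring.
    by rewrite mm mulr1 cos2sin2; lra.
  rewrite /= /ell /= -/(mid p).
  transitivity (cos p.1 * (cos (mid p) ^+ 2 + sin (mid p) ^+ 2 - 1)); first by ring.
  by rewrite mm subrr mulr0.
have [q0|q0] := eqVneq (ell q (x 0)) 0; last first.
  by exists (x 0) => //; apply: hx; rewrite expr0n exprn_even_gt0.
exists (x (sin p.1 / 2)).
  have : 0 < sin p.1 ^+ 2 by rewrite exprn_even_gt0.
  by move=> s2; apply: hx; rewrite expr_div_n; lra.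
have -> : ell q (x (sin p.1 / 2)) = ell q (x 0) - sin p.1 / 2 * sin (mid p - mid q).
  by rewrite /ell /x /= -/(mid q) sinB; ring.
by rewrite q0 sub0r oppr_eq0 !mulf_neq0// invr_eq0 pnatr_eq0.
Qed.

Lemma affine_lines ps l : List.In l (map ell ps) -> affine_fun l.
Proof. by elim: ps => //= p ps IH [<-|//]; exact: affine_ell. Qed.

Lemma ncells_nonvanishing Z ps : rel_open_convex Z ->
  {in ps, forall p, zero_part Z (ell p) = set0} ->
  ncells Z (map ell ps) = `[< Z !=set0 >] :> nat.
Proof.
move=> rZ; elim: ps => [_|p ps IH h]; first exact: ncells0.
have zp : zero_part Z (ell p) = set0 by apply: h; rewrite mem_head.
rewrite /= deletion_restriction//; last 3 first.
- exact: affine_ell.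
- exact: affine_lines.
- move=> [x Zx]; exists x => //; apply/negP => /eqP px.
  by have : zero_part Z (ell p) x by []; rewrite zp.
rewrite zp ncells_set0 addn0; apply: IH => q qs; apply: h.
by rewrite in_cons qs orbT.
Qed.

(** Each line meeting [Y] adds one piece, since its trace on [Y] is met by none of the later
    lines. *)
Lemma ncells_line Y ps : rel_open_convex Y -> Y !=set0 ->
  {in ps, forall q, exists2 x, Y x & ell q x != 0} ->
  pairwise (fun q r => `[< zero_part (zero_part Y (ell q)) (ell r) = set0 >]) ps ->
  ncells Y (map ell ps) = (1 + \sum_(q <- ps) `[< zero_part Y (ell q) !=set0 >])%N.
Proof.
move=> rY Y0; elim: ps => [_ _|p ps IH h /= /andP[/allP h1 h2]].
  by rewrite ncells0 asboolT// big_nil.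
rewrite deletion_restriction//; last 3 first.
- exact: affine_ell.
- exact: affine_lines.
- by move=> _; apply: h; rewrite mem_head.
rewrite IH//; last by move=> q qs; apply: h; rewrite in_cons qs orbT.
rewrite ncells_nonvanishing; last 2 first.
- exact: rel_open_zero (affine_ell _) rY.
- by move=> q /h1/asboolP.
by rewrite big_cons -addnA [(\sum_(_ <- _) _ + _)%N]addnC.
Qed.

Lemma ncells_generic ps : generic ps ->
  ncells (@open_disc R) (map ell ps) = (1 + size ps + crossings ps)%N.
Proof.
elim: ps => [_|p ps IH /= /and4P[sp /allP pq pr gps]].
  by rewrite ncells0 asboolT//; exists (0, 0); rewrite /open_disc /= expr0n addr0 ltr01.
rewrite deletion_restriction//; last 4 first.
- exact: affine_ell.
- exact: affine_lines.
- exact: rel_open_open_disc.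
- move=> _.
  (* A point of the disc off the line: the centre, unless the line passes through it; then half the
     unit normal. *)
  exists (if cos p.1 == 0 then (cos (mid p) / 2, sin (mid p) / 2) else (0, 0)).
    case: ifP => _; rewrite /open_disc /= ?expr0n ?addr0 ?ltr01//.
    by rewrite !expr_div_n -mulrDl cos2Dsin2; lra.
  case: ifP => [/eqP|/negbT] c0; rewrite /ell /= -/(mid p) ?c0 ?mul0r ?add0r ?oppr_eq0//.
  have -> : cos (mid p) / 2 * cos (mid p) + sin (mid p) / 2 * sin (mid p) - 0 =
    (cos (mid p) ^+ 2 + sin (mid p) ^+ 2) / 2 by field.
  by rewrite cos2Dsin2; apply/eqP; lra.
rewrite IH// ncells_line; last 4 first.
- exact: rel_open_zero (affine_ell _) rel_open_open_disc.
- exact: zero_part_disc.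
- by move=> q qs; apply: zero_part_nonzero => //; exact: pq.
- apply: sub_pairwise pr => q r d0; apply/asboolP; rewrite -subset0 => x [[[_ px] qx] rx].
  by case/eqP : d0; exact: concurrent_det3 px qx rx.
rewrite (eq_big_seq (fun q => cross p q : nat)); last first.
  move=> q qs /=; congr nat_of_bool; apply/asboolP/idP => /(crossP (pq _ qs)); exact.
by rewrite !addnA addn1 addnS !addSn addnAC.
Qed.

End PlaneCells.

(** * Measurability of the number of cells *)

Section MeasurableCells.
Context {R : realType}.

Lemma cell_setT (V : lmodType R) (X : set V) L s q :
  cell X L s q <-> X q /\ cell setT L s q.
Proof.
elim: L X s => [|l L IH] X [|b s] /=; try by split=> [|[]].
rewrite IH [X in _ <-> _ /\ X]IH /pos_part setTI; split=> [[[]]|[? []]] //.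
Qed.

Lemma open_cell (X : set (R * R)) L s : open X ->
  (forall l, List.In l L -> continuous l) -> open (cell X L s).
Proof.
elim: L X s => [|l L IH] X [|b s] //= oX cL; apply: IH; last first.
- by move=> k kL; apply: cL; right.
apply: openI => //.
have cl : continuous (if b then l else \- l).
  have cl := cL l (or_introl erefl); case: b => //= x.
  by apply: cvgN; exact: cl.
by move/continuousP: cl => /(_ _ (@open_gt R 0)).
Qed.

Lemma open_open_disc : open (@open_disc R).
Proof.
have c : continuous (fun z : R * R => z.1 ^+ 2 + z.2 ^+ 2).
  move=> z; apply: cvgD; apply: cvgM; by [exact: cvg_fst|exact: cvg_snd].
by move/continuousP: c => /(_ _ (@open_lt R 1)).
Qed.

Lemma open_rat (A : set (R * R)) : open A -> A !=set0 ->
  exists q : rat * rat, A (ratr q.1, ratr q.2).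
Proof.
move=> oA [x Ax].
have /nbhs_ballP[e /= e0 he] : nbhs x A by exact: open_nbhs_nbhs.
have [q1 /itvP h1] := @rat_in_itvoo R x.1 (x.1 + e) ltac:(lra).
have [q2 /itvP h2] := @rat_in_itvoo R x.2 (x.2 + e) ltac:(lra).
exists (q1, q2); apply: he; split => /=; rewrite /ball /= ltr0_norm ?subr_lt0 ?h1 ?h2// opprB
  ltrBlDl ?h1 ?h2//.
Qed.

Lemma measurable_ell d (T : measurableType d) (p : T -> R * R) x :
  measurable_fun setT p -> measurable_fun setT (fun w => ell (p w) x).
Proof.
move=> mp; have m1 : measurable_fun setT (fun w => (p w).1) by exact: measurableT_comp mp.
have m2 : measurable_fun setT (fun w => (p w).2) by exact: measurableT_comp mp.
have mm : measurable_fun setT (fun w => (p w).2 - (p w).1) by exact: measurable_funB.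
apply: measurable_funB.
  apply: measurable_funD; apply: measurable_funM => //.
    exact: measurableT_comp (continuous_measurable_fun (@continuous_cos R)) mm.
  exact: measurableT_comp (continuous_measurable_fun (@continuous_sin R)) mm.
exact: measurableT_comp (continuous_measurable_fun (@continuous_cos R)) m1.
Qed.

Lemma measurable_in_cell d (T : measurableType d) (ps : seq (T -> R * R)) s x :
  (forall p, List.In p ps -> measurable_fun setT p) ->
  measurable [set w | cell setT [seq ell (p w) | p <- ps] s x].
Proof.
have mT : measurable [set _ : T | [set: R * R]%classic x].
  by rewrite (_ : [set _ | _]%classic = setT)//; apply/seteqP; split.
elim: ps s => [|p ps IH] [|b s] mps //=.
have mp : measurable_fun setT (fun w => ell (p w) x).
  by apply: measurable_ell; apply: mps; left.
rewrite (_ : [set w | _]%classic =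
   ((fun w => if b then ell (p w) x else - ell (p w) x) @^-1` `]0, +oo[ `&`
   [set w | cell setT [seq ell (p w) | p <- ps] s x])%classic).
  apply: measurableI; last by apply: IH => q qs; apply: mps; right.
  rewrite -[X in measurable X]setTI; case: b; first exact: mp.
  by apply: (measurable_funN mp).
apply/seteqP; split => w /=.
  by move/cell_setT => [[_ h] ?]; split => //; rewrite in_itv /= andbT; case: b h.
by rewrite in_itv /= andbT => -[h ?]; apply/cell_setT; split => //; split => //; case: b h.
Qed.

(* An open cell is nonempty iff it contains a rational point. *)
Lemma measurable_ncells d (T : measurableType d) (ps : seq (T -> R * R)) :
  (forall p, List.In p ps -> measurable_fun setT p) ->
  measurable_fun setT
    (fun w => (ncells (@open_disc R) [seq ell (p w) | p <- ps])%:R : R).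
Proof.
move=> mps; pose c w s := cell (@open_disc R) [seq ell (p w) | p <- ps] s.
have me s : measurable [set w | c w s !=set0].
  rewrite (_ : [set w | _]%classic = (\bigcup_(q : rat * rat)
    [set w | c w s (ratr q.1, ratr q.2)])%classic).
    apply: countable_bigcupT_measurable; first exact: countableP.
    move=> q; rewrite (_ : [set w | _]%classic = ([set w | @open_disc R (ratr q.1, ratr q.2)] `&`
      [set w | cell setT [seq ell (p w) | p <- ps] s (ratr q.1, ratr q.2)])%classic).
      apply: measurableI; last exact: measurable_in_cell.
      have [h|h] := pselect (@open_disc R (ratr q.1, ratr q.2)).
        by rewrite (_ : [set w | _]%classic = setT)//; apply/seteqP; split.
      by rewrite (_ : [set w | _]%classic = set0)//; apply/seteqP; split.
    by apply/seteqP; split=> w /=; rewrite /c => /cell_setT.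
  apply/seteqP; split => w /=; last by move=> [q _ h]; exists (ratr q.1, ratr q.2).
  move=> /open_rat[]; last by move=> q h; exists q.
  apply: open_cell; first exact: open_open_disc.
  move=> l; elim: (ps) => //= p qs IH [<-|//]; exact: continuous_ell.
rewrite (_ : (fun w => _) = (fun w => \sum_(s <- signs (size ps))
    \1_([set w | c w s !=set0]%classic) w)).
  by apply: measurable_sum => s; exact: measurable_indic.
apply/funext => w; rewrite /ncells size_map -sum1_count natr_sum big_mkcond /=.
apply: eq_bigr => s _; rewrite indicE.
have [h|h] := pselect (c w s !=set0); first by rewrite asboolT// mem_set.
by rewrite asboolF// memNset.
Qed.

End MeasurableCells.

(** * Countability of the zeros of trigonometric equations *)

Section CosineEquations.
Context {R : realType}.

Lemma cosD2piz (k : int) (x : R) : cos (x + 2 * pi * k%:~R) = cos x.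
Proof.
have -> : 2 * pi * k%:~R = (pi *+ 2) *~ k :> R by rewrite -mulrzr mulr2n; ring.
have pn n y : cos (y + pi *+ 2 *+ n) = cos y :> R by apply: periodicn; exact: cosD2pi.
case: k => n; first by rewrite -pmulrn pn.
by rewrite NegzE mulrNz -pmulrn -[in RHS](subrK (pi *+ 2 *+ n.+1) x) pn.
Qed.

Lemma cos_2piB (x : R) : cos (2 * pi - x) = cos x.
Proof. by rewrite -[RHS]cosN -(cosD2piz 1 (- x)) mulr1 addrC. Qed.

Lemma mod2pi (s : R) : exists k : int, 0 <= s - 2 * pi * k%:~R < 2 * pi.
Proof.
have p0 : 0 < 2 * pi :> R by exact: two_pi_gt0.
exists (Num.floor (s / (2 * pi))).
have := floor_itv (s / (2 * pi)).
set k := Num.floor _ => /andP[h1 h2].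
have -> : s - 2 * pi * k%:~R = 2 * pi * (s / (2 * pi) - k%:~R).
  by rewrite mulrBr [2 * pi * (s / _)]mulrC divfK// lt0r_neq0.
rewrite mulr_ge0 ?subr_ge0 ?(ltW p0)//= gtr_pMr// ltrBlDl.
by move: h2; rewrite intrD.
Qed.

Lemma countable_cos_eq (c : R) : countable [set x : R | cos x = c].
Proof.
pose F (z : int * bool) : R :=
  (if z.2 then acos c else 2 * pi - acos c) + 2 * pi * (z.1)%:~R.
apply: (@sub_countable _ _ _ (range F)); last first.
  exact: sub_countable (card_image_le F setT) (countableP _).
apply: subset_card_le => x /= cx; have [k /andP[k0 k1]] := mod2pi x.
have c2 : cos (x - 2 * pi * k%:~R) = c by rewrite -mulrN -mulrNz cosD2piz.
have [yp|yp] := leP (x - 2 * pi * k%:~R) pi.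
  exists (k, true) => //; rewrite /F /= -c2 cosK ?subrK//.
  by rewrite in_itv /= k0.
exists (k, false) => //; rewrite /F /= -c2.
rewrite -cos_2piB cosK; first by ring.
by rewrite in_itv /=; apply/andP; split; lra.
Qed.

(** A nonzero pair [(A, B)] is written [r (cos al, sin al)], which reduces the equation to
    [cos y = - D / r]. Non-generic configurations lead to such equations in one angle. *)
Lemma countable_trig_eq (A B D s : R) : ~~ [&& A == 0, B == 0 & D == 0] ->
  countable [set x : R | A * cos (x - s) + B * sin (x - s) + D = 0].
Proof.
move=> nz; have [AB0|AB] := eqVneq (A ^+ 2 + B ^+ 2) 0.
  have A0 : A = 0.
    apply/eqP; rewrite -sqrf_eq0 eq_le sqr_ge0 andbT -AB0 lerDl sqr_ge0//.
  have B0 : B = 0.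
    apply/eqP; rewrite -sqrf_eq0 eq_le sqr_ge0 andbT -AB0 lerDr sqr_ge0//.
  rewrite (_ : [set x | _]%classic = set0); first exact: countable0.
  rewrite -subset0 => x /=; rewrite A0 B0 !mul0r !add0r => D0.
  by move: nz; rewrite A0 B0 D0 eqxx.
have r20 : 0 < A ^+ 2 + B ^+ 2 by rewrite lt_neqAle eq_sym AB addr_ge0 ?sqr_ge0.
pose r := Num.sqrt (A ^+ 2 + B ^+ 2).
have r0 : 0 < r by rewrite sqrtr_gt0.
have r2 : r ^+ 2 = A ^+ 2 + B ^+ 2 by rewrite sqr_sqrtr// ltW.
have Ar : -1 <= A / r <= 1.
  rewrite -ler_norml normrM normfV (gtr0_norm r0) ler_pdivrMr// mul1r.
  by rewrite -(@ler_pXn2r _ 2)// ?nnegrE ?(ltW r0)// real_normK ?num_real// r2 lerDl sqr_ge0.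
(* The arccosine determines the phase up to sign, and the sign of [B] decides. *)
have [al cal sal] : exists2 a : R, r * cos a = A & r * sin a = B.
  have cA : r * cos (acos (A / r)) = A.
    by rewrite acosK ?in_itv// mulrC divfK// lt0r_neq0.
  have sA : r * sin (acos (A / r)) = `|B|.
    rewrite sin_acos// -[X in X * _](@ger0_norm _ r) ?ltW// -sqrtr_sqr -sqrtrM ?sqr_ge0//.
    rewrite mulrBr mulr1 -exprMn mulrC divfK ?lt0r_neq0// r2 [A ^+ 2 + _]addrC addrK.
    by rewrite sqrtr_sqr.
  have [B0|B0] := leP 0 B.
    by exists (acos (A / r)); rewrite // sA ger0_norm.
  exists (- acos (A / r)); rewrite ?cosN// sinN mulrN sA ltr0_norm// opprK//.
apply: (@sub_countable _ _ _ ((fun y => y + (s + al)) @` [set x : R | cos x = - D / r]%classic)).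
  apply: subset_card_le => x /= h; exists (x - (s + al)); last by rewrite subrK.
  have -> : x - (s + al) = (x - s) - al by ring.
  rewrite cosB; apply: (mulfI (lt0r_neq0 r0)).
  rewrite [RHS]mulrC divfK ?lt0r_neq0//.
  transitivity (r * cos al * cos (x - s) + r * sin al * sin (x - s)); first by ring.
  by rewrite cal sal; lra.
exact: sub_countable (card_image_le _ _) (countable_cos_eq _).
Qed.

End CosineEquations.

(** * Uniform law on the circle *)

Section LebesgueShift.
Context {R : realType}.
Notation leb := (@lebesgue_measure R).

Lemma lebesgue_shift (s : R) (A : set R) : measurable A ->
  leb [set x | A (x - s)]%classic = leb A.
Proof.
move=> mA.
have mf : measurable_fun setT (fun x : measurableTypeR R => x - s : measurableTypeR R).
  by apply: measurable_funB.
pose nuf : {measure set (measurableTypeR R) -> \bar R} :=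
  pushforward leb (fun x : measurableTypeR R => x - s : measurableTypeR R).
pose nu := nuf mf.
have e X : nu X = leb [set x | X (x - s)]%classic by [].
rewrite -e; apply/esym/lebesgue_measure_unique => // X [[a b] /= ab <-].
rewrite e.
have -> : [set x | `]a, b]%classic (x - s)]%classic = `]a + s, b + s]%classic.
  by apply/seteqP; split => x /=; rewrite !in_itv /= ltrBrDr lerBlDr.
rewrite !lebesgue_measure_itv /= !lte_fin ltrD2r.
by case: ifP => // _; congr EFin; ring.
Qed.

Lemma uniform_probE (A : set R) : measurable A ->
  uniform_prob (@two_pi_gt0 R) A = ((2 * pi)^-1%:E * leb (A `&` `[0%R, (2 * pi)%R[))%E.
Proof.
move=> mA; rewrite /uniform_prob integral_uniform_pdf.
rewrite (eq_integral (fun=> (2 * pi)^-1%:E)); last first.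
  move=> x; rewrite inE => -[_] /=; rewrite in_itv /= /uniform_pdf => ->.
  by rewrite subr0.
rewrite integral_cst; last exact: measurableI.
congr (_ * _)%E.
have -> : `[0, 2 * pi]%classic = `[0, 2 * pi[%classic `|` [set 2 * pi] :> set R.
  by rewrite setUitv1// bnd_simp ltW// two_pi_gt0.
rewrite setIUr; apply: measureU0; try exact: measurableI.
apply/eqP; rewrite eq_le measure_ge0 andbT -(lebesgue_measure_set1 (2 * pi)).
by apply: le_measure; rewrite ?inE//; exact: measurableI.
Qed.

Lemma uniform_prob_countable (A : set R) : countable A ->
  uniform_prob (@two_pi_gt0 R) A = 0%E.
Proof.
move=> cA; rewrite uniform_probE; last first.
  by apply: countable_measurable => //= x _; exact: measurable_set1.
rewrite countable_lebesgue_measure0 ?mule0//.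
by apply: sub_countable cA; apply: subset_card_le; exact: subIsetl.
Qed.

(** The interval is cut at [s] for the shifted set and at [2 pi - s] for [B]. The pieces correspond
    by translation by [s] and by [s - 2 pi], the latter using periodicity. *)
Lemma uniform_prob_shift (B : set R) (s : R) : measurable B ->
  (forall x, B (x + 2 * pi) <-> B x) -> 0 <= s < 2 * pi ->
  uniform_prob (@two_pi_gt0 R) [set x | B (x - s)]%classic =
  uniform_prob (@two_pi_gt0 R) B.
Proof.
move=> mB perB /andP[s0 s1].
have mS (C : set R) t : measurable C -> measurable [set x | C (x - t)]%classic.
  move=> mC; rewrite -[X in measurable X]setTI.
  have : measurable_fun setT (fun x : R => x - t) by exact: measurable_funB.
  exact.
rewrite !uniform_probE//; last exact: mS.
congr (_ * _)%E.
have split0 (C : set R) (t : R) : measurable C -> 0 <= t <= 2 * pi ->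
    leb (C `&` `[0%R, (2 * pi)%R[) = (leb (C `&` `[0%R, t[) + leb (C `&` `[t, (2 * pi)%R[))%E.
  move=> mC /andP[t0 t1]; rewrite -measureU; try exact: measurableI.
    rewrite -setIUr; congr (leb (_ `&` _)).
    apply/seteqP; split => x /=; rewrite !in_itv /=.
      by move=> /andP[x0 x1]; case: (ltP x t) => xt; [left|right]; rewrite ?x0 ?x1.
    by case=> /andP[x0 x1]; apply/andP; split; lra.
  rewrite -subset0 => x /= [[_]]; rewrite !in_itv /= => /andP[x0 x1] [_ /andP[x2 x3]]; lra.
rewrite (split0 _ s); [|exact: mS|lra].
rewrite (split0 _ (2 * pi - s)); [|by []|lra].
rewrite addeC; congr (_ + _)%E.
  rewrite -(@lebesgue_shift s (B `&` _)); last exact: measurableI.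
  congr (leb _); apply/seteqP; split => x /= [Bx]; rewrite !in_itv /= => h; split => //; lra.
rewrite -(@lebesgue_shift (s - 2 * pi) (B `&` _)); last exact: measurableI.
have perB' x : B (x - (s - 2 * pi)) <-> B (x - s).
  by rewrite -(perB (x - s)); have -> : x - (s - 2 * pi) = x - s + 2 * pi by ring.
congr (leb _); apply/seteqP; split => x /= [Bx]; rewrite !in_itv /= => h; split;
  try exact/perB'; lra.
Qed.

(** On [0, 2 pi) the set consists of []b, a[] and its reflection in [pi], both of length [a - b]. *)
Lemma uniform_prob_cos_itv (a b : R) : 0 <= b -> b <= a -> a <= pi ->
  uniform_prob (@two_pi_gt0 R) [set x | cos a < cos x < cos b]%classic =
  ((a - b) / pi)%:E.
Proof.
move=> b0 ba api; have p0 := @pi_gt0 R.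
have mc : measurable_fun setT (@cos R) by exact: continuous_measurable_fun (@continuous_cos R).
have mB : measurable [set x : R | cos a < cos x < cos b]%classic.
  rewrite (_ : [set x | _]%classic = cos @^-1` `]cos a, cos b[%classic).
    by rewrite -[X in measurable X]setTI; exact: mc.
  by apply/seteqP; split => x /=; rewrite in_itv.
rewrite uniform_probE//.
have -> : [set x | cos a < cos x < cos b]%classic `&` `[0, 2 * pi[%classic =
    (`]b, a[ `|` `]2 * pi - a, 2 * pi - b[)%classic.
  have key (x : R) : 0 <= x <= pi -> (cos a < cos x < cos b) = (b < x < a).
    move=> xp; rewrite !ltr_cos ?in_itv//=; try (apply/andP; split; lra).
    by rewrite andbC.
  apply/seteqP; split => x /=; rewrite !in_itv /=.
    move=> [h /andP[x0 x1]]; have [xp|xp] := leP x pi.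
      by left; rewrite -key// x0.
    by right; move: h; rewrite -(cos_2piB x) key; lra.
  case=> h.
    by split; [rewrite key//; lra|lra].
  by split; [rewrite -(cos_2piB x) key//; lra|lra].
rewrite measureU//; last first.
  by rewrite -subset0 => x /= []; rewrite !in_itv /=; lra.
change (((2 * pi)^-1%:E * (leb `]b, a[%classic + leb `](2 * pi - a)%R,
  (2 * pi - b)%R[%classic))%E =
  ((a - b) / pi)%:E).
rewrite !lebesgue_measure_itv /= !lte_fin ltrD2l ltrN2.
have [->|ab] := eqVneq a b; first by rewrite ltxx adde0 mule0 subrr mul0r.
rewrite lt_neqAle eq_sym ab ba /= -EFinD -EFinM; congr EFin.
by clear -p0; move: (@pi R) p0 => q p0; field; rewrite lt0r_neq0.
Qed.

End LebesgueShift.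

(** * Null sets *)

Section NullSets.
Context d (T : measurableType d) (R : realType) (P : probability T R).

Lemma Ex_ae_eq (N : set T) (f g : T -> R) : measurable N -> P N = 0%E ->
  measurable_fun setT f -> measurable_fun setT g ->
  (forall x, ~ N x -> f x = g x) -> \int[P]_x f x = \int[P]_x g x.
Proof.
move=> mN PN mf mg fg; rewrite /Rintegral; congr fine.
apply: ae_eq_integral => //; try exact/measurable_EFinP.
by exists N; split => // x /= h; apply: contrapT => /fg e; apply: h => _; rewrite e.
Qed.

Lemma measurable_neq0 (f : T -> R) : measurable_fun setT f ->
  measurable [set x | f x != 0]%classic.
Proof.
move=> mf; rewrite (_ : [set x | _]%classic = ~` (f @^-1` [set 0])%classic).
  by apply: measurableC; rewrite -[X in measurable X]setTI; exact: mf.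
by apply/seteqP; split => x /= /eqP.
Qed.

Lemma measurable_eq0 (f : T -> R) : measurable_fun setT f ->
  measurable [set x | f x = 0]%classic.
Proof.
move=> mf; have := mf measurableT [set 0]%classic (measurable_set1 _).
by rewrite setTI.
Qed.

Lemma Ex_eq0 (f : T -> R) : bmf f -> (forall x, 0 <= f x) ->
  \int[P]_x f x = 0 -> P [set x | f x != 0]%classic = 0%E.
Proof.
move=> bf f0 h; have mf := bf.1.
have mA : measurable [set x | f x != 0]%classic.
  exact: measurable_neq0 mf.
have : (\int[P]_(x in setT) `|(f x)%:E|)%E = 0%E.
  rewrite (eq_integral (EFin \o f)); last by move=> x _; rewrite /= ger0_norm.
  by rewrite (Ex_EFin P bf) h.
move/(ae_eq_integral_abs P measurableT); move/(_ ltac:(exact/measurable_EFinP)).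
move=> [N [mN PN sN]].
apply/eqP; rewrite eq_le measure_ge0 andbT -PN le_measure ?inE//.
move=> x /= fx; apply: sN => /= e; have := e I => -[] /eqP.
by rewrite (negbTE fx).
Qed.

Lemma Ex_null_eq0 (f : T -> R) (N : set T) : measurable N -> P N = 0%E ->
  measurable_fun setT f -> (forall x, ~ N x -> f x = 0) -> \int[P]_x f x = 0.
Proof.
move=> mN PN mf fN; rewrite -(Ex_cst P 0); apply: Ex_ae_eq mN PN mf _ fN.
exact: measurable_cst.
Qed.

Lemma Ex_indic_eq0 (A : set T) : measurable A -> (\int[P]_x \1_A x = 0 :> R) <-> P A = 0%E.
Proof.
move=> mA; rewrite Ex_indic//; split=> [h|->//].
by rewrite -[LHS]fineK ?fin_num_measure// h.
Qed.

Lemma bigsetU_null (I : finType) (F : I -> set T) :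
  (forall i, measurable (F i) /\ P (F i) = 0%E) ->
  measurable (\big[setU/set0]_i F i) /\ P (\big[setU/set0]_i F i) = 0%E.
Proof.
move=> hF; apply: (big_ind (fun A => measurable A /\ P A = 0%E)) => //.
by move=> A B [mA A0] [mB B0]; split; [exact: measurableU|rewrite measureU0].
Qed.

Lemma sub_bigsetU (I : finType) (F : I -> set T) i : (F i `<=` \big[setU/set0]_i F i)%classic.
Proof. by move=> x Fx; rewrite (bigD1 i)//=; left. Qed.

End NullSets.

Lemma Ex_product d1 d2 (T1 : measurableType d1) (T2 : measurableType d2) (R : realType)
  (P1 : probability T1 R) (P2 : probability T2 R) (G : T1 * T2 -> R) : bmf G ->
  \int[(P1 \x P2)%E]_z G z = \int[P1]_x \int[P2]_y G (x, y).
Proof. by move=> bG; rewrite /Rintegral (Ex_prod P1 P2 bG). Qed.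

(** Averaging over the coordinate [i] first, every section in that coordinate is null. *)
Lemma tuple_null dE (E : measurableType dE) (R : realType) n (mu : probability E R)
  (Q : probability (n.-tuple E) R) (i : 'I_n) (A : set (n.-tuple E)) : iid_law mu Q ->
  measurable A -> (forall x, mu [set y | A (upd x i y)]%classic = 0%E) -> Q A = 0%E.
Proof.
move=> iidQ mA h; apply/Ex_indic_eq0 => //.
have bA : bmf (\1_A : _ -> R) by exact: bmf_indic.
rewrite -(Ex_avgi iidQ i bA) -(Ex_cst Q 0); apply: eq_Rintegral => x _.
have mS : measurable [set y | A (upd x i y)]%classic.
  rewrite -[X in measurable X]setTI.
  have mu1 : measurable_fun setT (fun y => upd x i y).
    exact: measurableT_comp (measurable_upd i) (measurable_pair1 x).
  exact: mu1.
by apply/(Ex_indic_eq0 mu mS).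
Qed.

(** * The crossing kernel *)

Section CrossingKernel.
Context {R : realType}.

Definition ckernel (p q : R * R) : R := (cross p q)%:R.

Lemma measurable_mid d (T : measurableType d) (g : T -> R * R) :
  measurable_fun setT g -> measurable_fun setT (fun w => mid (g w)).
Proof.
move=> mg; apply: measurable_funB; first exact: measurableT_comp measurable_snd mg.
exact: measurableT_comp measurable_fst mg.
Qed.

Lemma measurable_cos d (T : measurableType d) (g : T -> R) :
  measurable_fun setT g -> measurable_fun setT (fun w => cos (g w)).
Proof. exact: measurableT_comp (continuous_measurable_fun (@continuous_cos R)). Qed.

Lemma measurable_sin d (T : measurableType d) (g : T -> R) :
  measurable_fun setT g -> measurable_fun setT (fun w => sin (g w)).
Proof. exact: measurableT_comp (continuous_measurable_fun (@continuous_sin R)). Qed.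

Lemma measurable_ckernel :
  measurable_fun setT (fun z : (R * R) * (R * R) => ckernel z.1 z.2).
Proof.
have m1 : measurable_fun setT (fun z : (R * R) * (R * R) => z.1) by exact: measurable_fst.
have m2 : measurable_fun setT (fun z : (R * R) * (R * R) => z.2) by exact: measurable_snd.
have m11 := measurableT_comp measurable_fst m1.
have m21 := measurableT_comp measurable_fst m2.
have c1 := measurable_cos m11; have c2 := measurable_cos m21.
have s1 := measurable_sin m11; have s2 := measurable_sin m21.
have mm := measurable_cos (measurable_funB (measurable_mid m1) (measurable_mid m2)).
have h : measurable_fun setT (fun z : (R * R) * (R * R) => cross z.1 z.2).
  apply: measurable_fun_ltr.
    apply: measurableT_comp => //; apply: measurable_funB => //.
    exact: measurable_funM.
  by apply: measurableT_comp => //; exact: measurable_funM.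
rewrite (_ : (fun z => _) = fun z : (R * R) * (R * R) => if cross z.1 z.2 then 1 else 0 : R).
  by apply: measurable_fun_ifT h _ _; exact: measurable_cst.
by apply/funext => z; rewrite /ckernel; case: cross.
Qed.

Lemma ckernel_ge0 p q : 0 <= ckernel p q. Proof. by rewrite /ckernel ler0n. Qed.

Lemma ckernel_le1 p q : ckernel p q <= 1. Proof. by rewrite /ckernel; case: cross. Qed.

Lemma ckernel_sym p q : ckernel p q = ckernel q p.
Proof.
by rewrite /ckernel /cross -[mid p - mid q]opprB cosN [cos p.1 * _]mulrC [sin p.1 * _]mulrC.
Qed.

Lemma bmf_ckernel : bmf (fun z : (R * R) * (R * R) => ckernel z.1 z.2).
Proof.
apply: (bmf_le (M := 1) measurable_ckernel) => z.
by rewrite ger0_norm ?ckernel_ge0// ckernel_le1.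
Qed.

Lemma bmf_ckernel1 q : bmf (fun p => ckernel p q).
Proof. exact: bmf_pairl q bmf_ckernel. Qed.

End CrossingKernel.

(** * The law of one chord and the projection of the kernel *)

Section ChordLaw.
Context {R : realType}.
Variables (f : R -> R) (nuT nuP : probability R R).
Hypothesis hf : is_density `[0, pi / 2] f.
Hypothesis hT : forall A : set R, measurable A ->
  (nuT A = \int[lebesgue_measure]_(x in A `&` `[0%R, (pi / 2)%R]) (f x)%:E)%E.
Hypothesis hP : forall A : set R, measurable A ->
  nuP A = uniform_prob (@two_pi_gt0 R) A.

Definition chord_law : probability (R * R)%type R := (nuT \x nuP)%E.
Local Notation mu := chord_law.

Lemma measurable_countable (A : set R) : countable A -> measurable A.
Proof. by apply: countable_measurable => x; exact: measurable_set1. Qed.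

Lemma half_angle_countable (A : set R) : countable A -> nuT A = 0%E.
Proof.
move=> cA; have mA := measurable_countable cA; rewrite hT//.
have c0 : lebesgue_measure (A `&` `[0, (pi / 2)%R]%classic) = 0%E.
  apply: countable_lebesgue_measure0.
  by apply: sub_countable cA; apply: subset_card_le; exact: subIsetl.
have [mf _ _] := hf.
apply: null_set_integral => //; first exact: measurableI.
apply/measurable_EFinP; apply: measurable_funS mf => //; exact: subIsetr.
Qed.

Lemma half_angle_range : nuT (~` `[0, pi / 2])%classic = 0%E.
Proof.
by rewrite hT ?setICl ?integral_set0//; exact: measurableC.
Qed.

Lemma angle_countable (A : set R) : countable A -> nuP A = 0%E.
Proof.
by move=> cA; rewrite hP ?uniform_prob_countable//; exact: measurable_countable.
Qed.

(** Neither the half-angle nor the endpoint angle has atoms, so countable exceptional sets can be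
    discarded in each variable. *)
Lemma chord_null (B : set (R * R)) (N : set R) : measurable B -> countable N ->
  (forall t, ~ N t -> countable [set p | B (t, p)]%classic) -> mu B = 0%E.
Proof.
move=> mB cN h; apply/Ex_indic_eq0 => //.
have bB : bmf (\1_B : _ -> R) by exact: bmf_indic.
rewrite /mu Ex_product//.
apply: (@Ex_null_eq0 _ _ _ nuT _ N); first exact: measurable_countable.
- exact: half_angle_countable.
- by have [] := bmf_Exr nuT nuP bB.
move=> t Nt; have mS : measurable [set p | B (t, p)]%classic.
  by apply: measurable_countable; exact: h.
by apply/(Ex_indic_eq0 nuP mS); exact/angle_countable/h.
Qed.

(** The differences of arc middles for which chords of half-angles [t] and [u] cross; a set of
    period 2 pi. *)
Definition arc (t u : R) : set R := [set x | `|cos x - cos t * cos u| < `|sin t * sin u|]%classic.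

Definition cross_prob (t u : R) : R := fine (uniform_prob (@two_pi_gt0 R) (arc t u)).

Lemma measurable_arc t u : measurable (arc t u).
Proof.
rewrite (_ : arc t u = (fun x => `|cos x - cos t * cos u|) @^-1` `]-oo,
  `|sin t * sin u|[%classic).
  rewrite -[X in measurable X]setTI.
  have : measurable_fun setT (fun x : R => `|cos x - cos t * cos u|).
    apply: measurableT_comp => //; apply: measurable_funB => //.
    exact: measurable_cos.
  exact.
by apply/seteqP; split => x; rewrite /arc /= in_itv.
Qed.

(** The half-angle [t] and the second chord's position only rotate the set of crossing positions,
    and the uniform law is rotation invariant; [k] reduces the rotation modulo 2 pi. *)
Lemma Ex_cross (t : R) (q : R * R) : \int[nuP]_p ckernel (t, p) q = cross_prob t q.1.
Proof.
pose s := t + mid q; have [k hk] := mod2pi s.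
have e (p : R) : ckernel (t, p) q = \1_([set p | arc t q.1 (p - (s - 2 * pi * k%:~R))]%classic) p.
  rewrite /ckernel indicE /cross /=; congr (nat_of_bool _)%:R.
  apply/idP/idP => [h|/set_mem]; [apply/mem_set|]; rewrite /= /arc /=.
    rewrite opprB addrCA [_ + (p - s)]addrC cosD2piz; move: h; rewrite /mid /=.
    by rewrite (_ : p - t - (q.2 - q.1) = p - s)//; rewrite /s /mid; ring.
  rewrite opprB addrCA [_ + (p - s)]addrC cosD2piz /mid /=.
  by rewrite (_ : p - t - (q.2 - q.1) = p - s)//; rewrite /s /mid; ring.
have mS : measurable [set p | arc t q.1 (p - (s - 2 * pi * k%:~R))]%classic.
  rewrite -[X in measurable X]setTI.
  have : measurable_fun setT (fun p : R => p - (s - 2 * pi * k%:~R)) by exact: measurable_funB.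
  by apply => //; exact: measurable_arc.
under eq_Rintegral do rewrite e; rewrite Ex_indic// hP// /cross_prob.
rewrite uniform_prob_shift//; first exact: measurable_arc.
by move=> x; rewrite /arc /= -{1}[2 * pi]mulr1 (cosD2piz 1).
Qed.

(** The bounds on the cosine are those at [t + u] and [|t - u|], and [(t + u) - |t - u|] is twice
    the minimum. *)
Lemma cross_probE t u : 0 <= t <= pi / 2 -> 0 <= u <= pi / 2 ->
  cross_prob t u = 2 * Num.min t u / pi.
Proof.
move=> /andP[t0 t1] /andP[u0 u1]; have p0 := @pi_gt0 R.
have st : 0 <= sin t by apply: sin_ge0_pi; lra.
have su : 0 <= sin u by apply: sin_ge0_pi; lra.
have cos_abs x : cos `|x| = cos x :> R.
  by have [h|h] := leP 0 x; [rewrite ger0_norm|rewrite ltr0_norm// cosN].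
have arcE : arc t u = [set x | cos (t + u) < cos x < cos `|t - u|]%classic.
  apply/seteqP; split => x; rewrite /arc /= (ger0_norm (mulr_ge0 st su)) cosD;
    rewrite (_ : cos `|t - u| = cos t * cos u + sin t * sin u).
  - by rewrite ltr_norml => /andP[? ?]; apply/andP; split; lra.
  - by rewrite cos_abs cosB.
  - by move=> /andP[? ?]; rewrite ltr_norml; apply/andP; split; lra.
  - by rewrite cos_abs cosB.
rewrite /cross_prob arcE uniform_prob_cos_itv//=; last 2 first.
- by rewrite ler_norml; apply/andP; split; lra.
- by lra.
congr (_ / _); case: (leP t u) => tu.
  by rewrite ler0_norm ?subr_le0//; ring.
by rewrite ger0_norm ?subr_ge0 ?(ltW tu)//; ring.
Qed.

Definition mean_cross (u : R) : R := \int[nuT]_t cross_prob t u.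

Lemma bmf_cross_prob u : bmf (fun t => cross_prob t u).
Proof.
under eq_fun => t do rewrite -(Ex_cross t (u, 0)).
have h := bmf_Exr nuT nuP (bmf_ckernel1 (u, 0)); exact: h.
Qed.

Lemma proj1U_ckernel q : proj1U mu (@ckernel R) q = mean_cross q.1.
Proof.
rewrite /proj1U /mu Ex_product; last exact: bmf_ckernel1.
by apply: eq_Rintegral => t _; exact: Ex_cross.
Qed.

Lemma bmf_proj1U_ckernel : bmf (proj1U mu (@ckernel R)).
Proof. exact: (bmf_Exr mu mu (bmf_swap bmf_ckernel)). Qed.

Lemma bmf_mean_cross : bmf mean_cross.
Proof.
rewrite (_ : mean_cross = fun u => proj1U mu (@ckernel R) (u, 0)).
  have h := bmf_pairl (0 : R) bmf_proj1U_ckernel; exact: h.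
by apply/funext => u; rewrite proj1U_ckernel.
Qed.

Lemma half_angle_set1 (t : R) : nuT [set t]%classic = 0%E.
Proof. exact/half_angle_countable/countable1. Qed.

(* If the projection were a.s. constant then, for a.e. [t], a second half-angle
   would a.s. not exceed [t]; but of two independent half-angles one is larger. *)
Lemma var1U_ckernel_gt0 : 0 < var1U mu (@ckernel R).
Proof.
rewrite lt_neqAle var1U_ge0 andbT eq_sym; apply/eqP => v0.
set p := meanU mu (@ckernel R) in v0.
have bG := bmf_mean_cross.
have bD : bmf (fun u => (mean_cross u - p) ^+ 2) by bmf_solve.
have {}v0 : \int[nuT]_u ((mean_cross u - p) ^+ 2) = 0.
  rewrite -v0 /var1U -/p /mu Ex_product; last first.
    have := bmf_proj1U_ckernel; rewrite -/mu => h; bmf_solve.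
  apply: eq_Rintegral => u _; rewrite -[LHS](Ex_cst nuP).
  by apply: eq_Rintegral => y _; rewrite -/mu proj1U_ckernel.
have h0 := Ex_eq0 bD (fun u => sqr_ge0 _) v0.
pose I := `[0, pi / 2]%classic : set R.
(* Off the null set [B], the half-angle lies in [0, pi/2] and the projection equals [p]. *)
pose B := ([set u | (mean_cross u - p) ^+ 2 != 0] `|` ~` I)%classic.
have mI : measurable I by exact: measurable_itv.
have mB1 : measurable [set u | (mean_cross u - p) ^+ 2 != 0]%classic.
  exact: measurable_neq0 bD.1.
have mB : measurable B by apply: measurableU => //; exact: measurableC.
have nB : nuT B = 0%E.
  exact: etrans (measureU0 mB1 (measurableC mI) half_angle_range) h0.
have goodB u : ~ B u -> I u /\ mean_cross u = p.
  move=> /not_orP[/negP h1 /contrapT h2]; split => //.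
  by move: h1; rewrite negbK sqrf_eq0 subr_eq0 => /eqP.
have mgt (t : R) : measurable [set x : R | t < x]%classic.
  by rewrite (_ : [set x | _]%classic = `]t, +oo[%classic)//; apply/seteqP; split => x /=;
    rewrite in_itv /= andbT.
have tail0 t : ~ B t -> nuT [set x | t < x]%classic = 0%E.
  move=> /goodB[It Gt]; apply: contrapT => /eqP tp.
  (* A set of positive measure is not contained in the null set [B]. *)
  have [u [tu Bu]] : exists u, t < u /\ ~ B u.
    apply: contrapT => /forallNP h; move/eqP: tp; apply.
    apply/eqP; rewrite eq_le measure_ge0 andbT -nB le_measure ?inE//.
    by move=> x /= tx; apply: contrapT => Bx; apply: (h x).
  have [Iu Gu] := goodB _ Bu.
  have bk := bmfB (bmf_cross_prob u) (bmf_cross_prob t).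
  have e0 : \int[nuT]_x (cross_prob x u - cross_prob x t) = 0.
    rewrite ExB; [|exact: bmf_cross_prob|exact: bmf_cross_prob].
    by rewrite -!/(mean_cross _) Gu Gt subrr.
  have p0 := @pi_gt0 R.
  have kE x : I x -> cross_prob x u - cross_prob x t = 2 * (Num.min x u - Num.min x t) / pi.
    rewrite /I /= !in_itv /= in It Iu * => Ix; rewrite !cross_probE//; ring.
  (* Monotonicity of [min x] makes the integrand nonnegative on [I], so mean 0 forces it to vanish
     almost everywhere; yet it is positive for [x > t]. *)
  have h1 : \int[nuT]_x `|cross_prob x u - cross_prob x t| = 0.
    rewrite -e0; apply: (@Ex_ae_eq _ _ _ nuT (~` I)%classic).
    - exact: measurableC.
    - exact: half_angle_range.
    - exact: (bmf_norm bk).1.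
    - exact: bk.1.
    move=> x /contrapT Ix; rewrite ger0_norm// kE// divr_ge0 ?(ltW p0)// mulr_ge0// subr_ge0.
    by rewrite le_min2// ltW.
  have := Ex_eq0 (bmf_norm bk) (fun=> normr_ge0 _) h1 => h2.
  move/eqP: tp; apply; apply/eqP; rewrite eq_le measure_ge0 andbT.
  have mC : measurable [set x | `|cross_prob x u - cross_prob x t| != 0]%classic.
    exact: measurable_neq0 (bmf_norm bk).1.
  have mIC : measurable (~` I)%classic by exact: measurableC.
  have hr := half_angle_range.
  have hU := etrans (measureU0 mC mIC hr) h2.
  rewrite -hU; apply: le_measure; rewrite ?inE//; first exact: measurableU.
  move=> x /= tx; have [Ix|Ix] := pselect (I x); last by right.
  left; rewrite normr_eq0 kE// !mulf_neq0 ?invr_eq0 ?lt0r_neq0//.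
  rewrite (min_r (ltW tx)) subr_gt0; rewrite lt_min tx tu//.
pose gt (z : R * R) : R := \1_([set z : R * R | z.1 < z.2]%classic) z.
have mgt2 : measurable [set z : R * R | z.1 < z.2]%classic.
  rewrite (_ : [set z | _]%classic = (fun z : R * R => z.2 - z.1) @^-1` `]0, +oo[%classic).
    rewrite -[X in measurable X]setTI.
    have : measurable_fun setT (fun z : R * R => z.2 - z.1).
      by apply: measurable_funB; [exact: measurable_snd|exact: measurable_fst].
    exact.
  by apply/seteqP; split => z /=; rewrite in_itv /= andbT subr_gt0.
have bgt : bmf gt by exact: bmf_indic.
have e1 : \int[nuT]_t \int[nuT]_x gt (t, x) = 0.
  apply: (@Ex_null_eq0 _ _ _ nuT _ B) => //; first by have [] := bmf_Exr nuT nuT bgt.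
  by move=> t /tail0 /(Ex_indic_eq0 nuT (mgt t)) h; rewrite -[RHS]h.
have e2 : \int[nuT]_t \int[nuT]_x gt (x, t) = 0.
  by rewrite -e1 (Ex_Fubini nuT nuT bgt).
(* Off the diagonal exactly one of [t < x] and [x < t] holds, and the diagonal is null because
   half-angles have no atoms. *)
have e3 : \int[nuT]_t \int[nuT]_x (gt (t, x) + gt (x, t)) = 1.
  transitivity (\int[nuT]_t (1 : R)); last exact: Ex_cst.
  apply: eq_Rintegral => t _; transitivity (\int[nuT]_x (1 : R)); last exact: Ex_cst.
  apply: (@Ex_ae_eq _ _ _ nuT [set t]%classic).
  - exact: measurable_set1.
  - exact: half_angle_set1.
  - have := bmfD (bmf_pairr t bgt) (bmf_pairl t bgt); by case.
  - exact: measurable_cst.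
  move=> x /eqP xt; rewrite /gt !indicE.
  have [h|h|h] := ltgtP t x.
  - by rewrite mem_set// memNset ?addr0//= => /lt_trans/(_ h); rewrite ltxx.
  - by rewrite memNset ?mem_set ?add0r//= => /lt_trans/(_ h); rewrite ltxx.
  - by rewrite h eqxx in xt.
have : \int[nuT]_t \int[nuT]_x (gt (t, x) + gt (x, t)) = 0.
  rewrite -[RHS](Ex_cst nuT); under eq_Rintegral => t _.
    rewrite ExD; [|exact: bmf_pairr|exact: bmf_pairl]; over.
  rewrite ExD; [|exact: (bmf_Exr nuT nuT bgt)|exact: (bmf_Exr nuT nuT (bmf_swap bgt))].
  by rewrite e1 e2 addr0 Ex_cst.
by rewrite e3 => /eqP; rewrite oner_eq0.
Qed.

(** The projection is [0, 1]-valued with mean [p], so its positive variance is at most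
    [p - p^2 <= p]. *)
Lemma meanU_ckernel_gt0 : 0 < meanU mu (@ckernel R).
Proof.
apply: (lt_le_trans var1U_ckernel_gt0).
set p := meanU _ _; have bg := bmf_proj1U_ckernel.
have pb : 0 <= p <= 1 by apply: meanU_bounds;
  [exact: measurable_ckernel|exact: ckernel_ge0|exact: ckernel_le1].
have h : \int[mu]_b (proj1U mu (@ckernel R) b - 2 * p * proj1U mu (@ckernel R) b + p ^+ 2) = p
  - p ^+ 2.
  rewrite ExD; [|by bmf_solve|by bmf_solve].
  rewrite ExB; [|by bmf_solve|by bmf_solve].
  by rewrite ExZ// Ex_cst -/(meanU mu _) -/p; ring.
apply: (@le_trans _ _ (p - p ^+ 2)); last by rewrite gerBl sqr_ge0.
rewrite -h; apply: Ex_le; [by bmf_solve|by bmf_solve|move=> b].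
have /andP[g0 g1] := g_bounds mu measurable_ckernel ckernel_ge0 ckernel_le1 b.
have : 0 <= proj1U mu (@ckernel R) b * (1 - proj1U mu (@ckernel R) b) by rewrite mulr_ge0//
  subr_ge0.
by rewrite -/p; move: (proj1U _ _ b) => z; lra.
Qed.

(** * Almost sure general position *)

Section Genericity.
Variables (n : nat) (Q : probability (n.-tuple (R * R)) R).
Hypothesis iidQ : iid_law mu Q.
Local Notation Om := (n.-tuple (R * R)).

Let mt (i : 'I_n) : measurable_fun setT (fun x : Om => tnth x i).
Proof. exact: measurable_tnth. Qed.

Let mth (i : 'I_n) := measurableT_comp measurable_fst (mt i).

Let mmid (i j : 'I_n) : measurable_fun setT (fun x : Om => sin (mid (tnth x i) - mid (tnth x j))).
Proof. by apply: measurable_sin; apply: measurable_funB; exact: measurable_mid. Qed.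

Lemma half_angle_null (g : R -> R) (i : 'I_n) : measurable_fun setT g ->
  countable [set t | g t = 0]%classic ->
  measurable [set x : Om | g (tnth x i).1 = 0]%classic /\
  Q [set x : Om | g (tnth x i).1 = 0]%classic = 0%E.
Proof.
move=> mg cg; have mA : measurable [set x : Om | g (tnth x i).1 = 0]%classic.
  by apply: measurable_eq0; exact: measurableT_comp mg (mth i).
split => //; apply: (tuple_null (i := i) iidQ mA) => x.
have -> : [set y | [set x0 : Om | g (tnth x0 i).1 = 0]%classic (upd x i y)]%classic =
    [set y : R * R | g y.1 = 0]%classic.
  by apply/seteqP; split => y; rewrite /= tnth_upd eqxx.
apply: (@chord_null _ [set t : R | g t = 0]%classic) => //.
- by apply: measurable_eq0; exact: measurableT_comp mg measurable_fst.
- by move=> t gt; rewrite (_ : [set p | _]%classic = set0)//; apply/seteqP; split.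
Qed.

Lemma countable_sin_eq0 : countable [set t : R | sin t = 0]%classic.
Proof.
have := @countable_trig_eq R 0 1 0 0; rewrite eqxx oner_eq0 /= => /(_ isT).
apply: sub_countable; apply: subset_card_le => t /= h.
by rewrite subr0 mul0r add0r mul1r addr0.
Qed.

(** With everything but the endpoint angle of the chord [i] fixed, this is a trigonometric equation
    whose coefficients [- sin b] and [cos b] do not both vanish. *)
Lemma parallel_null (i j : 'I_n) : i != j ->
  measurable [set x : Om | sin (mid (tnth x i) - mid (tnth x j)) = 0]%classic /\
  Q [set x : Om | sin (mid (tnth x i) - mid (tnth x j)) = 0]%classic = 0%E.
Proof.
move=> ij.
have mA : measurable [set x : Om | sin (mid (tnth x i) - mid (tnth x j)) = 0]%classic.
  exact: measurable_eq0.
split; first exact: mA.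
apply: (tuple_null (i := i) iidQ mA) => x.
set b := mid (tnth x j).
have -> : [set y | [set x0 : Om | sin (mid (tnth x0 i) - mid (tnth x0 j)) = 0]%classic (upd x i
  y)]%classic =
    [set y : R * R | sin (mid y - b) = 0]%classic.
  by apply/seteqP; split => y; rewrite /= !tnth_upd eqxx eq_sym (negbTE ij).
apply: (@chord_null _ set0).
- apply: measurable_eq0; apply: measurable_sin; apply: measurable_funB;
  [exact: measurable_mid|exact: measurable_cst].
- exact: countable0.
move=> t _; have := @countable_trig_eq R (- sin b) (cos b) 0 t.
have -> : ~~ [&& - sin b == 0, cos b == 0 & (0 : R) == 0].
  apply/negP => /and3P[/eqP s0 /eqP c0 _]; have := cos2Dsin2 b.
  by rewrite c0 -[sin b ^+ 2]sqrrN s0 expr0n addr0 => /esym/eqP; rewrite oner_eq0.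
move=> /(_ isT); apply: sub_countable; apply: subset_card_le => p /=.
by rewrite /mid /= sinB => h; rewrite addr0 -[RHS]h; ring.
Qed.

(** As an equation in the endpoint angle of the chord [k], it has constant term
    [- cos t sin (mid p - mid q)]. The two conditions in [A] keep this term nonzero; parallel lines
    and diameters are null on their own. *)
Lemma concurrent_null (i j k : 'I_n) : k != i -> k != j ->
  let A := [set x : Om | [/\ sin (mid (tnth x i) - mid (tnth x j)) <> 0,
    cos (tnth x k).1 <> 0 & det3 (tnth x i) (tnth x j) (tnth x k) = 0]]%classic in
  measurable A /\ Q A = 0%E.
Proof.
move=> ki kj A.
have mne (g : Om -> R) : measurable_fun setT g -> measurable [set x | g x <> 0]%classic.
  by move=> mg; apply: measurableC; exact: measurable_eq0.
have mA : measurable A.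
  have -> : A = ([set x : Om | sin (mid (tnth x i) - mid (tnth x j)) <> 0] `&`
      [set x : Om | cos (tnth x k).1 <> 0] `&`
      [set x : Om | det3 (tnth x i) (tnth x j) (tnth x k) = 0])%classic.
    by apply/seteqP; split => x; [case|case=> -[]].
  apply: measurableI; first apply: measurableI.
  - exact: mne.
  - apply: mne; apply: measurable_cos; exact: mth.
  apply: measurable_eq0; apply: measurable_funD; first apply: measurable_funD;
    by apply: measurable_funM; [apply: measurable_cos; exact: mth|exact: mmid].
split; first exact: mA.
apply: (tuple_null (i := k) iidQ mA) => x.
set p := tnth x i; set q := tnth x j.
have AE y : A (upd x k y) <-> [/\ sin (mid p - mid q) <> 0, cos y.1 <> 0 & det3 p q y = 0].
  by rewrite /A /= !tnth_upd eqxx eq_sym (negbTE ki) eq_sym (negbTE kj).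
apply: (@chord_null _ set0).
- have mu1 : measurable_fun setT (fun y => upd x k y).
    exact: measurableT_comp (measurable_upd k) (measurable_pair1 x).
  by rewrite -[X in measurable X]setTI; exact: mu1.
- exact: countable0.
move=> t _.
have [pq|pq] := eqVneq (sin (mid p - mid q)) 0.
  rewrite (_ : [set p | _]%classic = set0); first exact: countable0.
  by apply/seteqP; split => // y /= /AE[].
have [ct|ct] := eqVneq (cos t) 0.
  rewrite (_ : [set p | _]%classic = set0); first exact: countable0.
  by apply/seteqP; split => // y /= /AE[].
have := @countable_trig_eq R (cos q.1 * sin (mid p) - cos p.1 * sin (mid q))
  (cos p.1 * cos (mid q) - cos q.1 * cos (mid p)) (- (cos t * sin (mid p - mid q))) t.
have -> : ~~ [&& cos q.1 * sin (mid p) - cos p.1 * sin (mid q) == 0,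
    cos p.1 * cos (mid q) - cos q.1 * cos (mid p) == 0 &
    - (cos t * sin (mid p - mid q)) == 0].
  by rewrite oppr_eq0 mulf_eq0 (negbTE pq) (negbTE ct) /= !andbF.
move=> /(_ isT); apply: sub_countable; apply: subset_card_le => y /= /AE[_ _].
by rewrite /det3 [mid (t, y)]/mid /= => <-; rewrite !sinB; ring.
Qed.

Lemma generic_nth (ps : seq (R * R)) (z0 : R * R) :
  (forall i, (i < size ps)%N -> sin (nth z0 ps i).1 <> 0) ->
  (forall i j, (i < j < size ps)%N -> sin (mid (nth z0 ps i) - mid (nth z0 ps j)) <> 0) ->
  (forall i j k, (i < j < k)%N -> (k < size ps)%N ->
     det3 (nth z0 ps i) (nth z0 ps j) (nth z0 ps k) <> 0) ->
  generic ps.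
Proof.
elim: ps => //= p ps IH h1 h2 h3; apply/and4P; split.
- by apply/eqP; exact: (h1 0%N).
- by apply/(all_nthP z0) => i si; apply/eqP; exact: (h2 0%N i.+1).
- apply/(pairwiseP z0) => j k; rewrite !inE => sj sk jk; apply/eqP.
  by apply: (h3 0%N j.+1 k.+1) => //=; rewrite ltnS.
- apply: IH => [i si|i j ij|i j k ijk sk].
  + exact: (h1 i.+1).
  + exact: (h2 i.+1 j.+1).
  + exact: (h3 i.+1 j.+1 k.+1).
Qed.

Lemma generic_ae : exists2 B : set Om, measurable B /\ Q B = 0%E &
  forall x : Om, ~ B x -> generic x.
Proof.
have [m1 B1] := bigsetU_null (fun i => half_angle_null i (measurable_sin (@measurable_id _ R
  setT)) countable_sin_eq0).
have [m2 B2] := bigsetU_null (fun i => half_angle_null i (measurable_cos (@measurable_id _ R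
  setT)) (countable_cos_eq 0)).
pose F3 (ij : 'I_n * 'I_n) : set Om := if ij.1 != ij.2 then
  [set x : Om | sin (mid (tnth x ij.1) - mid (tnth x ij.2)) = 0]%classic else set0.
have [m3 B3] : measurable (\big[setU/set0]_ij F3 ij) /\ Q (\big[setU/set0]_ij F3 ij) = 0%E.
  apply: bigsetU_null => -[i j]; rewrite /F3 /=; case: ifPn => [|_]; last by rewrite measure0.
  exact: parallel_null.
pose F4 (ijk : 'I_n * 'I_n * 'I_n) : set Om :=
  if (ijk.2 != ijk.1.1) && (ijk.2 != ijk.1.2) then
  [set x : Om | [/\ sin (mid (tnth x ijk.1.1) - mid (tnth x ijk.1.2)) <> 0,
    cos (tnth x ijk.2).1 <> 0 & det3 (tnth x ijk.1.1) (tnth x ijk.1.2) (tnth x ijk.2) =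
      0]]%classic
  else set0.
have [m4 B4] : measurable (\big[setU/set0]_ijk F4 ijk) /\ Q (\big[setU/set0]_ijk F4 ijk) = 0%E.
  apply: bigsetU_null => -[[i j] k]; rewrite /F4 /=; case: ifPn => [/andP[ki kj]|_];
    last by rewrite measure0.
  exact: concurrent_null.
have m34 := measurableU _ _ m3 m4; have m234 := measurableU _ _ m2 m34.
exists (\big[setU/set0]_i [set x : Om | sin (tnth x i).1 = 0] `|`
  (\big[setU/set0]_i [set x : Om | cos (tnth x i).1 = 0] `|`
  (\big[setU/set0]_ij F3 ij `|` \big[setU/set0]_ijk F4 ijk)))%classic.
  split; first exact: measurableU.
  have B34 := etrans (measureU0 m3 m4 B4) B3.
  have B234 := etrans (measureU0 m2 m34 B34) B2.
  exact: etrans (measureU0 m1 m234 B234) B1.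
move=> x /not_orP[h1 /not_orP[h2 /not_orP[h3 h4]]].
have sinN0 i : sin (tnth x i).1 <> 0.
  by move=> h; apply: h1; exact: (@sub_bigsetU _ Om _ (fun i => [set x : Om | sin (tnth x i).1
    = 0]%classic) i).
have cosN0 i : cos (tnth x i).1 <> 0.
  by move=> h; apply: h2; exact: (@sub_bigsetU _ Om _ (fun i => [set x : Om | cos (tnth x i).1
    = 0]%classic) i).
have midN0 i j : i != j -> sin (mid (tnth x i) - mid (tnth x j)) <> 0.
  by move=> ij h; apply: h3; apply: (@sub_bigsetU _ Om _ F3 (i, j)); rewrite /F3 /= ij.
have detN0 i j k : i != j -> k != i -> k != j -> det3 (tnth x i) (tnth x j) (tnth x k) <> 0.
  move=> ij ki kj h; apply: h4; apply: (@sub_bigsetU _ Om _ F4 (i, j, k)); rewrite /F4 /= ki kj.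
  by split; [exact: midN0|exact: cosN0|].
have nthE (i : nat) (si : (i < n)%N) : nth (0, 0) x i = tnth x (Ordinal si).
  by rewrite (tnth_nth (0, 0)).
apply: (@generic_nth _ (0, 0)); rewrite size_tuple.
- by move=> i si; rewrite (nthE _ si).
- move=> i j /andP[ij jn]; rewrite (nthE _ jn) (nthE _ (ltn_trans ij jn)); apply: midN0.
  by rewrite -val_eqE /= ltn_eqF.
- move=> i j k /andP[ij jk] kn; have jn := ltn_trans jk kn.
  rewrite (nthE _ kn) (nthE _ jn) (nthE _ (ltn_trans ij jn)); apply: detN0.
  + by rewrite -val_eqE /= ltn_eqF.
  + by rewrite -val_eqE /= gtn_eqF// (ltn_trans ij).
  + by rewrite -val_eqE /= gtn_eqF.
Qed.

End Genericity.

End ChordLaw.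

(** * Crossings as a U-statistic *)

Section CrossingCount.
Context {R : realType}.

(** Doubling passes from the ordered list of pairs to a symmetric double sum; the diagonal is
    subtracted rather than evaluated. *)
Lemma crossings_double (ps : seq (R * R)) : 2 * (crossings ps)%:R =
  \sum_(p <- ps) \sum_(q <- ps) ckernel p q - \sum_(p <- ps) ckernel p p :> R.
Proof.
elim: ps => [|p ps IH] /=; first by rewrite !big_nil mulr0 subr0.
rewrite natrD mulrDr IH !big_cons.
have -> : \sum_(j <- ps) \sum_(q <- p :: ps) ckernel j q =
    \sum_(j <- ps) ckernel p j + \sum_(j <- ps) \sum_(q <- ps) ckernel j q.
  rewrite -big_split; apply: eq_bigr => j _.
  by rewrite big_cons ckernel_sym.
by rewrite natr_sum; ring.
Qed.

Lemma crossings_Ustat n (x : n.-tuple (R * R)) :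
  (crossings x)%:R = Ustat (@ckernel R) x.
Proof.
apply: (mulfI (_ : 2 != 0 :> R)); first by rewrite pnatr_eq0.
rewrite crossings_double /Ustat mulrA divff ?pnatr_eq0// mul1r !big_tuple.
rewrite -sumrB; apply: eq_bigr => i _; rewrite big_tuple (bigD1 i)//=; ring.
Qed.

End CrossingCount.

(** * Expectations under the standard normal law *)

Section StandardNormal.
Context {R : realType}.

Lemma Phi_gcdf (z : R) : Phi z = (gcdf z)%:E.
Proof.
rewrite /Phi (_ : [set t | t < z]%classic = `]-oo, z[%classic); last first.
  by apply/seteqP; split => t /=; rewrite in_itv.
rewrite /normal_prob integral_itv_bndo_bndc; last first.
  apply/measurable_EFinP; apply: measurable_funTS.
  exact: continuous_measurable_fun (@continuous_gpdf R).
rewrite /gcdf /gint /Rintegral fineK.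
  by apply: eq_integral => t _; rewrite mul1r.
apply: integrable_fin_num => //.
exact: (integrable_gpdfM (measurable_cst (1 : R)) one_le (measurable_itv _)).
Qed.

Lemma Phi_fun_gmean (h : R -> R) : measurable_fun setT h -> (forall x, `|h x| <= 1) ->
  Phi_fun h = (gmean h)%:E.
Proof.
move=> mh h1; rewrite /Phi_fun.
have ip : lebesgue_measure.-integrable setT (EFin \o @gpdf R) by exact: integrable_normal_pdf.
have nuE (A : set (measurableTypeR R)) : measurable A ->
  normal_prob (0 : R) 1 A = (\int[lebesgue_measure]_(x in A) (@gpdf R x)%:E)%E by [].
rewrite (@integral_density _ _ R lebesgue_measure (normal_prob (0 : R) 1) (@gpdf R) h 1 ip nuE
  mh h1).
rewrite /gmean /Rintegral fineK//.
apply: integrable_fin_num => //; exact: (integrable_gpdfM mh h1).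
Qed.

End StandardNormal.

(** * Transfer to the number of regions *)

Section RegionLaw.
Context {R : realType} d (T : measurableType d) (P : probability T R).
Variables (f : R -> R) (n : nat) (theta phi : 'I_n -> {RV P >-> R}).
Hypothesis hf : is_density `[0, pi / 2] f.
Hypothesis hc : iid_random_chords f theta phi.
Variables (nuT nuP : probability R R).
Hypothesis hT : forall A : set R, measurable A ->
  (nuT A = \int[lebesgue_measure]_(x in A `&` `[0%R, (pi / 2)%R]) (f x)%:E)%E.
Hypothesis hP : forall A : set R, measurable A ->
  nuP A = uniform_prob (@two_pi_gt0 R) A.
Local Notation mu := (chord_law nuT nuP).
Local Notation Om := (n.-tuple (R * R)).

Definition chords (w : T) : Om := [tuple (theta i w, phi i w) | i < n].

Lemma measurable_chords : measurable_fun setT chords.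
Proof.
apply/measurable_fun_tnthP => i; rewrite /comp.
under eq_fun do rewrite tnth_mktuple.
by apply: measurable_fun_pair.
Qed.

Definition chords_law_mfun : {mfun T >-> Om} :=
  HB.pack chords (isMeasurableFun.Build _ _ _ _ _ measurable_chords).

Definition chords_law : probability Om R := distribution P chords_law_mfun.
Local Notation Q := chords_law.

Lemma chord_pair_law i (A : set (R * R)) : measurable A ->
  P [set w | A (theta i w, phi i w)]%classic = mu A.
Proof.
move=> mA; have [hth hph hind] := hc.1 i.
have mp : measurable_fun setT (fun w => (theta i w, phi i w)) by exact: measurable_fun_pair.
pose nuf : {measure set (R * R) -> \bar R} := pushforward P (fun w => (theta i w, phi i w)).
pose nu := nuf mp.
have -> : P [set w | A (theta i w, phi i w)]%classic = nu A by [].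
apply/esym; apply: product_measure_unique => // B C mB mC.
transitivity (P ((theta i @^-1` B) `&` (phi i @^-1` C))%classic); first by [].
rewrite hind//; congr (_ * _)%E.
  exact: etrans (hth _ mB) (esym (hT mB)).
exact: etrans (hph _ mC) (esym (hP mC)).
Qed.

Lemma chords_iid : iid_law mu Q.
Proof.
move=> A mA.
have := hc.2 [set: 'I_n]%SET A (fun i _ => mA i).
rewrite (eq_bigr (fun i => mu (A i))); last first.
  by move=> i _; exact: chord_pair_law.
rewrite (eq_bigl xpredT); last by move=> i; rewrite inE.
move=> <-; rewrite /chords_law /distribution /pushforward /=; congr (P _).
apply/seteqP; split => w /=.
  by move=> h i _; have := h i; rewrite /= tnth_mktuple.
by move=> h i; rewrite tnth_mktuple; apply: (h i); rewrite /= inE.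
Qed.

Lemma Ex_chords (g : Om -> R) : bmf g -> \int[P]_w g (chords w) = \int[Q]_x g x.
Proof.
move=> bg; rewrite /Rintegral; congr fine.
have mX := measurable_chords.
have := @integral_pushforward _ _ T Om R chords mX P setT (EFin \o g).
rewrite preimage_setT => h; rewrite [RHS]h//.
  by apply/measurable_EFinP; case: bg.
exact: bmf_integrable (bmf_comp bg mX).
Qed.

Lemma region_count_ncells w : region_count theta phi w =
  (ncells (@open_disc R) [seq ell p | p <- chords w])%:R.
Proof.
rewrite /region_count num_regions_cells; congr (ncells _ _)%:R.
by rewrite /chords /= -map_comp.
Qed.

Lemma measurable_region_count : measurable_fun setT (region_count theta phi).
Proof.
have -> : region_count theta phi = fun w => (ncells (@open_disc R)
    [seq ell (p w) | p <- [seq (fun w => (theta i w, phi i w)) | i <- enum 'I_n]])%:R.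
  apply/funext => w; rewrite region_count_ncells; congr (ncells _ _)%:R.
  by rewrite /chords /= -!map_comp.
apply: measurable_ncells => p; elim: (enum _) => //= i s IH [<-|//].
by apply: measurable_fun_pair.
Qed.

Lemma region_count_ae : exists2 N : set T, measurable N /\ P N = 0%E &
  forall w, ~ N w -> region_count theta phi w = 1 + n%:R + Ustat (@ckernel R) (chords w).
Proof.
have [B [mB B0] hB] := generic_ae hf hT hP chords_iid.
exists (chords @^-1` B)%classic.
  by split; [rewrite -[X in measurable X]setTI; exact: measurable_chords|exact: B0].
move=> w Bw; rewrite region_count_ncells ncells_generic; last exact: hB.
by rewrite size_tuple !natrD crossings_Ustat.
Qed.

(** Off a null set the number of regions is [1 + n + S] of the tuple of chords; the constant shift
    then cancels in the variance and in the standardization. *)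
Lemma Ex_region_count (u : R -> R) : measurable_fun setT u ->
  bmf (fun x : Om => u (1 + n%:R + Ustat (@ckernel R) x)) ->
  \int[P]_w u (region_count theta phi w) =
  \int[Q]_x u (1 + n%:R + Ustat (@ckernel R) x).
Proof.
move=> mu' bu; have [N [mN N0] hN] := region_count_ae.
rewrite -(Ex_chords bu); apply: Ex_ae_eq mN N0 _ _ _.
- exact: measurableT_comp mu' measurable_region_count.
- exact: (bmf_comp bu measurable_chords).1.
- by move=> w /hN ->.
Qed.

Local Notation S := (Ustat (n := n) (@ckernel R)).
Local Notation m := (2^-1 * ((n%:R : R) * ((n%:R : R) - 1) * meanU mu (@ckernel R))).
Local Notation F := (region_count theta phi).

Let bS : bmf S. Proof. exact: bmf_Ustat measurable_ckernel ckernel_ge0 ckernel_le1. Qed.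

Lemma mean_region_count : mean P F = 1 + n%:R + m.
Proof.
rewrite /mean unlock -/(Rintegral _ _ _).
have b1 : bmf (fun x : Om => 1 + n%:R + S x) by apply: bmfD => //; exact: bmf_cst.
rewrite (Ex_region_count (u := idfun) _ b1)//; last exact: measurable_id.
rewrite ExD//; last exact: bmf_cst.
rewrite Ex_cst (Ex_Ustat chords_iid measurable_ckernel ckernel_ge0 ckernel_le1)//.
Qed.

Lemma var_region_count : fine 'V_P[F]%E = \int[Q]_x ((S x - m) ^+ 2).
Proof.
rewrite /variance covariance.unlock expectation.unlock -/(Rintegral _ _ _).
have -> : fine (\int[P]_x (F x)%:E)%E = 1 + n%:R + m by rewrite -mean_region_count /mean unlock.
have b2 : bmf (fun x : Om => (1 + n%:R + S x - (1 + n%:R + m)) ^+ 2).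
  by apply: bmfX; apply: bmfB; [apply: bmfD => //; exact: bmf_cst|exact: bmf_cst].
have mu2 : measurable_fun setT (fun y : R => (y - (1 + n%:R + m)) ^+ 2).
  by apply: measurable_funX; exact: measurable_funB.
have := Ex_region_count mu2 b2; rewrite /= => h.
transitivity (\int[P]_w ((F w - (1 + n%:R + m)) ^+ 2)); first by [].
rewrite h; apply: eq_Rintegral => x _; congr (_ ^+ 2); ring.
Qed.

Lemma sigma_sqr : sigma P F ^+ 2 = \int[Q]_x ((S x - m) ^+ 2).
Proof.
rewrite /sigma sqr_sqrtr var_region_count//.
by apply: Ex_ge0 => x; exact: sqr_ge0.
Qed.

Lemma Ex_standardized (u : R -> R) : measurable_fun setT u ->
  (exists M : R, forall x, `|u x| <= M) ->
  bmf (fun w => u (standardized P F w)) /\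
  \int[P]_w u (standardized P F w) = \int[Q]_x u (stdU mu (@ckernel R) (sigma P F) x).
Proof.
move=> mu' [M hM].
have mst : measurable_fun setT (fun y : R => (y - mean P F) / sigma P F).
  by apply: measurable_funM => //; exact: measurable_funB.
have mv := measurableT_comp mu' mst.
split.
  by apply: (bmf_le (M := M)) => //; exact: measurableT_comp mv measurable_region_count.
have bv : bmf (fun x : Om => u ((1 + n%:R + S x - mean P F) / sigma P F)).
  apply: (bmf_le (M := M)) => //; apply: (measurableT_comp mv).
  by apply: measurable_funD => //; case: bS.
rewrite (Ex_region_count mv bv); apply: eq_Rintegral => x _.
by rewrite /stdU mean_region_count; congr (u (_ / _)); ring.
Qed.

Section Distances.
Hypothesis n_gt5 : (5 < n)%N.
Hypothesis s_gt0 : 0 < sigma P F.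

Let n_gt1 : (1 < n)%N. Proof. exact: leq_trans n_gt5. Qed.

Lemma kolmogorov_distance_le : (kolmogorov_distance P (standardized P F) <=
  (14 * n%:R ^+ 4 / sigma P F ^+ 3)%:E)%E.
Proof.
apply: ge_ereal_sup => _ [z _ <-].
have bb : exists M : R, forall x, `|below z x| <= M.
  by exists 1 => x; rewrite /below; case: (_ < _); rewrite ?normr1 ?normr0.
have mb : measurable_fun setT (below z).
  rewrite (_ : below z = \1_(`]-oo, z[%classic)).
    by apply: measurable_indic; exact: measurable_itv.
  by apply/funext => x; rewrite /below indicE mem_setE in_itv.
have [bw ew] := Ex_standardized mb bb.
have -> : P [set x | standardized P F x < z]%classic =
    (\int[P]_w below z (standardized P F w))%:E.
  have mA : measurable [set w | standardized P F w < z]%classic.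
    have := measurable_neq0 bw.1; congr (measurable _).
    by apply/seteqP; split => w /=; rewrite /below pnatr_eq0 eqb0 negbK.
  rewrite -[LHS]fineK ?fin_num_measure// -(Ex_indic P mA); congr EFin.
  by apply: eq_Rintegral => w _; rewrite /below indicE mem_setE.
rewrite Phi_gcdf -EFinB abse_EFin lee_fin ew.
apply: (stein_kolmogorov chords_iid measurable_ckernel ckernel_ge0
  ckernel_le1 ckernel_sym n_gt1 s_gt0 sigma_sqr (measurable_stein_ind z)
  (stein_ind_bound z) (mul_stein_ind_bound z) _ (stein_ind_incr z)).
by rewrite gcdf_ge0 gcdf_le1.
Qed.

Lemma smooth_distance_le : (smooth_distance P (standardized P F) <=
  (6 * (n%:R ^+ 2 * Num.sqrt n%:R) / sigma P F ^+ 2 + 2 * n%:R ^+ 4 / sigma P F ^+ 3)%:E)%E.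
Proof.
apply: ge_ereal_sup => _ [h [dh h1 h'1] <-].
have sup_le (g : R -> R) : (sup_norm g <= 1)%E -> forall x, `|g x| <= 1.
  move=> g1 x; rewrite -lee_fin; apply: le_trans g1; apply: ereal_sup_ubound.
  by exists x.
have {}h1 := sup_le _ h1; have {}h'1 := sup_le _ h'1.
have mh : measurable_fun setT h.
  apply: continuous_measurable_fun => x; apply: differentiable_continuous.
  by apply/derivable1_diffP; exact: dh.
have [bw ew] := Ex_standardized mh (ex_intro _ 1 h1).
have -> : 'E_P[(fun x => h (standardized P F x))]%E = (\int[P]_w h (standardized P F w))%:E.
  by rewrite unlock -(Ex_EFin P bw).
rewrite (Phi_fun_gmean mh h1) -EFinB abse_EFin lee_fin ew.
exact: (stein_smooth chords_iid measurable_ckernel ckernel_ge0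
  ckernel_le1 ckernel_sym n_gt1 s_gt0 sigma_sqr (measurable_stein_fun dh h1)
  (measurable_stein_der dh h1) (stein_fun_bound dh h1) (stein_der_bound dh h1)
  (stein_eq h) (stein_taylor dh h1 h'1) n_gt5).
Qed.

End Distances.

(** The linear part alone has variance [n (n - 1)^2 v >= v n^3 / 4] for [n >= 2]; the upper bound
    follows from [Var S <= n^3 / 8]. *)
Lemma sigma_bounds : (1 < n)%N ->
  Num.sqrt (var1U mu (@ckernel R)) / 2 * Num.sqrt n%:R ^+ 3 <= sigma P F <= Num.sqrt n%:R ^+ 3.
Proof.
move=> n_gt1; set v := var1U _ _; set r : R := Num.sqrt n%:R.
have v0 : 0 <= v by exact: var1U_ge0.
have r2 : r ^+ 2 = n%:R by rewrite sqr_sqrtr.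
have r0 : 0 <= r by exact: sqrtr_ge0.
have n2 : 2 <= n%:R :> R by rewrite ler_nat.
have s0 : 0 <= sigma P F by exact: sqrtr_ge0.
have r6 : (r ^+ 3) ^+ 2 = n%:R ^+ 3 by rewrite -r2 -!exprM.
apply/andP; split.
  rewrite -(@ler_pXn2r _ 2)// ?nnegrE ?mulr_ge0 ?divr_ge0 ?exprn_ge0 ?sqrtr_ge0//.
  rewrite exprMn r6 exprMn sqr_sqrtr// sigma_sqr.
  rewrite (var_Ustat chords_iid measurable_ckernel ckernel_ge0 ckernel_le1 ckernel_sym) -/v.
  have d0 := vardU_ge0 mu (@ckernel R).
  have n0 : 0 <= n%:R * (n%:R - 1) * vardU mu (@ckernel R).
    by rewrite !mulr_ge0//; lra.
  have h1 : n%:R ^+ 2 / 4 <= (n%:R - 1) ^+ 2 :> R.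
    have : 0 <= (n%:R - 2) * (3 * n%:R - 2) :> R by rewrite mulr_ge0//; lra.
    lra.
  have h2 := ler_wpM2l v0 (ler_wpM2l (ler0n R n) h1).
  by rewrite exprVn; lra.
rewrite -(@ler_pXn2r _ 2)// ?nnegrE ?exprn_ge0// r6.
have := stdU_var_le chords_iid measurable_ckernel ckernel_ge0 ckernel_le1 ckernel_sym n_gt1
  sigma_sqr.
have : 0 <= n%:R ^+ 3 :> R by rewrite exprn_ge0.
lra.
Qed.

End RegionLaw.

(** * Orders of magnitude *)

Section Growth.
Context {R : realType}.
Local Notation rt n := (Num.sqrt (n%:R : R)).

Lemma powR_sqrt (n k : nat) : (0 < n)%N -> n%:R `^ (k%:R / 2) = rt n ^+ k.
Proof.
move=> n0; rewrite mulrC powRrM powR12_sqrt// powR_mulrn//.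
Qed.

Lemma powR_invsqrt (n : nat) : (0 < n)%N -> n%:R `^ (- (1 / 2)) = (rt n)^-1%R.
Proof. by move=> n0; rewrite powRN (powR_sqrt 1 n0) expr1. Qed.

Lemma natX4 (n : nat) : n%:R ^+ 4 = rt n ^+ 8.
Proof. by rewrite -[in LHS](@sqr_sqrtr _ n%:R)// -exprM. Qed.

Lemma Theta_sqr (p : R) (a : nat -> R) : 0 < p <= 1 ->
  (forall n, a n = 1 + n%:R + 2^-1 * (n%:R * (n%:R - 1) * p)) -> is_Theta a 2.
Proof.
move=> /andP[p0 p1] aE; exists (p / 4), 3, 1%N; split; [lra|lra|move=> n n1].
have n2 : 2 <= n%:R :> R by rewrite ler_nat.
rewrite (powR_mulrn 2)// aE.
have h1 : 0 <= (n%:R - 2) * n%:R * p by rewrite !mulr_ge0//; lra.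
have h2 : 0 <= n%:R * (n%:R - 1) * (1 - p) by rewrite !mulr_ge0//; lra.
have h3 : 0 <= (n%:R - 2) * n%:R :> R by rewrite !mulr_ge0//; lra.
by apply/andP; split; lra.
Qed.

Variables (s : nat -> R) (k : R).
Hypothesis k01 : 0 < k < 1.
Hypothesis hs : forall n, (1 < n)%N -> k * rt n ^+ 3 <= s n <= rt n ^+ 3.

Lemma Theta_sigma : is_Theta s (3 / 2).
Proof.
case/andP: k01 => k0 k1; exists k, 1, 1%N; split => // n n1.
by rewrite (powR_sqrt 3) ?mul1r ?hs// ltnW.
Qed.

Let inv_bounds (n : nat) : (1 < n)%N -> [/\ 0 < rt n, 0 < s n,
  rt n ^- 3 <= (s n)^-1%R & (s n)^-1%R <= (k^-1)%R * rt n ^- 3].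
Proof.
case/andP: k01 => k0 k1 n1; have /andP[h1 h2] := hs n1.
have r0 : 0 < rt n by rewrite sqrtr_gt0 ltr0n ltnW.
have r3 : 0 < rt n ^+ 3 by rewrite exprn_gt0.
have s0 : 0 < s n by apply: lt_le_trans h1; rewrite mulr_gt0.
split => //; first by rewrite lef_pV2.
by rewrite -invfM lef_pV2// posrE mulr_gt0.
Qed.

(** Since [s n] has the order of [rt n ^ 3], the condition [a + 1 = 3 b] makes the quotient of order
    [1 / rt n]. It is used with [(a, b)] equal to (5, 2) and (8, 3). *)
Lemma Theta_ratio (c : R) (a b : nat) : 0 < c -> a.+1 = (3 * b)%N ->
  forall n, (1 < n)%N -> c * (rt n)^-1 <= c * rt n ^+ a / s n ^+ b <= c * k ^- b * (rt n)^-1.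
Proof.
case/andP: k01 => k0 k1 c0 ab n n1; have [r0 s0 l u] := inv_bounds n1.
have V0 : 0 <= (s n)^-1%R by rewrite invr_ge0 ltW.
have lb : (rt n ^- 3) ^+ b <= s n ^- b.
  by rewrite -[s n ^- b]exprVn lerXn2r// nnegrE ?invr_ge0 ?exprn_ge0 ?ltW.
have ub : s n ^- b <= ((k^-1)%R * rt n ^- 3) ^+ b.
  by rewrite -exprVn lerXn2r// nnegrE ?mulr_ge0 ?invr_ge0 ?exprn_ge0 ?ltW.
have rE : rt n ^+ a * (rt n ^- 3) ^+ b = (rt n)^-1%R.
  rewrite exprVn -exprM -ab exprS invfM mulrC -mulrA mulVf ?mulr1//.
  by rewrite expf_neq0// lt0r_neq0.
have cn0 : 0 <= c * rt n ^+ a by rewrite mulr_ge0 ?exprn_ge0// ltW.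
have := ler_wpM2l cn0 lb; have := ler_wpM2l cn0 ub.
by rewrite exprMn mulrCA -!mulrA rE exprVn mulrCA => -> ->.
Qed.

Lemma Theta_bound1 : is_Theta (fun n =>
  6 * n%:R `^ (5 / 2) / s n ^+ 2 + 2 * n%:R ^+ 4 / s n ^+ 3) (- (1 / 2)).
Proof.
have kk : 1 < (k^-1)%R by case/andP: k01 => k0 k1; rewrite invf_gt1.
have k2 : 1 < k ^- 2 by rewrite -exprVn exprn_egt1.
have k3 : 1 < k ^- 3 by rewrite -exprVn exprn_egt1.
exists 8, (6 * k ^- 2 + 2 * k ^- 3), 1%N; split => //; first lra.
move=> n n1; rewrite (powR_invsqrt (ltnW n1)) (powR_sqrt 5 (ltnW n1)) natX4.
have /andP[h1 h2] := @Theta_ratio 6 5 2 ltac:(lra) erefl n n1.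
have /andP[h3 h4] := @Theta_ratio 2 8 3 ltac:(lra) erefl n n1.
by rewrite mulrDl; apply/andP; split; lra.
Qed.

Lemma Theta_bound2 : is_Theta (fun n => 14 * n%:R ^+ 4 / s n ^+ 3) (- (1 / 2)).
Proof.
have kk : 1 < (k^-1)%R by case/andP: k01 => k0 k1; rewrite invf_gt1.
have k3 : 1 < k ^- 3 by rewrite -exprVn exprn_egt1.
exists 14, (14 * k ^- 3), 1%N; split => //; first lra.
move=> n n1; rewrite (powR_invsqrt (ltnW n1)) natX4.
exact: (@Theta_ratio 14 8 3 ltac:(lra) erefl n n1).
Qed.

End Growth.

Theorem theorem1p1 (R : realType) (f : R -> R)
    (hf : is_density `[0, pi / 2] f)
    (d : nat -> measure_display) (T : forall n : nat, measurableType (d n))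
    (P : forall n : nat, probability (T n) R)
    (theta phi : forall n : nat, 'I_n -> {RV (P n) >-> R})
    (hchords : forall n : nat, iid_random_chords f (theta n) (phi n)) :
  let Fn (n : nat) : T n -> R := region_count (theta n) (phi n) in
  let sigman (n : nat) : R := sigma (P n) (Fn n) in
  let bound1 (n : nat) : R :=
    6 * n%:R `^ (5 / 2) / sigman n ^+ 2 + 2 * n%:R ^+ 4 / sigman n ^+ 3 in
  let bound2 (n : nat) : R := 14 * n%:R ^+ 4 / sigman n ^+ 3 in
  [/\ is_Theta (fun n => mean (P n) (Fn n)) 2,
      is_Theta sigman (3 / 2),
      forall n : nat, (5 < n)%N ->
        (smooth_distance (P n) (standardized (P n) (Fn n))
           <= (bound1 n)%:E)%E /\
        (kolmogorov_distance (P n) (standardized (P n) (Fn n))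
           <= (bound2 n)%:E)%E
    & is_Theta bound1 (- (1 / 2)) /\ is_Theta bound2 (- (1 / 2))].
Proof.
move=> Fn sigman bound1 bound2.
have [h1 h2 _] := (hchords 1%N).1 ord0.
(* All sample sizes share the law of a single chord, read off here from the only chord of the case
   [n = 1]; hence the constant [k] below does not depend on [n]. *)
pose nuT : probability R R := distribution (P 1%N) (theta 1%N ord0).
pose nuP : probability R R := distribution (P 1%N) (phi 1%N ord0).
have hT (A : set R) : measurable A ->
  (nuT A = \int[lebesgue_measure]_(x in A `&` `[0%R, (pi / 2)%R]) (f x)%:E)%E by exact: h1.
have hP (A : set R) : measurable A -> nuP A = uniform_prob (@two_pi_gt0 R) A by exact: h2.
pose mu := chord_law nuT nuP.
have v0 : 0 < var1U mu (@ckernel R) := var1U_ckernel_gt0 hf hT hP.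
have p0 : 0 < meanU mu (@ckernel R) := meanU_ckernel_gt0 hf hT hP.
have /andP[_ p1] := meanU_bounds mu measurable_ckernel ckernel_ge0 ckernel_le1.
have vle := vardU_var1U mu measurable_ckernel ckernel_ge0 ckernel_le1 ckernel_sym.
have d0 := vardU_ge0 mu (@ckernel R).
pose k := Num.sqrt (var1U mu (@ckernel R)) / 2.
(* The projection has variance at most 1/8, so [k < 1]; the constants in [is_Theta] have to be
   strictly ordered. *)
have k01 : 0 < k < 1.
  rewrite /k divr_gt0 ?sqrtr_gt0//= ltr_pdivrMr// mul1r.
  rewrite -(@ltr_pXn2r _ 2)// ?nnegrE ?sqrtr_ge0// sqr_sqrtr ?(ltW v0)//; lra.
have hs n : (1 < n)%N -> k * Num.sqrt n%:R ^+ 3 <= sigman n <= Num.sqrt n%:R ^+ 3.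
  exact: (sigma_bounds hf (hchords n) hT hP).
split.
- apply: (@Theta_sqr R (meanU mu (@ckernel R))); first by rewrite p0.
  by move=> n; exact: (mean_region_count hf (hchords n) hT hP).
- exact: Theta_sigma k01 hs.
- move=> n n5; have n1 : (1 < n)%N by exact: leq_trans n5.
  have s0 : 0 < sigman n.
    have /andP[h _] := hs _ n1; apply: lt_le_trans h.
    by case/andP: k01 => k0 _; rewrite mulr_gt0// exprn_gt0// sqrtr_gt0 ltr0n ltnW.
  split; last exact: (kolmogorov_distance_le hf (hchords n) hT hP).
  rewrite /bound1 (powR_sqrt 5) ?(ltnW n1)//.
  have -> : Num.sqrt n%:R ^+ 5 = n%:R ^+ 2 * Num.sqrt n%:R :> R.
    transitivity ((Num.sqrt n%:R ^+ 2) ^+ 2 * Num.sqrt n%:R : R).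
      by rewrite -exprM -exprSr.
    by rewrite sqr_sqrtr.
  exact: (smooth_distance_le hf (hchords n) hT hP).
- by split; [exact: Theta_bound1 k01 hs|exact: Theta_bound2 k01 hs].
Qed.
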